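(* Let $\mu$ be a stochastic measure on $(\mathsf S,\mathcal B)$ and let $\mathsf B\subset\mathbb R^d$ be a bounded (Jordan measurable) set. Assume that $h(x,s):\mathsf B\times\mathsf S\to\mathbb R$ is a measurable deterministic function which is Riemann integrable on $\mathsf B$ (as a function of $x$) for each fixed $s\in\mathsf S$, and $|h(x,s)|\le g(s)$ for all $(x,s)$, where $g:\mathsf S\to\mathbb R$ is integrable on $\mathsf S$ with respect to $d\mu(s)$. Then the random function $\xi(x)=\int_{\mathsf S}h(x,s)\,d\mu(s)$ is integrable on $\mathsf B$, and $$\int_{\mathsf B}dx\int_{\mathsf S}h(x,s)\,d\mu(s)=\int_{\mathsf S}d\mu(s)\int_{\mathsf B}h(x,s)\,dx .$$
   Context: $(\Omega,\mathcal F,\mathsf P)$ is a complete probability space and $L_0$ is the set of (equivalence classes of) real-valued random variables on it, with convergence in probability. A random function on $\mathsf B$ is a map $\xi:\mathsf B\to L_0$. Stochastic measure and its integral. $\mathsf S$ is an arbitrary set and $\mathcal B$ a $\sigma$-algebra of subsets of $\mathsf S$. A stochastic measure is a mapping $\mu:\mathcal B\to L_0$ that is $\sigma$-additive (with convergence in probability); no positivity or integrability is assumed. For a simple measurable $g=\sum_k c_k\mathbf 1_{A_k}$, $\int_{A}g\,d\mu=\sum_k c_k\mu(A_k\cap A)$; a measurable deterministic $g:\mathsf S\to\mathbb R$ is integrable with respect to $\mu$ if there are simple functions $g_n\to g$ pointwise such that $\int_A g_n\,d\mu$ converges in probability for each $A\in\mathcal B$, the limit being $\int_A g\,d\mu$.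 (Every bounded measurable $g$ is integrable, and an analogue of the Lebesgue dominated convergence theorem holds.) Riemann integral of a random function. All bounded subsets of $\mathbb R^d$ are assumed Jordan measurable; $\mathsf m$ is Jordan content. $\xi$ has an integral on $\mathsf B$ if for any sequence of partitions $\mathsf B=\bigcup_{1\le k\le k_n}\mathsf B_{kn}$ into Jordan measurable sets without common interior points, with $\max_k\operatorname{diam}\mathsf B_{kn}\to0$, and any $x_{kn}\in\mathsf B_{kn}$, the limit in probability $\lim_n\sum_k\xi(x_{kn})\mathsf m(\mathsf B_{kn})=:\int_{\mathsf B}\xi(x)\,dx$ exists (it is then independent of the choices). $\xi$ is integrable on $\mathsf B$ if it has an integral on $\mathsf B$ and $\{\xi(x):x\in\mathsf B\}$ is bounded in probability. For deterministic functions this is the usual Riemann integral over Jordan measurable sets. *)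

(* Defs.v *)
From HB Require Import structures.
From mathcomp Require Import all_boot all_order all_algebra.
From mathcomp Require Import all_classical all_reals all_analysis.

Set Implicit Arguments.
Unset Strict Implicit.
Unset Printing Implicit Defensive.
Import Order.TTheory GRing.Theory Num.Theory.
Import numFieldNormedType.Exports.
Import HBSimple.

Local Open Scope classical_set_scope.
Local Open Scope ring_scope.
Local Open Scope quotient_scope.

Definition L0 (R : realType) (dO : measure_display) (Omega : measurableType dO)
    (P : probability Omega R) : Type :=
  {mfun_ P, Omega >-> measurableTypeR R}.

(* A representative of the class.  All the notions below that are stated through
   it only depend on the class. *)
Definition L0_fun (R : realType) (dO : measure_display)
    (Omega : measurableType dO) (P : probability Omega R) (X : L0 P) :
    Omega -> R :=
  aqEqMfun_to_fun X.
Coercion L0_fun : L0 >-> Funclass.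

Definition cvg_in_prob (R : realType) (dO : measure_display)
    (Omega : measurableType dO) (P : probability Omega R)
    (X : nat -> Omega -> R) (Y : Omega -> R) : Prop :=
  forall eps : R, 0 < eps ->
    P [set w | eps <= `|X n w - Y w|] @[n --> \oo] --> 0%E.

Section StochasticMeasure.
Context (R : realType) (dO dS : measure_display) (Omega : measurableType dO)
  (P : probability Omega R) (S : measurableType dS).

Definition L0_zero : L0 P :=
  \pi_({mfun_ P, Omega >-> measurableTypeR R}) (cst 0).

(* Only the values of [mu] on measurable sets are relevant.  Taking all the
   [A k] empty gives [mu set0 = 0], hence finite additivity. *)
Definition stochastic_measure (mu : set S -> L0 P) : Prop :=
  forall A : nat -> set S,
    (forall k, measurable (A k)) -> trivIset setT A ->
    cvg_in_prob P (fun n w => \sum_(k < n) mu (A k) w) (mu (\bigcup_k A k)).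

Definition simple_int (mu : set S -> L0 P) (A : set S) (g : {sfun S >-> R}) :
    Omega -> R :=
  fun w => \sum_(c \in range g) c * mu (g @^-1` [set c] `&` A) w.

Definition is_indefinite_int (mu : set S -> L0 P) (g : S -> R)
    (I : set S -> L0 P) : Prop :=
  exists gn : nat -> {sfun S >-> R},
    (forall s, gn n s @[n --> \oo] --> g s) /\
    (forall A, measurable A ->
       cvg_in_prob P (fun n => simple_int mu A (gn n)) (I A)).

Definition sm_integrable (mu : set S -> L0 P) (g : S -> R) : Prop :=
  measurable_fun setT g /\ exists I, is_indefinite_int mu g I.

(* [L0_zero] is the default value when [g] is not integrable. *)
Definition sm_int (mu : set S -> L0 P) (A : set S) (g : S -> R) : L0 P :=
  xget L0_zero [set I A | I in is_indefinite_int mu g].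

End StochasticMeasure.

Section Jordan.
Context (R : realType) (d : nat).
Local Notation E := 'rV[R]_d.

Definition box (a b : E) : set E :=
  [set x | forall i, a ord0 i <= x ord0 i < b ord0 i].

Definition box_volume (a b : E) : R :=
  \prod_(i < d) Num.max 0 (b ord0 i - a ord0 i).

Definition outer_content (A : set E) : R :=
  inf [set v | exists (n : nat) (a b : 'I_n -> E),
    A `<=` \bigcup_i box (a i) (b i) /\ v = \sum_(i < n) box_volume (a i) (b i)].

Definition inner_content (A : set E) : R :=
  sup [set v | exists (n : nat) (a b : 'I_n -> E),
    [/\ \bigcup_i box (a i) (b i) `<=` A,
        trivIset setT (fun i => box (a i) (b i)) &
        v = \sum_(i < n) box_volume (a i) (b i)]].

Definition jordan_measurable (A : set E) : Prop :=
  bounded_set A /\ inner_content A = outer_content A.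

Definition jordan_content (A : set E) : R := outer_content A.

(* The norm of the library on row vectors is the sup norm. *)
Definition eucl_dist (x y : E) : R :=
  Num.sqrt (\sum_(i < d) (x ord0 i - y ord0 i) ^+ 2).

Definition diameter (A : set E) : R :=
  sup [set eucl_dist xy.1 xy.2 | xy in A `*` A].

(* The size may be 0 only when [B] is empty. *)
Record tagged_partition (B : set E) := TaggedPartition {
  tp_size : nat ;
  tp_cell : 'I_tp_size -> set E ;
  tp_tag : 'I_tp_size -> E ;
  tp_cover : \bigcup_i tp_cell i = B ;
  tp_jordan : forall i, jordan_measurable (tp_cell i) ;
  tp_interior : forall i j, i != j -> (tp_cell i)° `&` (tp_cell j)° = set0 ;
  tp_tagP : forall i, tp_cell i (tp_tag i) }.

Definition mesh (B : set E) (p : tagged_partition B) : R :=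
  \big[Num.max/0]_(i < tp_size p) diameter (tp_cell i).

Definition riemann_sum (B : set E) (f : E -> R) (p : tagged_partition B) : R :=
  \sum_(i < tp_size p) f (tp_tag i) * jordan_content (tp_cell i).

Definition fine_partitions (B : set E) (p : nat -> tagged_partition B) : Prop :=
  mesh (p n) @[n --> \oo] --> (0 : R).

Definition riemann_integrable (B : set E) (f : E -> R) : Prop :=
  (exists M : R, forall x, B x -> `|f x| <= M) /\
  (forall p : nat -> tagged_partition B, fine_partitions p ->
     exists I : R, riemann_sum f (p n) @[n --> \oo] --> I).

(* Value 0 when the Riemann sums have no common limit. *)
Definition riemann_int (B : set E) (f : E -> R) : R :=
  xget 0 [set I : R | forall p : nat -> tagged_partition B, fine_partitions p ->
    riemann_sum f (p n) @[n --> \oo] --> I].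

Section RandomFunction.
Context (dO : measure_display) (Omega : measurableType dO)
  (P : probability Omega R).

Definition random_riemann_sum (B : set E) (xi : E -> L0 P)
    (p : tagged_partition B) : Omega -> R :=
  fun w => riemann_sum (fun x => xi x w) p.

Definition rf_has_int (B : set E) (xi : E -> L0 P) : Prop :=
  forall p : nat -> tagged_partition B, fine_partitions p ->
    exists I : L0 P, cvg_in_prob P (fun n => random_riemann_sum xi (p n)) I.

Definition bounded_in_prob (B : set E) (xi : E -> L0 P) : Prop :=
  forall eps : R, 0 < eps -> exists c : R, forall x, B x ->
    (P [set w | (c < `|xi x w|)%R] <= eps%:E)%E.

Definition rf_integrable (B : set E) (xi : E -> L0 P) : Prop :=
  rf_has_int B xi /\ bounded_in_prob B xi.

Definition rf_int (B : set E) (xi : E -> L0 P) : L0 P :=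
  xget (L0_zero P) [set I : L0 P | forall p : nat -> tagged_partition B,
    fine_partitions p ->
    cvg_in_prob P (fun n => random_riemann_sum xi (p n)) I].

End RandomFunction.

(* Measurability of the restriction of [h] to [B * S] for the product of the
   Borel sigma-algebra of [B] and the sigma-algebra of [S], that is, for the
   trace on [B * S] of the product sigma-algebra.  A Jordan measurable [B] need
   not be Borel, and the library's [measurable_fun] holds vacuously on a domain
   that is not measurable. *)
Definition jointly_measurable (dS : measure_display) (S : measurableType dS)
    (B : set E) (h : E -> S -> R) : Prop :=
  forall Y : set R, measurable Y ->
    exists2 C : set (g_sigma_algebraType (@open E) * S), measurable C &
      (B `*` setT) `&` [set xs | Y (h xs.1 xs.2)] = (B `*` setT) `&` C.

End Jordan.

(* Main.v *)
Require Import Defs.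
From HB Require Import structures.
From mathcomp Require Import all_boot all_order all_algebra finmap.
From mathcomp Require Import all_classical all_reals all_analysis.
From mathcomp Require Import measurable_realfun.
From mathcomp Require Import ring lra.
Set Implicit Arguments.
Unset Strict Implicit.
Unset Printing Implicit Defensive.
Import Order.TTheory GRing.Theory Num.Theory.
Import numFieldNormedType.Exports.
Import HBSimple HBNNSimple.
Local Open Scope ring_scope.

(* The Riemann sums of the random function are the integrals with respect to mu
   of the Riemann sums S_n of h(., s).  These converge pointwise and are dominated
   by C |g|, where C is the volume of a cube containing B, so the theorem follows
   from a dominated convergence theorem for mu.

   L0 is not locally convex, so domination rests on two theorems about additive
   functions with values in L0.  The first, due to Talagrand and to Kalton, Peck
   and Roberts, says that the integrals of the simple functions bounded by 1 are
   bounded in probability.  Otherwise, label at random the pieces of a partition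
   of an unbounded set: with large probability the pieces with a given label
   contain a set whose measure is not small, while the remaining pieces are still
   unbounded; iterating gives disjoint sets whose measures do not tend to 0.  The
   second is Nikodym's theorem on the uniform countable additivity of setwise
   convergent measures.  Together with a multiplier inequality, which bounds
   sums a_i nu(B_i) with |a_i| <= 1 by the values of nu on unions of the B_i,
   they show that the simple functions dominated by an integrable g have
   uniformly countably additive integrals. *)

(** * Random choices on finite sets *)

(** Elements of L0 need not have moments: only probabilities of exceeding a level are available. The
    key estimates are therefore proved at a fixed outcome, as inequalities between indicators
    averaged over finitely many random signs and labels, and then integrated over [Omega]. This is
    why they are linear in indicators and carry explicit constants.

    The hard point is that unboundedness makes the measure of a random part non-small. Sets [E j]
    are chosen one after the other, each with a value far beyond the values of the cells cut out by
    the earlier ones. Let [x i] be the values on the final cells. If many [x i] are at least 1 in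
    modulus, or the others have a large sum of squares, or one of certain normalised sums of the
    others is large, then random weighted sums over the selected part reach 1 with a fixed
    probability. Otherwise a few cells account for all the large values; but each large [E j] must
    separate two of these cells that the earlier sets left together, and this can happen at most as
    often as there are such cells. *)

Section FiniteProductExpectation.
Context (R : realFieldType) (I V : finType).
Implicit Types (w u : I -> V -> R) (r : {ffun I -> V}) (phi psi : {ffun I -> V} -> R).

Definition upd r i v : {ffun I -> V} := [ffun j => if j == i then v else r j].

Definition fexp w phi : R := \sum_(r : {ffun I -> V}) (\prod_i w i (r i)) * phi r.

Lemma upd_same r i v : upd r i v i = v.
Proof. by rewrite ffunE eqxx. Qed.

Lemma upd_other r i v j : j != i -> upd r i v j = r j.
Proof. by move=> ji; rewrite ffunE (negbTE ji). Qed.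

Lemma fexpD w phi psi : fexp w (fun r => phi r + psi r) = fexp w phi + fexp w psi.
Proof. by rewrite -big_split; apply: eq_bigr => r _; rewrite mulrDr. Qed.

Lemma fexpZ w c phi : fexp w (fun r => c * phi r) = c * fexp w phi.
Proof. by rewrite mulr_sumr; apply: eq_bigr => r _; rewrite mulrCA. Qed.

Lemma eq_fexp w phi psi : phi =1 psi -> fexp w phi = fexp w psi.
Proof. by move=> e; apply: eq_bigr => r _; rewrite e. Qed.

Lemma fexpB w phi psi : fexp w (fun r => phi r - psi r) = fexp w phi - fexp w psi.
Proof.
rewrite fexpD; congr (_ + _).
by rewrite -mulN1r -fexpZ; apply: eq_fexp => r; rewrite mulN1r.
Qed.

Lemma fexp_sum w (J : finType) (F : J -> {ffun I -> V} -> R) :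
  fexp w (fun r => \sum_j F j r) = \sum_j fexp w (F j).
Proof.
by rewrite exchange_big; apply: eq_bigr => r _; rewrite mulr_sumr.
Qed.

Section Normalised.
Context (w : I -> V -> R) (w_ge0 : forall i v, 0 <= w i v)
  (w_sum1 : forall i, \sum_v w i v = 1).

Lemma fexp_le phi psi : (forall r, phi r <= psi r) -> fexp w phi <= fexp w psi.
Proof.
by move=> le; apply: ler_sum => r _; rewrite ler_wpM2l// prodr_ge0.
Qed.

Lemma fexp_cst c : fexp w (fun=> c) = c.
Proof.
by rewrite /fexp -mulr_suml -bigA_distr_bigA /= big1 ?mul1r.
Qed.

(** Exchanging the coordinate [r i] with an independent copy [v] preserves the product weight.
    Conditioning on all coordinates but one always goes through this identity. *)
Lemma fexp_resample i phi :
  fexp w phi = fexp w (fun r => \sum_v w i v * phi (upd r i v)).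
Proof.
pose W r := \prod_j w j (r j).
pose sw (p : {ffun I -> V} * V) := (upd p.1 i p.2, p.1 i).
have swK : involutive sw.
  move=> [r v]; rewrite /sw /= upd_same; congr pair.
  by apply/ffunP => j; rewrite !ffunE; case: eqP => // ->.
have W_upd r v : W (upd r i v) * w i (r i) = W r * w i v.
  rewrite /W (bigD1 i)// [X in _ = X * _](bigD1 i)//= upd_same.
  rewrite (eq_bigr (fun j => w j (r j))); first by ring.
  by move=> j ji; rewrite upd_other.
transitivity (\sum_(p : {ffun I -> V} * V) W p.1 * w i p.2 * phi p.1).
  rewrite -(pair_bigA _ (fun r v => W r * w i v * phi r)) /=.
  apply: eq_bigr => r _; rewrite -mulr_suml -mulr_sumr w_sum1 mulr1.
  by [].
rewrite (reindex_inj (inv_inj swK)) /=.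
rewrite -(pair_bigA _ (fun r v => W (upd r i v) * w i (r i) * phi (upd r i v))) /=.
apply: eq_bigr => r _; rewrite mulr_sumr; apply: eq_bigr => v _.
by rewrite W_upd mulrA.
Qed.

Lemma fexp_ge_coord i phi c :
  (forall r, c <= \sum_v w i v * phi (upd r i v)) -> c <= fexp w phi.
Proof. by move=> H; rewrite (fexp_resample i) -[c]fexp_cst fexp_le. Qed.

Section Moments.
Context (u : I -> V -> R) (u_centered : forall i, \sum_v w i v * u i v = 0).

Let Z (s : seq I) r : R := \sum_(i <- s) u i (r i).

Let Z_upd s i r v : i \notin s -> Z s (upd r i v) = Z s r.
Proof.
move=> si; apply: eq_big_seq => j js; rewrite upd_other//.
by apply: contraNneq si => <-.
Qed.

Let Z_cons i s r v : i \notin s -> Z (i :: s) (upd r i v) = Z s r + u i v.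
Proof. by move=> si; rewrite addrC -(Z_upd r v si) /Z big_cons upd_same. Qed.

Let mean_Z s : uniq s -> fexp w (Z s) = 0.
Proof.
elim: s => [|i s IH] /=; first by move=> _; rewrite /Z -[RHS]fexp_cst;
  under eq_fexp do rewrite big_nil.
move=> /andP[si us]; rewrite (fexp_resample i) -[RHS](IH us).
apply: eq_fexp => r /=; under eq_bigr do rewrite Z_cons// mulrDr.
by rewrite big_split /= u_centered addr0 -mulr_suml w_sum1 mul1r.
Qed.

Let second_Z s : uniq s ->
  fexp w (fun r => Z s r ^+ 2) = \sum_(i <- s) \sum_v w i v * u i v ^+ 2.
Proof.
elim: s => [|i s IH] /=.
  move=> _; rewrite big_nil -[RHS]fexp_cst; apply: eq_fexp => r.
  by rewrite /Z big_nil expr0n.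
move=> /andP[si us]; rewrite big_cons -(IH us) (fexp_resample i) addrC -[X in _ = _ + X]fexp_cst
  -fexpD.
apply: eq_fexp => r /=.
under eq_bigr do rewrite Z_cons//.
transitivity (\sum_v (Z s r ^+ 2 * w i v + 2 * Z s r * (w i v * u i v) + w i v * u i v ^+ 2)).
  by apply: eq_bigr => v _; ring.
by rewrite !big_split /= -!mulr_sumr w_sum1 u_centered mulr0 addr0 mulr1.
Qed.

Lemma second_moment :
  fexp w (fun r => (\sum_i u i (r i)) ^+ 2) = \sum_i \sum_v w i v * u i v ^+ 2.
Proof. exact/second_Z/index_enum_uniq. Qed.

(** A new independent centred term adds [6 * s2 * E(Z^2) + s4] to the fourth moment, since the terms
    of odd degree in [Z] have mean 0. The first summand is the cross term in the expansion of
    [3 * (E(Z^2) + s2)^2]. *)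
Let fourth_Z s : uniq s ->
  fexp w (fun r => Z s r ^+ 4) <=
  3 * (\sum_(i <- s) \sum_v w i v * u i v ^+ 2) ^+ 2
    + \sum_(i <- s) \sum_v w i v * u i v ^+ 4.
Proof.
elim: s => [|i s IH] /=.
  move=> _; rewrite !big_nil expr0n /= mulr0 addr0 -[leRHS]fexp_cst fexp_le// => r.
  by rewrite /Z big_nil expr0n.
move=> /andP[si us]; rewrite !big_cons.
set s2 := \sum_v w i v * u i v ^+ 2; set s3 := \sum_v w i v * u i v ^+ 3.
set s4 := \sum_v w i v * u i v ^+ 4.
have s2_ge0 : 0 <= s2 by apply: sumr_ge0 => v _; rewrite mulr_ge0// sqr_ge0.
rewrite (fexp_resample i).
have -> : fexp w (fun r => \sum_v w i v * Z (i :: s) (upd r i v) ^+ 4) =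
   fexp w (fun r => Z s r ^+ 4 + ((6 * s2) * Z s r ^+ 2 + (4 * s3 * Z s r + s4))).
  apply: eq_fexp => r /=.
  under eq_bigr do rewrite Z_cons//.
  transitivity (\sum_v (Z s r ^+ 4 * w i v + 4 * Z s r ^+ 3 * (w i v * u i v) +
     6 * Z s r ^+ 2 * (w i v * u i v ^+ 2) + 4 * Z s r * (w i v * u i v ^+ 3)
     + w i v * u i v ^+ 4)).
    by apply: eq_bigr => v _; ring.
  rewrite !big_split /= -!mulr_sumr w_sum1 u_centered -/s2 -/s3 -/s4; ring.
rewrite fexpD fexpD fexpD !fexpZ fexp_cst mean_Z// second_Z//.
have := IH us; set A := fexp w _; set B := \sum_(j <- s) _; set D := \sum_(j <- s) _.
by move=> IHs; nra.
Qed.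

Lemma fourth_moment :
  fexp w (fun r => (\sum_i u i (r i)) ^+ 4) <=
  3 * (\sum_i \sum_v w i v * u i v ^+ 2) ^+ 2 + \sum_i \sum_v w i v * u i v ^+ 4.
Proof. exact/fourth_Z/index_enum_uniq. Qed.

End Moments.
End Normalised.
End FiniteProductExpectation.

(** * Uniform random signs and labels *)

Section UniformExpectation.
Context (R : realFieldType).

Definition unif_exp (I V : finType) (phi : {ffun I -> V} -> R) : R :=
  fexp (fun _ _ => #|V|%:R^-1) phi.

Definition bool_ind (b : bool) : R := b%:R.

Definition bool_sign (b : bool) : R := (-1) ^+ b.

Definition selected (I : finType) (M : nat) (l : {ffun I -> 'I_M.+1}) (i : I) :=
  l i == ord0.

Lemma sgr_boolE : (bool_sign true = -1) * (bool_sign false = 1).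
Proof. by rewrite /bool_sign expr0 expr1. Qed.

Lemma unif_ge0 (V : finType) : 0 <= #|V|%:R^-1 :> R.
Proof. by rewrite invr_ge0 ler0n. Qed.

Lemma unif_sum1 (V : finType) : (0 < #|V|)%N -> \sum_(v : V) #|V|%:R^-1 = 1 :> R.
Proof.
by move=> V0; rewrite sumr_const -[_ *+ _]mulr_natr mulVf// pnatr_eq0 -lt0n.
Qed.

Section Nonempty.
Context (I V : finType) (V_gt0 : (0 < #|V|)%N).
Implicit Types phi psi : {ffun I -> V} -> R.

Lemma uexp_le phi psi : (forall r, phi r <= psi r) -> unif_exp phi <= unif_exp psi.
Proof. by apply: fexp_le => _ _; exact: unif_ge0. Qed.

Lemma uexp_cst c : unif_exp (fun _ : {ffun I -> V} => c) = c.
Proof. by apply: fexp_cst => _; exact: unif_sum1. Qed.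

Lemma uexp_const_le c phi : (forall r, c <= phi r) -> c <= unif_exp phi.
Proof. by move=> H; rewrite -[c]uexp_cst uexp_le. Qed.

Lemma uexp_ge0 phi : (forall r, 0 <= phi r) -> 0 <= unif_exp phi.
Proof. exact: uexp_const_le. Qed.

End Nonempty.

Lemma card_bool_gt0 : (0 < #|{: bool}|)%N. Proof. by rewrite card_bool. Qed.
Lemma card_lab_gt0 M : (0 < #|'I_M.+1|)%N. Proof. by rewrite card_ord. Qed.

Section Signs.
Context (I : finType) (z : I -> R).
Let Z (r : {ffun I -> bool}) : R := \sum_i bool_sign (r i) * z i.

(** Given the other signs, the two possible values of [Z] differ by [2 * z i0], so one of them has
    modulus at least [|z i0|]. *)
Lemma sign_small_ball i0 : 2^-1 <= unif_exp (fun r => bool_ind (`|z i0| <= `|Z r|)).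
Proof.
apply: (@fexp_ge_coord _ _ _ _ _ _ i0) => [i v|i|r].
- exact: unif_ge0.
- exact/unif_sum1/card_bool_gt0.
pose rest := \sum_(i | i != i0) bool_sign (r i) * z i.
have Zv v : Z (upd r i0 v) = bool_sign v * z i0 + rest.
  rewrite /Z (bigD1 i0)//= upd_same; congr (_ + _).
  by apply: eq_bigr => i ii0; rewrite upd_other.
rewrite big_bool !Zv card_bool !sgr_boolE !mul1r mulN1r /bool_ind /=.
have : (`|z i0| <= `|- z i0 + rest|) || (`|z i0| <= `|z i0 + rest|).
  case: leP => //= h1; case: leP => // h2.
  exfalso; have := ler_normB (z i0 + rest) (- z i0 + rest).
  have -> : z i0 + rest - (- z i0 + rest) = 2 * z i0 by ring.
  by rewrite normrM ger0_norm// => H; lra.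
have half b : 0 <= 2^-1 * (b : bool)%:R :> R by rewrite mulr_ge0 ?ler0n ?invr_ge0.
by case/orP => ->; rewrite mulr1 ?lerDl ?lerDr half.
Qed.

(* Paley-Zygmund, with the optimal pointwise minorant of the indicator by a
   polynomial of degree 2 in [Z ^ 2]. *)
Lemma sign_paley_zygmund : 0 < \sum_i z i ^+ 2 ->
  13^-1 <= unif_exp (fun r => bool_ind ((\sum_i z i ^+ 2) / 2 <= Z r ^+ 2)).
Proof.
set S := \sum_i _ => S_gt0.
have sum1 : forall i : I, \sum_(v : bool) #|{: bool}|%:R^-1 = 1 :> R.
  by move=> _; exact/unif_sum1/card_bool_gt0.
pose u (i : I) v := bool_sign v * z i.
have u0 i : \sum_v #|{: bool}|%:R^-1 * u i v = 0.
  by rewrite big_bool /= /u !sgr_boolE; ring.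
have u2 i : \sum_v #|{: bool}|%:R^-1 * u i v ^+ 2 = z i ^+ 2.
  by rewrite big_bool /= /u !sgr_boolE card_bool; field.
have u4 i : \sum_v #|{: bool}|%:R^-1 * u i v ^+ 4 = z i ^+ 4.
  by rewrite big_bool /= /u !sgr_boolE card_bool; field.
have m2 : unif_exp (fun r => Z r ^+ 2) = S.
  rewrite /unif_exp (second_moment sum1 u0).
  by apply: eq_bigr => i _; exact: u2.
have m4 : unif_exp (fun r => Z r ^+ 4) <= 3 * S ^+ 2 + S ^+ 2.
  have := fourth_moment (fun _ _ => unif_ge0 _) sum1 u0.
  rewrite (eq_bigr _ (fun i _ => u2 i)) (eq_bigr _ (fun i _ => u4 i)) -/S.
  move=> /le_trans; apply; rewrite lerD2l expr2 mulr_suml ler_sum// => i _.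
  rewrite -[4%N]/(2 + 2)%N exprD ler_wpM2l ?sqr_ge0// /S (bigD1 i)//= lerDl.
  by apply: sumr_ge0 => j _; exact: sqr_ge0.
clear sum1 u0 u2 u4.
(* With [y = Z^2 / S] this is [(56 y - 4 y^2 - 27) / 169]: it vanishes at [y = 1/2], is negative
   below, and has maximum 1 at [y = 7]. As [E y = 1] and [E y^2 <= 4], its mean is at least
   [13 / 169]. *)
pose p r : R := 56 / (169 * S) * Z r ^+ 2 - 4 / (169 * S ^+ 2) * Z r ^+ 4 - 27 / 169.
apply: (@le_trans _ _ (unif_exp p)).
  rewrite /unif_exp /p !fexpB !fexpZ -![fexp _ _]/(unif_exp _) m2 uexp_cst ?card_bool//.
  have : 4 / (169 * S ^+ 2) * unif_exp (fun r => Z r ^+ 4) <= 4 / (169 * S ^+ 2) * (4 * S ^+ 2).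
    rewrite ler_wpM2l ?divr_ge0 ?mulr_ge0 ?sqr_ge0 ?(ltW S_gt0)//.
    by move: m4; lra.
  have -> : 4 / (169 * S ^+ 2) * (4 * S ^+ 2) = 16 / 169 by field; rewrite gt_eqF.
  have -> : 56 / (169 * S) * S = 56 / 169 by field; rewrite gt_eqF.
  by lra.
apply: uexp_le => r; rewrite /p /bool_ind.
have [y yE] : exists y, Z r ^+ 2 = y * S.
  by exists (Z r ^+ 2 / S); rewrite divfK ?gt_eqF.
have -> : Z r ^+ 4 = (y * S) ^+ 2 by rewrite -yE -exprM.
rewrite yE.
have -> : 56 / (169 * S) * (y * S) = 56 / 169 * y by field; rewrite gt_eqF.
have -> : 4 / (169 * S ^+ 2) * (y * S) ^+ 2 = 4 / 169 * y ^+ 2 by field; rewrite gt_eqF.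
have -> : (S / 2 <= y * S) = (1 <= 2 * y).
  by rewrite ler_pdivrMr// -[leLHS]mul1r mulrAC ler_pM2r// mulrC.
case: (leP 1 (2 * y)) => /= hy.
  have : 0 <= y ^+ 2 - 14 * y + 49.
    by rewrite (_ : _ + 49 = (y - 7) ^+ 2) ?sqr_ge0//; ring.
  by lra.
have : 0 <= (1 - 2 * y) * (27 - 2 * y) by rewrite mulr_ge0//; lra.
by rewrite (_ : _ * _ = 27 - 56 * y + 4 * y ^+ 2); [lra | ring].
Qed.

End Signs.
Section Selection.
Context (I : finType) (M : nat).
Let N : R := M.+1%:R.
Let N_gt0 : 0 < N. Proof. exact: ltr0Sn. Qed.
Let sum1 (i : I) : \sum_(v : 'I_M.+1) #|'I_M.+1|%:R^-1 = 1 :> R.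
Proof. exact/unif_sum1/card_lab_gt0. Qed.

Let sum_select a b :
  \sum_(v : 'I_M.+1) #|'I_M.+1|%:R^-1 * (if v == ord0 then a else b) =
  a / N + (1 - N^-1) * b.
Proof.
rewrite (bigD1 ord0)//= (eq_bigr (fun=> N^-1 * b)); last first.
  by move=> v /negbTE ->; rewrite card_ord.
rewrite sumr_const cardC1 card_ord /= -[_ *+ M]mulr_natl -/N.
have -> : M%:R = N - 1 by rewrite /N -natr1; ring.
by field; rewrite nat1r pnatr_eq0.
Qed.

(** The probability is exactly [(1 - 1/N)^#|J|]; the rational bound follows by induction from
    [(1 - t) (1 + (n + 1) t) <= 1 + n t] with [t = 1/N]. *)
Lemma uexp_avoid (J : {set I}) :
  unif_exp (fun l : {ffun I -> 'I_M.+1} => bool_ind [forall i in J, ~~ selected l i]) <=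
  (1 + #|J|%:R / N)^-1.
Proof.
have E s : uniq s -> unif_exp (fun l : {ffun I -> 'I_M.+1} =>
    bool_ind (all (fun i => ~~ selected l i) s)) = (1 - N^-1) ^+ size s.
  elim: s => [|i s IH] /=; first by rewrite expr0 /bool_ind /= uexp_cst// card_ord.
  move=> /andP[si us]; rewrite exprS -(IH us) {1}/unif_exp (fexp_resample sum1 i) -fexpZ.
  apply: eq_fexp => l.
  under eq_bigr => v _.
    have -> : bool_ind (~~ selected (upd l i v) i && all (fun j => ~~ selected (upd l i v) j) s)
       = if v == ord0 then 0 else bool_ind (all (fun j => ~~ selected l j) s).
      rewrite /selected upd_same; case: (v == ord0) => //=.
      congr bool_ind; apply: eq_in_all => j js; rewrite upd_other//.
      by apply: contraNneq si => <-.
    over.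
  by rewrite sum_select mul0r add0r.
have -> : unif_exp (fun l : {ffun I -> 'I_M.+1} => bool_ind [forall i in J, ~~ selected l i]) =
    (1 - N^-1) ^+ #|J|.
  rewrite cardE -E ?enum_uniq//; apply: eq_fexp => l; congr bool_ind.
  apply/forall_inP/allP => H i; first by rewrite mem_enum => /H.
  by move=> iJ; apply: H; rewrite mem_enum.
rewrite -[leRHS]mul1r ler_pdivlMr; last first.
  by rewrite ltr_wpDr// divr_ge0// ltW.
have Ni : 0 < N^-1 <= 1 by rewrite invr_gt0 N_gt0 invf_le1// ler1n.
elim: #|J| => [|n IH]; first by rewrite mul0r addr0 expr0 mulr1.
rewrite exprS; apply: le_trans IH.
rewrite [leLHS](_ : _ = (1 - N^-1) ^+ n * ((1 - N^-1) * (1 + n.+1%:R / N))); last by ring.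
apply: ler_wpM2l; first by rewrite exprn_ge0// subr_ge0; case/andP: Ni.
rewrite -natr1; have : 0 <= n%:R / N by rewrite divr_ge0// ltW.
rewrite [(n%:R + 1) / N]mulrDl mul1r; case/andP: Ni.
move: (N^-1) => t t0 _ a0.
rewrite -subr_ge0 [leRHS](_ : _ = t * (n%:R * t) + t ^+ 2); last by ring.
by rewrite addr_ge0 ?sqr_ge0// mulr_ge0// ltW.
Qed.

Lemma uexp_hit (J : {set I}) :
  unif_exp (fun l : {ffun I -> 'I_M.+1} => bool_ind [exists i in J, selected l i]) <=
  #|J|%:R / N.
Proof.
apply: (@le_trans _ _ (unif_exp (fun l : {ffun I -> 'I_M.+1} =>
  \sum_i bool_ind ((i \in J) && selected l i)))).
  apply: uexp_le => l; rewrite {1}/bool_ind.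
  case: existsP => [[i H]|_] /=; last by rewrite sumr_ge0// => i _; exact: ler0n.
  by rewrite (bigD1 i)//= H lerDl sumr_ge0// => j _; exact: ler0n.
rewrite /unif_exp fexp_sum mulr_natl -[leRHS]sumr_const [leRHS]big_mkcond ler_sum// => i _.
rewrite (fexp_resample sum1 i) -[leRHS](fexp_cst sum1).
apply: fexp_le => [_ _|l]; first exact: unif_ge0.
under eq_bigr => v _.
  have -> : bool_ind ((i \in J) && selected (upd l i v) i) =
     if v == ord0 then bool_ind (i \in J) else 0.
    by rewrite /selected upd_same; case: (v == _); rewrite ?andbT ?andbF.
  over.
by rewrite sum_select mulr0 addr0 /bool_ind; case: (i \in J); rewrite /= ?mul1r ?mul0r.
Qed.

Lemma uexp_chebyshev (y : I -> R) t : 0 < t ->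
  unif_exp (fun l : {ffun I -> 'I_M.+1} =>
     bool_ind (t <= `|\sum_(i | selected l i) y i - (\sum_i y i) / N|)) <=
  (\sum_i y i ^+ 2) / (N * t ^+ 2).
Proof.
move=> t_gt0.
(* The centred indicator of selection times [y i], of variance [(1/N) (1 - 1/N) (y i)^2]. *)
pose u i (v : 'I_M.+1) := if v == ord0 then (1 - N^-1) * y i else - (N^-1) * y i.
have u0 i : \sum_v #|'I_M.+1|%:R^-1 * u i v = 0.
  by rewrite /u sum_select; field; rewrite nat1r pnatr_eq0.
have u2 i : \sum_v #|'I_M.+1|%:R^-1 * u i v ^+ 2 <= y i ^+ 2 / N.
  under eq_bigr => v _ do rewrite (_ : u i v ^+ 2 =
    if v == ord0 then ((1 - N^-1) * y i) ^+ 2 else (- (N^-1) * y i) ^+ 2) 1?(fun_if (fun z =>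
      z ^+ 2))//.
  rewrite sum_select.
  have Ni : 0 < N^-1 <= 1 by rewrite invr_gt0 N_gt0 invf_le1// ler1n.
  have := sqr_ge0 (y i); set a := y i ^+ 2 => a0.
  rewrite [leLHS](_ : _ = (N^-1 * (1 - N^-1)) * a); last by rewrite /a; ring.
  rewrite [leRHS]mulrC; apply: ler_wpM2r => //; case/andP: Ni => t0 t1.
  by apply: ler_piMr; [exact: ltW | rewrite gerBl ltW].
have Z l : \sum_(i | selected l i) y i - (\sum_i y i) / N = \sum_i u i (l i).
  rewrite mulr_suml big_mkcond -sumrB; apply: eq_bigr => i _.
  by rewrite /u /selected; case: (_ == _); ring.
apply: (@le_trans _ _ (unif_exp (fun l : {ffun I -> 'I_M.+1} =>
  (t ^+ 2)^-1 * (\sum_i u i (l i)) ^+ 2))).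
  apply: uexp_le => l; rewrite Z /bool_ind; case: (leP t) => /= h; last first.
    by rewrite mulr_ge0 ?sqr_ge0// invr_ge0 sqr_ge0.
  rewrite mulrC ler_pdivlMr ?exprn_gt0// mul1r -[leRHS]real_normK ?num_real//.
  by rewrite lerXn2r ?nnegrE// ltW.
rewrite /unif_exp fexpZ (second_moment sum1 u0).
rewrite [leRHS](_ : _ = (t ^+ 2)^-1 * ((\sum_i y i ^+ 2) / N)); last first.
  by rewrite invfM mulrA mulrC.
apply: ler_wpM2l; first by rewrite invr_ge0 sqr_ge0.
by rewrite mulr_suml ler_sum.
Qed.

End Selection.
End UniformExpectation.

(** * Random selections from a finite family of reals *)

Section Core.
Context (R : realFieldType).
Local Notation uexp := (@unif_exp R _ _).
Local Notation ind := (@bool_ind R).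
Local Notation sgr := (@bool_sign R).

Lemma uexp_exchange (I V J W : finType) (F : {ffun I -> V} -> {ffun J -> W} -> R) :
  uexp (fun l => uexp (F l)) = uexp (fun r => uexp (F^~ r)).
Proof.
rewrite /unif_exp /fexp.
etransitivity; first by apply: eq_bigr => l _; rewrite mulr_sumr; reflexivity.
rewrite exchange_big /=; apply: eq_bigr => r _; rewrite mulr_sumr.
by apply: eq_bigr => l _; rewrite mulrCA.
Qed.

Lemma ind_ge0 b : 0 <= ind b. Proof. exact: ler0n. Qed.

Lemma ind_le (b c : bool) : (b -> c) -> ind b <= ind c.
Proof. by rewrite /ind; case: b; case: c => //= /(_ isT). Qed.

Lemma indN b : ind (~~ b) = 1 - ind b.
Proof. by rewrite /ind; case: b; rewrite ?subrr ?subr0. Qed.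

Section Sampling.
Context (I : finType) (M k : nat) (x : I -> R).
Let N : R := M.+1%:R.
Let N_gt0 : 0 < N := ltr0Sn _ _.
Let heavy := [set i | 1 <= `|x i|].
Let light_square := \sum_(i | i \notin heavy) x i ^+ 2.
Hypothesis MK : M.+1 = (100 * k)%N.

Let NE : N = 100 * k%:R. Proof. by rewrite /N MK natrM. Qed.

Definition sign_hits : R := uexp (fun l : {ffun I -> 'I_M.+1} =>
  uexp (fun r : {ffun I -> bool} =>
    ind (1 <= `|\sum_(i | selected l i) sgr (r i) * x i|))).

Let labels_le := @uexp_le R I 'I_M.+1.
Let labels_cst := @uexp_cst R I _ (card_lab_gt0 M).
Let signs_le (J : finType) := @uexp_le R J bool.
Let sum_selected (l : {ffun I -> 'I_M.+1}) (y z : I -> R) :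
  \sum_(i | selected l i) y i * z i = \sum_i y i * (if selected l i then z i else 0).
Proof. by rewrite big_mkcond; apply: eq_bigr => i _; case: ifP; rewrite ?mulr0. Qed.

(** With [k = N / 100] heavy indices the selection meets one of them with probability at least
    1/101, and then the signed sum is at least 1 for half of the signs. *)
Lemma sign_hits_heavy : (k <= #|heavy|)%N -> 300^-1 <= sign_hits.
Proof.
move=> kH; pose avoid (l : {ffun I -> 'I_M.+1}) := [forall i in heavy, ~~ selected l i].
have : uexp (fun l => 2^-1 * (1 - ind (avoid l))) <= sign_hits.
  apply: labels_le => l; rewrite -indN.
  have [|] := boolP (avoid l).
    by move=> _; rewrite /= mulr0 uexp_ge0 ?card_bool// => r; exact: ind_ge0.
  rewrite negb_forall_in => /exists_inP[i0]; rewrite inE negbK => x1 li0.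
  rewrite mulr1.
  apply: le_trans (sign_small_ball (fun i => if selected l i then x i else 0) i0) _.
  apply: signs_le => r; apply: ind_le; rewrite li0 sum_selected.
  exact: le_trans.
rewrite /unif_exp fexpZ fexpB -![fexp _ _]/(uexp _) labels_cst.
have := @uexp_avoid R I M heavy; rewrite -/N -/(avoid _).
set a := uexp _ => a_le a_hits.
have : a <= (1 + 100^-1)^-1.
  apply: le_trans a_le _; rewrite lef_pV2 ?posrE; last 2 first.
  - by rewrite ltr_wpDr// divr_ge0// ltW.
  - by lra.
  rewrite lerD2l ler_pdivlMr// NE.
  by move: kH; rewrite -(ler_nat R); lra.
have -> : (1 + 100^-1)^-1 = 100 / 101 :> R by field.
by move=> ?; lra.
Qed.

Let few_hits : (#|heavy| < k)%N ->
  uexp (fun l : {ffun I -> 'I_M.+1} => ind [exists i in heavy, selected l i]) <= 100^-1.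
Proof.
move=> Hk; apply: le_trans (@uexp_hit R I M heavy) _; rewrite -/N ler_pdivrMr// NE.
by move: (ltnW Hk); rewrite -(ler_nat R); lra.
Qed.

Let light i : i \notin heavy -> x i ^+ 2 <= 1.
Proof.
rewrite inE -ltNge => /ltW x1; rewrite -real_normK ?num_real//.
by rewrite exprn_ile1.
Qed.

(** The selected light squares have total mean at least 8. Each is at most 1, so by Chebyshev their
    sum is at least 4 with probability at least 1/2, and Paley-Zygmund then makes the squared signed
    sum at least 2 with probability 1/13. Selections that meet a heavy index cost at most 1/100. *)
Lemma sign_hits_light : (#|heavy| < k)%N -> 8 * N <= light_square ->
  300^-1 <= sign_hits.
Proof.
move=> Hk D8; set D := light_square in D8; have D_gt0 : 0 < D by apply: lt_le_trans D8;
  rewrite mulr_gt0.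
pose hit (l : {ffun I -> 'I_M.+1}) := [exists i in heavy, selected l i].
pose y i := if i \notin heavy then x i ^+ 2 else 0.
have yD : \sum_i y i = D by rewrite /D /light_square [RHS]big_mkcond.
pose far (l : {ffun I -> 'I_M.+1}) :=
  ind (D / (2 * N) <= `|\sum_(i | selected l i) y i - (\sum_i y i) / N|).
have far_le : uexp far <= 2^-1.
  apply: le_trans (uexp_chebyshev _ _ _) _; first by rewrite divr_gt0// mulr_gt0.
  apply: (@le_trans _ _ (D / (N * (D / (2 * N)) ^+ 2))).
    apply: ler_wpM2r; first by rewrite invr_ge0 mulr_ge0 ?sqr_ge0 ?(ltW N_gt0).
    rewrite -[leRHS]yD ler_sum// => i _.
    rewrite /y; case: ifP => [iH|_]; last by rewrite expr0n.
    by rewrite expr2 ler_piMl ?sqr_ge0// light.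
  have aux (a b : R) : 0 < a -> 0 < b -> a / (b * (a / (2 * b)) ^+ 2) = 4 * b / a.
    by move=> a0 b0; field; rewrite !gt_eqF.
  rewrite aux//.
  by rewrite ler_pdivrMr//; lra.
have inner l : 13^-1 * (1 - ind (hit l) - far l) <= uexp (fun r : {ffun I -> bool} =>
    ind (1 <= `|\sum_(i | selected l i) sgr (r i) * x i|)).
  have [|noH] := boolP (hit l).
    move=> _; apply: (@le_trans _ _ 0); last by rewrite uexp_ge0 ?card_bool// => r; exact: ind_ge0.
    by rewrite /= subrr sub0r mulrN oppr_le0 mulr_ge0 ?invr_ge0 ?ler0n // ind_ge0.
  rewrite {1}/ind /= subr0.
  rewrite /far; have [_|] := leP (D / (2 * N)).
    rewrite /ind /= subrr mulr0.
    by rewrite uexp_ge0 ?card_bool// => r; exact: ind_ge0.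
  rewrite {1}/ind /= subr0 mulr1 yD => near.
  pose z i := if selected l i then x i else 0.
  have zS : \sum_i z i ^+ 2 = \sum_(i | selected l i) y i.
    rewrite [RHS]big_mkcond; apply: eq_bigr => i _; rewrite /z /y.
    case: ifP => li; last by rewrite expr0n.
    case: ifP => // /negbFE iH.
    by case/exists_inP: noH; exists i.
  have z4 : 4 <= \sum_i z i ^+ 2.
    rewrite zS; move: near; set S := \sum_(i | _) _.
    have -> : D / (2 * N) = D / N / 2 by rewrite invfM mulrA mulrAC.
    have : 8 <= D / N by rewrite ler_pdivlMr.
    move: (D / N) S => q S q8; rewrite ltr_norml => /andP[qS _]; lra.
  apply: le_trans (sign_paley_zygmund (z := z) _) _; first by lra.
  apply: signs_le => r; apply: ind_le; rewrite sum_selected -/(z _) => h.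
  rewrite -(@ler_pXn2r _ 2) ?nnegrE// expr1n real_normK ?num_real//.
  by apply: le_trans h; lra.
apply: le_trans (labels_le inner).
rewrite /unif_exp fexpZ !fexpB -![fexp _ _]/(uexp _) labels_cst.
by have := few_hits Hk; rewrite -/hit; move: far_le; lra.
Qed.

(** Half of the signed combinations of the tests are at least as large on the light part as the test
    [c], hence at least [7 * N]. Their coefficients are at most 1 in modulus and [light_square] is
    at most [8 * N], so the selected sum is within 6 of a mean of modulus at least 7, except with
    probability [8 / 36]. *)
Lemma test_hits (C : finType) (phi : C -> I -> R) c :
  (#|heavy| < k)%N -> light_square <= 8 * N ->
  (forall i, \sum_c `|phi c i| <= 1) ->
  7 * N <= `|\sum_(i | i \notin heavy) phi c i * x i| ->
  300^-1 <= uexp (fun l : {ffun I -> 'I_M.+1} =>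
  uexp (fun r : {ffun C -> bool} =>
    ind (1 <= `|\sum_(i | selected l i) (\sum_c sgr (r c) * phi c i) * x i|))).
Proof.
move=> Hk D8 phi1 Lc; rewrite uexp_exchange.
pose hit (l : {ffun I -> 'I_M.+1}) := [exists i in heavy, selected l i].
pose L c := \sum_(i | i \notin heavy) phi c i * x i.
pose big (r : {ffun C -> bool}) := `|L c| <= `|\sum_c sgr (r c) * L c|.
have inner r : ind (big r) * 2^-1 <= uexp (fun l : {ffun I -> 'I_M.+1} =>
    ind (1 <= `|\sum_(i | selected l i) (\sum_c sgr (r c) * phi c i) * x i|)).
  have [Lr|_] := boolP (big r); last first.
    by rewrite mul0r uexp_ge0 ?card_ord// => l; exact: ind_ge0.
  rewrite mul1r; pose a i := \sum_c sgr (r c) * phi c i.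
  have a1 i : a i ^+ 2 <= 1.
    rewrite -real_normK ?num_real// exprn_ile1//.
    apply: le_trans (phi1 i); apply: le_trans (ler_norm_sum _ _ _) _.
    apply: ler_sum => d _; rewrite normrM /bool_sign normrX normrN normr1 expr1n.
    by rewrite mul1r.
  pose y i := if i \notin heavy then a i * x i else 0.
  have y2 : \sum_i y i ^+ 2 <= 8 * N.
    apply: le_trans D8; rewrite /light_square [leRHS]big_mkcond ler_sum// => i _.
    rewrite /y; case: ifP => _; last by rewrite expr0n.
    by rewrite exprMn ler_piMl ?sqr_ge0.
  have yL : \sum_i y i = \sum_c sgr (r c) * L c.
    rewrite /y -big_mkcond /=; under eq_bigr => i _ do rewrite /a mulr_suml.
    rewrite exchange_big; apply: eq_bigr => d _; rewrite mulr_sumr.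
    by apply: eq_bigr => i _; rewrite mulrA.
  pose far (l : {ffun I -> 'I_M.+1}) :=
    ind (6 <= `|\sum_(i | selected l i) y i - (\sum_i y i) / N|).
  have far_le : uexp far <= 2 / 9.
    apply: le_trans (uexp_chebyshev _ _ _) _ => //.
    rewrite ler_pdivrMr; last by rewrite mulr_gt0 ?exprn_gt0.
    by apply: le_trans y2 _; lra.
  have : uexp (fun l => 1 - ind (hit l) - far l) <= uexp (fun l : {ffun I -> 'I_M.+1} =>
      ind (1 <= `|\sum_(i | selected l i) (\sum_c sgr (r c) * phi c i) * x i|)).
    apply: labels_le => l.
    have [|noH] := boolP (hit l).
      by move=> _; rewrite subrr sub0r; apply: (@le_trans _ _ 0); rewrite ?oppr_le0 ?ind_ge0.
    rewrite {1}/ind /= subr0 /far; have [_|] := leP 6.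
      by rewrite /ind /= subrr; exact: ler0n.
    rewrite {1}/ind /= subr0 => near.
    apply: (@ind_le true) => _.
    have -> : \sum_(i | selected l i) (\sum_c sgr (r c) * phi c i) * x i =
              \sum_(i | selected l i) y i.
      apply: eq_bigr => i li; rewrite /y; case: ifP => // /negbFE iH.
      by case/exists_inP: noH; exists i.
    have : 7 <= `|(\sum_i y i) / N|.
      rewrite normrM normfV (gtr0_norm N_gt0) ler_pdivlMr// yL.
      exact: le_trans Lr.
    move: near; set S := \sum_(i | _) _; set m := _ / N => near m7.
    clearbody S m; have := ler_distD S m 0; rewrite !subr0 (distrC m S) => tri; lra.
  rewrite /unif_exp !fexpB -![fexp _ _]/(uexp _) labels_cst.
  by have := few_hits Hk; rewrite -/hit; move: far_le; lra.
apply: le_trans (signs_le inner).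
rewrite /unif_exp (@eq_fexp _ _ _ _ _ (fun r => 2^-1 * ind (big r))); last by move=> r;
  rewrite mulrC.
rewrite fexpZ -[fexp _ _]/(uexp _).
by have := sign_small_ball L c; rewrite -/(big _); lra.
Qed.

End Sampling.
End Core.

(** * Prefix classes of binary words *)

Section Grouping.
Context (R : realFieldType) (K : nat).
Local Notation I := {ffun 'I_K -> bool}.
Implicit Types (i r : I) (H : {set I}).

(** The bits from [j] on are cleared instead of dropped, so that prefixes of all lengths live in one
    type. *)
Definition prefix (j : nat) i : I := [ffun l : 'I_K => (l < j)%N && i l].

Lemma prefix_prefix j i : prefix j (prefix j.+1 i) = prefix j i.
Proof.
apply/ffunP => l; rewrite !ffunE; case: ltnP => //= lj.
by rewrite ltnS (ltnW lj).
Qed.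

Lemma card_prefixS H j : (#|prefix j @: H| <= #|prefix j.+1 @: H|)%N.
Proof.
have -> : prefix j @: H = prefix j @: (prefix j.+1 @: H).
  by rewrite -imset_comp; apply: eq_imset => i /=; rewrite prefix_prefix.
exact: leq_imset_card.
Qed.

(** Truncation maps the classes of level [j + 1] onto those of level [j]; equal cardinalities make
    it injective, so reading bit [j] splits no class. *)
Lemma card_prefix_eq H (j : 'I_K) :
  #|prefix j.+1 @: H| = #|prefix j @: H| ->
  {in H &, forall i i', prefix j i = prefix j i' -> i j = i' j}.
Proof.
move=> e i i' iH i'H.
have E : prefix j @: H = prefix j @: (prefix j.+1 @: H).
  by rewrite -imset_comp; apply: eq_imset => i1 /=; rewrite prefix_prefix.
have /imset_injP inj : #|prefix j @: (prefix j.+1 @: H)| == #|prefix j.+1 @: H|.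
  by rewrite -E e.
rewrite -(prefix_prefix j i) -(prefix_prefix j i') => /inj.
have mem a : a \in H -> prefix j.+1 a \in prefix j.+1 @: H by exact: imset_f.
move=> /(_ (mem _ iH) (mem _ i'H)) /ffunP /(_ j).
by rewrite !ffunE ltnSn.
Qed.

(** Every level in [J] creates at least one new class, and there are never more classes than
    elements of [H]. *)
Lemma card_le_sum_prefix H (J : {set 'I_K}) :
  (forall j : 'I_K, j \in J -> #|prefix j @: H| != #|prefix j.+1 @: H|) ->
  (#|J| <= #|H|)%N.
Proof.
move=> HJ.
have P n : (n <= K)%N -> (#|[set j in J | (j < n)%N]| <= #|prefix n @: H|)%N.
  elim: n => [_|n IH nK]; first by rewrite (_ : [set _ in _ | _] = finset.set0) ?cards0//;
    apply/setP => j; rewrite !inE andbF.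
  pose jn := Ordinal nK.
  have [jJ|jJ] := boolP (jn \in J).
    apply: (@leq_trans (#|[set j in J | (j < n)%N]|.+1)).
      rewrite -[leqRHS]add1n -[X in (X + _)%N](cards1 jn);
        apply: leq_trans (leq_of_leqif (leq_card_setU _ _)).
      apply: subset_leq_card; apply/fintype.subsetP => j; rewrite !inE ltnS leq_eqVlt.
      by case: (j \in J) => //=; rewrite -(inj_eq val_inj).
    apply: leq_ltn_trans (IH (ltnW nK)) _.
    by rewrite ltn_neqAle card_prefixS andbT; exact: (HJ jn).
  apply: leq_trans (card_prefixS _ _); apply: leq_trans (IH (ltnW nK)).
  apply: subset_leq_card; apply/fintype.subsetP => j; rewrite !inE ltnS leq_eqVlt.
  case/andP => jJ' /orP[/eqP jn'|->]; last by rewrite jJ'.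
  by case/negP: jJ; rewrite (_ : jn = j)//; apply: val_inj.
have := P K (leqnn K).
rewrite (_ : [set j in J | _] = J) => [/leq_trans|]; last first.
  by apply/setP => j; rewrite !inE ltn_ord andbT.
by apply; exact: leq_imset_card.
Qed.

(* The classes of level [j] met by [H] are split at level [j + 1] whenever
   the total of [x] over [{i | i j}] is large compared with the classes of
   level [j], so their number grows and soon exceeds [#|H|]. *)
Lemma grouping (k : nat) (x : I -> R) (H : {set I}) (J : {set 'I_K})
    (b : 'I_K -> R) (e : R) : (#|H| < k)%N ->
  (forall (j : 'I_K) r, `|\sum_(i | prefix j i == r) x i| <= b j) ->
  (forall (j : 'I_K) r, `|\sum_(i | i \notin H) (prefix j i == r)%:R * x i| <= e) ->
  (forall j : 'I_K, `|\sum_(i : I | i \notin H) (i j)%:R * x i| <= e) ->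
  (forall j, j \in J -> k%:R * (b j + e) + e < `|\sum_(i : I) (i j)%:R * x i|) ->
  (#|J| <= #|H|)%N.
Proof.
move=> Hk xb lightb lightJ bigJ; apply: card_le_sum_prefix => j jJ.
apply/eqP => /esym /card_prefix_eq same.
have := bigJ _ jJ; apply/negP; rewrite -leNgt.
rewrite (bigID (mem H)) /=; apply: le_trans (ler_normD _ _) _.
apply: lerD; last exact: lightJ.
have b0 : 0 <= b j + e by rewrite addr_ge0 ?(le_trans _ (xb j [ffun=> false])) ?(le_trans _
  (lightJ j)).
rewrite (partition_big_imset (prefix j)) /=; apply: le_trans (ler_norm_sum _ _ _) _.
apply: (@le_trans _ _ (\sum_(r in prefix j @: H) (b j + e))); last first.
  rewrite sumr_const -[leLHS]mulr_natl ler_wpM2r// ler_nat.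
  by apply: leq_trans (ltnW Hk); exact: leq_imset_card.
apply: ler_sum => r /imsetP[i0 i0H rE].
(* On a class met by [H] the bit [j] has the single value [i0 j]. Up to this factor, the heavy part
   of the class contributes the whole class sum minus its light part. *)
rewrite (eq_bigr (fun i => (i0 j)%:R * x i)); last first.
  by move=> i /andP[iH /eqP ir]; rewrite (same i i0)// ir.
rewrite -mulr_sumr normrM.
apply: (@le_trans _ _ `|\sum_(i in H | prefix j i == r) x i|).
  by rewrite ler_piMl// normr_nat; case: (i0 j).
have -> : \sum_(i in H | prefix j i == r) x i = \sum_(i | prefix j i == r) x i -
    \sum_(i | i \notin H) (prefix j i == r)%:R * x i.
  rewrite [X in _ = X - _](bigID (mem H)) /= -addrA [X in _ = _ + X](_ : _ = 0).
    by rewrite addr0; apply: eq_bigl => i; rewrite andbC.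
  apply/eqP; rewrite subr_eq0; apply/eqP.
  rewrite (eq_bigl (fun i => (i \notin H) && (prefix j i == r))); last by move=> i; rewrite andbC.
  rewrite big_mkcondr; apply: eq_bigr => i _.
  by case: (_ == _); rewrite ?mul1r ?mul0r.
by apply: le_trans (ler_normB _ _) _; apply: lerD; [exact: xb|exact: lightb].
Qed.

End Grouping.

(** * The hit-rate inequality at a fixed outcome *)

Section Pointwise.
Context (R : realFieldType) (K M k : nat).
Hypotheses (K_gt0 : (0 < K)%N) (MK : M.+1 = (100 * k)%N).
Local Notation I := {ffun 'I_K -> bool}.
Local Notation C := ('I_K * I + 'I_K)%type.
Local Notation uexp := (@unif_exp R _ _).
Local Notation ind := (@bool_ind R).
Local Notation sgr := (@bool_sign R).

(** Each [i] lies in one class per level and has at most [K] bits set; the divisor [2 * K] thus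
    keeps the sum of all tests at [i] below 1, as [test_hits] requires. *)
Definition test (c : C) (i : I) : R :=
  match c with
  | inl (j, r) => (prefix j i == r)%:R
  | inr j => (i j)%:R
  end / (2 * K%:R).

Let K0 : 0 < 2 * K%:R :> R. Proof. by rewrite mulr_gt0// ltr0n. Qed.

Lemma test_ge0 c i : 0 <= test c i.
Proof. by case: c => [[j r]|j]; rewrite /test divr_ge0 ?ler0n// ltW. Qed.

Lemma sum_test_le1 i : \sum_c `|test c i| <= 1.
Proof.
rewrite (eq_bigr (test^~ i)); last by move=> c _; rewrite ger0_norm// test_ge0.
rewrite big_sumType /= /test -!mulr_suml -mulrDl ler_pdivrMr// mul1r.
rewrite [2 * _]mulr_natl mulr2n.
have card_K : \sum_(j < K) 1 = K%:R :> R.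
  by rewrite sumr_const card_ord.
apply: lerD; last first.
  by rewrite -card_K ler_sum// => j _; case: (i j).
rewrite (eq_bigr (fun p : 'I_K * I => (prefix p.1 i == p.2)%:R)); last by case.
rewrite -(pair_bigA _ (fun (j : 'I_K) r => (prefix j i == r)%:R)) /= -card_K ler_sum// => j _.
rewrite (bigD1 (prefix j i))//= eqxx big1 ?addr0// => r.
by rewrite eq_sym => /negbTE ->.
Qed.

Definition sign_hit_rate (x : I -> R) : R :=
  uexp (fun l : {ffun I -> 'I_M.+1} => uexp (fun r : {ffun I -> bool} =>
    ind (1 <= `|\sum_(i | selected l i) sgr (r i) * x i|))).

Definition test_hit_rate (x : I -> R) : R :=
  uexp (fun l : {ffun I -> 'I_M.+1} => uexp (fun r : {ffun C -> bool} =>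
    ind (1 <= `|\sum_(i | selected l i) (\sum_c sgr (r c) * test c i) * x i|))).

(** The bound [7 * N] of [test_hits] for the light part of a test, multiplied by [2 * K] to undo the
    normalisation. [threshold] is the level of [grouping] with this slack in the role of [e]. *)
Definition slack : R := 14 * M.+1%:R * K%:R.
Definition threshold (b : R) : R := k%:R * (b + slack) + slack.

(** Linear in the indicators, so that it integrates over [Omega] term by term. If the hit rates stay
    below 1/300, there are fewer than [k] heavy indices and all light tests are small; if moreover
    no class sum exceeds its bound, [grouping] allows fewer than [k] large levels. Dividing by [K]
    keeps the left side below 1/300 in the remaining cases. *)
Lemma hit_rate_ge (b : 'I_K -> R) (x : I -> R) :
  300^-1 * ((\sum_(j < K) ind (threshold (b j) < `|\sum_(i : I) (i j)%:R * x i|) - k%:R) / K%:R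
    - \sum_(j < K) \sum_r ind (b j < `|\sum_(i | prefix j i == r) x i|)) <=
  sign_hit_rate x + test_hit_rate x.
Proof.
have KR : 0 < K%:R :> R by rewrite ltr0n.
set s := \sum_j ind _; set bad := \sum_j \sum_r _.
have rate_ge0 : 0 <= sign_hit_rate x /\ 0 <= test_hit_rate x.
  split; apply: uexp_ge0; rewrite ?card_ord// => l;
    by apply: uexp_ge0; rewrite ?card_bool// => r; exact: ind_ge0.
have bad_ge0 : 0 <= bad.
  by do 2![apply: sumr_ge0 => ? _]; exact: ind_ge0.
have sK : s <= K%:R.
  rewrite -[leRHS](_ : \sum_(j < K) 1 = _); last by rewrite sumr_const card_ord.
  by apply: ler_sum => j _; rewrite /bool_ind; case: (_ < _).
have low : (s - k%:R) / K%:R <= 1.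
  by rewrite ler_pdivrMr// mul1r; have := ler0n R k; lra.
have [|rate_lt] := leP 300^-1 (sign_hit_rate x + test_hit_rate x).
  by apply: le_trans; lra.
suff : (s - k%:R) / K%:R <= bad by lra.
(* [bad] counts class sums above their bounds, so [bad < 1] means that there are none. *)
have [bad1|bad1] := leP 1 bad; first by lra.
apply: (@le_trans _ _ 0) => //.
rewrite ler_pdivrMr// mul0r subr_le0.
pose H := [set i | 1 <= `|x i|].
pose J := [set j : 'I_K | threshold (b j) < `|\sum_(i : I) (i j)%:R * x i|].
have -> : s = #|J|%:R.
  rewrite -sum1_card natr_sum /s [RHS]big_mkcond; apply: eq_bigr => j _.
  by rewrite inE /bool_ind; case: (_ < _).
rewrite ler_nat.
have [kH|Hk] := leqP k #|H|.
  by have h : 300^-1 <= sign_hit_rate x := @sign_hits_heavy R _ M k x MK kH; lra.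
have [big|small_in_prob] := leP (8 * M.+1%:R) (\sum_(i | i \notin H) x i ^+ 2).
  by have h : 300^-1 <= sign_hit_rate x := @sign_hits_light R _ M k x MK Hk big; lra.
have tests c : `|\sum_(i | i \notin H) test c i * x i| < 7 * M.+1%:R.
  rewrite ltNge; apply/negP => h.
  have rate : 300^-1 <= test_hit_rate x :=
    @test_hits R _ M k x MK _ test c Hk (ltW small_in_prob) sum_test_le1 h.
  by lra.
have scale (w : I -> R) : \sum_(i | i \notin H) w i / (2 * K%:R) * x i =
    (\sum_(i | i \notin H) w i * x i) / (2 * K%:R).
  by rewrite mulr_suml; apply: eq_bigr => i _; rewrite mulrAC.
have slackE : 7 * M.+1%:R * (2 * K%:R) = slack by rewrite /slack; ring.
apply: leq_trans (ltnW Hk).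
apply: (@grouping _ _ k x H J b slack) => // [j r|j r|j|j]; last by rewrite inE.
- rewrite leNgt; apply/negP => h; move: bad1; apply/negP; rewrite -leNgt /bad.
  rewrite (bigD1 j)//= (bigD1 r)//= h -addrA lerDl addr_ge0//.
    by apply: sumr_ge0 => *; exact: ind_ge0.
  by do 2![apply: sumr_ge0 => ? _]; exact: ind_ge0.
- have := tests (inl (j, r)); rewrite /test scale normrM normfV (gtr0_norm K0).
  by rewrite ltr_pdivrMr// slackE => /ltW.
- have := tests (inr j); rewrite /test scale normrM normfV (gtr0_norm K0).
  by rewrite ltr_pdivrMr// slackE => /ltW.
Qed.

End Pointwise.

(** * From bounded multipliers to random signs *)

Section Multiplier.
Context (R : realFieldType) (I : finType) (a : I -> R).
Hypothesis a_le1 : forall i, `|a i| <= 1.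
Local Notation ind := (@bool_ind R).
Local Notation sgr := (@bool_sign R).

(** The law of a random sign with mean [a i]. *)
Let tilt (i : I) (b : bool) : R := (1 + sgr b * a i) / 2.

Let tilt_ge0 i b : 0 <= tilt i b.
Proof.
have := a_le1 i; rewrite ler_norml => /andP[? ?].
by rewrite /tilt; case: b; rewrite !sgr_boolE divr_ge0//; lra.
Qed.

Let tilt_sum1 i : \sum_b tilt i b = 1.
Proof. by rewrite big_bool /= /tilt !sgr_boolE; field. Qed.

(* Random signs are used both with mean 0, to control the sum of squares, and
   with means [a i]. *)
Definition multiplier_weight (r : {ffun I -> bool}) : R :=
  13 * \prod_(i : I) #|{: bool}|%:R^-1 + 2 * \prod_i tilt i (r i).

Lemma multiplier_weight_ge0 r : 0 <= multiplier_weight r.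
Proof.
apply: addr_ge0; apply: mulr_ge0 => //; apply: prodr_ge0 => i _; rewrite ?tilt_ge0// invr_ge0 ler0n.
Qed.

Let weighted_sum (F : {ffun I -> bool} -> R) :
  \sum_r multiplier_weight r * F r = 13 * unif_exp F + 2 * fexp tilt F.
Proof.
rewrite /unif_exp /fexp !mulr_sumr -big_split; apply: eq_bigr => r _ /=.
by rewrite mulrDl !mulrA.
Qed.

Lemma multiplier_weight_sum : \sum_r multiplier_weight r = 15.
Proof.
rewrite (eq_bigr (fun r => multiplier_weight r * 1)); last by move=> r _; rewrite mulr1.
by rewrite weighted_sum uexp_cst ?card_bool// fexp_cst// !mulr1 -natrD.
Qed.

(** If [8 * Q <= m^2], the tilted signed sum has mean [m] and variance at most [Q], so by Chebyshev
    it exceeds [c / 4] in modulus with probability at least 1/2. Otherwise [Q] is large compared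
    with [c^2], and Paley-Zygmund for unbiased signs gives probability at least 1/13. The weights 2
    and 13 turn both bounds into 1. *)
Lemma multiplier_pointwise (x : I -> R) (c : R) : 0 < c ->
  ind (c < `|\sum_i a i * x i|) <=
  \sum_(r : {ffun I -> bool}) multiplier_weight r * ind (c / 4 <= `|\sum_i sgr (r i) * x i|).
Proof.
move=> c0; rewrite weighted_sum.
set m := \sum_i a i * x i; pose Q := \sum_i x i ^+ 2.
pose Z (r : {ffun I -> bool}) := \sum_i sgr (r i) * x i.
set F := fun r => _; have F0 r : 0 <= F r by exact: ind_ge0.
have u0 : 0 <= unif_exp F by apply: uexp_ge0; rewrite ?card_bool.
have f0 : 0 <= fexp tilt F.
  by rewrite -(fexp_cst tilt_sum1 0) fexp_le.
have [cm|_] := ltP c `|m|; last by rewrite /ind /=; lra.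
rewrite {1}/ind /=.
have [Qm|mQ] := leP (8 * Q) (m ^+ 2).
  have m2 : 0 < m ^+ 2 by rewrite -real_normK ?num_real// exprn_gt0// (lt_trans c0).
  pose u i b := (sgr b - a i) * x i.
  have mean i : \sum_b tilt i b * u i b = 0.
    by rewrite big_bool /= /tilt /u !sgr_boolE; field.
  have var i : \sum_b tilt i b * u i b ^+ 2 <= x i ^+ 2.
    rewrite big_bool /= /tilt /u !sgr_boolE [leLHS](_ : _ = x i ^+ 2 - (a i * x i) ^+ 2);
      last by field.
    by rewrite gerBl sqr_ge0.
  have E r : Z r - m = \sum_i u i (r i).
    by rewrite -sumrB; apply: eq_bigr => i _; rewrite -mulrBl.
  have cheb (r : {ffun I -> bool}) : 1 - 4 / m ^+ 2 * (\sum_i u i (r i)) ^+ 2 <= F r.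
    rewrite -E /F; case: (leP (c / 4)) => /= [_|Zc].
      rewrite {1}/ind /= gerBl mulr_ge0 ?sqr_ge0// divr_ge0// ltW//.
    rewrite /ind subr_le0 mulrAC ler_pdivlMr// mul1r.
    have -> : 4 * (Z r - m) ^+ 2 = (2 * (Z r - m)) ^+ 2 by ring.
    rewrite -[leLHS]real_normK ?num_real// -[leRHS]real_normK ?num_real//.
    rewrite lerXn2r ?nnegrE// normrM normr_nat.
    have := ler_distD (Z r) m 0; rewrite !subr0 (distrC m) -/(Z r) in Zc *.
    by lra.
  have : 1 - 4 / m ^+ 2 * (\sum_i \sum_b tilt i b * u i b ^+ 2) <= fexp tilt F.
    apply: le_trans (fexp_le tilt_ge0 cheb).
    by rewrite fexpB fexpZ fexp_cst// (second_moment tilt_sum1 mean).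
  have : 4 / m ^+ 2 * (\sum_i \sum_b tilt i b * u i b ^+ 2) <= 2^-1.
    rewrite mulrAC ler_pdivrMr//; apply: (@le_trans _ _ (4 * Q)); last by lra.
    by rewrite ler_wpM2l// ler_sum.
  by lra.
have Q0 : 0 < Q by have := sqr_ge0 m; lra.
have : 13^-1 <= unif_exp F.
  apply: le_trans (sign_paley_zygmund Q0) _; apply: uexp_le => r; apply: ind_le => h.
  rewrite -(@ler_pXn2r _ 2) ?nnegrE// ?divr_ge0 ?(ltW c0)// real_normK ?num_real//.
  apply: le_trans h; rewrite -/Q.
  have : c ^+ 2 < m ^+ 2.
    by rewrite -[ltRHS]real_normK ?num_real// ltrXn2r ?nnegrE// ltW.
  have -> : (c / 4) ^+ 2 = c ^+ 2 / 16 by field.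
  by lra.
by lra.
Qed.

End Multiplier.

Local Open Scope classical_set_scope.
Local Open Scope ring_scope.

(** * Additive functions with values in L0 *)

Section Probability.
Context (R : realType) (dO : measure_display) (Omega : measurableType dO)
  (P : probability Omega R).
Implicit Types (b c : Omega -> bool) (X Y : Omega -> R).
Local Notation ind := (@bool_ind R).

Definition Pr b : R := fine (P [set w | b w]).
Definition event b := measurable [set w | b w].

Lemma P_pr b : event b -> P [set w | b w] = (Pr b)%:E.
Proof. by move=> mb; rewrite /Pr fineK// fin_num_measure. Qed.

Lemma pr_ge0 b : 0 <= Pr b.
Proof. exact: fine_ge0. Qed.

Lemma pr_le b c : event b -> event c -> (forall w, b w -> c w) -> Pr b <= Pr c.
Proof.
move=> mb mc bc; rewrite -lee_fin -!P_pr//.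
by apply: le_measure; rewrite ?inE.
Qed.

Lemma eq_pr b c : (forall w, b w = c w) -> Pr b = Pr c.
Proof. by move=> bc; rewrite /Pr; congr (fine (P _)); apply/seteqP; split=> w /=; rewrite bc. Qed.

Lemma pr_le1 b : event b -> Pr b <= 1.
Proof. by move=> mb; rewrite -lee_fin -P_pr//; exact: probability_le1. Qed.

Lemma event_or b c : event b -> event c -> event (fun w => b w || c w).
Proof.
move=> mb mc; rewrite /event.
rewrite (_ : [set _ | _] = [set w | b w] `|` [set w | c w]); first exact: measurableU.
by apply/seteqP; split=> w /= /orP.
Qed.

Lemma event_and b c : event b -> event c -> event (fun w => b w && c w).
Proof.
move=> mb mc; rewrite /event.
rewrite (_ : [set _ | _] = [set w | b w] `&` [set w | c w]); first exact: measurableI.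
by apply/seteqP; split=> w /= /andP.
Qed.

Lemma pr_or b c : event b -> event c -> Pr (fun w => b w || c w) <= Pr b + Pr c.
Proof.
move=> mb mc; rewrite -lee_fin EFinD -!P_pr//; last exact: event_or.
rewrite (_ : [set _ | _] = [set w | b w] `|` [set w | c w]).
  exact: measureU2.
by apply/seteqP; split=> w /= /orP.
Qed.

Let indE b : (fun w => ind (b w)) = \1_[set w | b w].
Proof.
by apply/funext => w; rewrite indicE /bool_ind mem_setE.
Qed.

(** Integrability is bundled with the value, so that the mean of a combination of indicators is
    built along its syntax and a pointwise inequality becomes one between probabilities. *)
Definition has_mean X (m : R) : Prop :=
  P.-integrable setT (EFin \o X) /\ \int[P]_w X w = m.

Lemma has_mean_ind b : event b -> has_mean (fun w => ind (b w)) (Pr b).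
Proof.
move=> mb; rewrite indE; split; first exact: integrable_indic.
by rewrite /Rintegral integral_indic// setIT.
Qed.

Lemma has_mean_cst (c : R) : has_mean (fun=> c) c.
Proof.
split; first exact: finite_measure_integrable_cst.
by rewrite Rintegral_cst// [X in fine X]probability_setT mulr1.
Qed.

Lemma has_meanZ X m (c : R) : has_mean X m -> has_mean (fun w => c * X w) (c * m).
Proof.
move=> [iX <-]; split; first exact: (integrableZl measurableT c iX).
by rewrite RintegralZl.
Qed.

Lemma has_meanD X Y m m' : has_mean X m -> has_mean Y m' ->
  has_mean (fun w => X w + Y w) (m + m').
Proof.
move=> [iX <-] [iY <-]; split; first exact: (integrableD _ iX iY).
by rewrite RintegralD.
Qed.

Lemma has_meanB X Y m m' : has_mean X m -> has_mean Y m' ->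
  has_mean (fun w => X w - Y w) (m - m').
Proof.
move=> hX /(has_meanZ (-1)) hY.
have := has_meanD hX hY; rewrite mulN1r.
by rewrite (_ : (fun w => X w + _) = fun w => X w - Y w)//; apply/funext => w; rewrite mulN1r.
Qed.

Lemma has_mean_sum (J : finType) (X : J -> Omega -> R) (m : J -> R) :
  (forall j, has_mean (X j) (m j)) ->
  has_mean (fun w => \sum_j X j w) (\sum_j m j).
Proof.
move=> H; elim: (index_enum J) => [|j s IH].
  rewrite big_nil (_ : (fun w => _) = fun=> 0); first exact: has_mean_cst.
  by apply/funext => w; rewrite big_nil.
rewrite big_cons (_ : (fun w => _) = fun w => X j w + \sum_(j <- s) X j w).
  exact: has_meanD.
by apply/funext => w; rewrite big_cons.
Qed.

Lemma has_mean_uexp (I V : finType) (F : {ffun I -> V} -> Omega -> R) m :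
  (forall r, has_mean (F r) (m r)) ->
  has_mean (fun w => unif_exp (fun r => F r w)) (unif_exp m).
Proof. by move=> H; apply: has_mean_sum => r; apply: has_meanZ. Qed.

Lemma has_mean_le X Y m m' : has_mean X m -> has_mean Y m' ->
  (forall w, X w <= Y w) -> m <= m'.
Proof. by move=> [iX <-] [iY <-] XY; exact: le_Rintegral. Qed.

Definition as_eq X Y := Pr (fun w => X w != Y w) = 0.

Lemma event_lt X (t : R) : measurable_fun setT X -> event (fun w => t < X w).
Proof.
move=> mX; rewrite /event -[X in measurable X]setTI.
rewrite (_ : [set w | _] = X @^-1` `]t, +oo[%classic); first exact: mX.
by apply/seteqP; split=> w /=; rewrite in_itv /= andbT.
Qed.

Lemma event_le X (t : R) : measurable_fun setT X -> event (fun w => t <= X w).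
Proof.
move=> mX; rewrite /event -[X in measurable X]setTI.
rewrite (_ : [set w | _] = X @^-1` `[t, +oo[%classic); first exact: mX.
by apply/seteqP; split=> w /=; rewrite in_itv /= andbT.
Qed.

Lemma measurable_norm_fun X : measurable_fun setT X -> measurable_fun setT (fun w => `|X w|).
Proof. by move=> mX; apply: measurableT_comp. Qed.

Lemma event_norm_lt X (t : R) : measurable_fun setT X -> event (fun w => t < `|X w|).
Proof. by move=> /measurable_norm_fun; exact: event_lt. Qed.

Lemma event_norm_le X (t : R) : measurable_fun setT X -> event (fun w => t <= `|X w|).
Proof. by move=> /measurable_norm_fun; exact: event_le. Qed.

Lemma event_neq X Y : measurable_fun setT X -> measurable_fun setT Y ->
  event (fun w => X w != Y w).
Proof.
move=> mX mY; have mD : measurable_fun setT (fun w => X w - Y w) by exact: measurable_funB.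
rewrite /event (_ : [set w | _] = [set w | 0 < `|X w - Y w|]); first exact: event_norm_lt.
by apply/seteqP; split=> w /=; rewrite normr_gt0 subr_eq0.
Qed.

Lemma measurable_lin (I : finType) (Q : pred I) (a : I -> R) (X : I -> Omega -> R) :
  (forall i, measurable_fun setT (X i)) ->
  measurable_fun setT (fun w => \sum_(i | Q i) a i * X i w).
Proof.
move=> mX; rewrite (_ : (fun w => _) =
    (fun w => \sum_(i <- index_enum I) (if Q i then a i * X i w else 0))).
  apply: measurable_sum => i; case: (Q i); last exact: measurable_cst.
  exact: measurable_funM.
by apply/funext => w; rewrite -big_mkcond.
Qed.

Lemma measurable_sum_cond (I : finType) (Q : pred I) (X : I -> Omega -> R) :
  (forall i, measurable_fun setT (X i)) ->
  measurable_fun setT (fun w => \sum_(i | Q i) X i w).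
Proof.
move=> mX; rewrite (_ : (fun w => _) = (fun w => \sum_(i | Q i) 1 * X i w)).
  exact: measurable_lin.
by apply/funext => w; apply: eq_bigr => i _; rewrite mul1r.
Qed.

Lemma pr_le_null b c n : event b -> event c -> event n -> Pr n = 0 ->
  (forall w, b w -> ~~ n w -> c w) -> Pr b <= Pr c.
Proof.
move=> mb mc mn n0 H; apply: (@le_trans _ _ (Pr (fun w => c w || n w))).
  apply: pr_le => // [|w bw]; first exact: event_or.
  by have [nw|nw] := boolP (n w); rewrite ?orbT// H.
by apply: le_trans (pr_or mc mn) _; rewrite n0 addr0.
Qed.

End Probability.

Section AlmostEverywhere.
Context (R : realType) (dO : measure_display) (Omega : measurableType dO)
  (P : probability Omega R).
Implicit Types (X Y Z : Omega -> R).
Local Notation pr := (Pr P).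
Local Notation aeq := (as_eq P).

Lemma aeq_refl X : aeq X X.
Proof.
rewrite /as_eq /Pr (_ : [set w | _] = set0) ?measure0//.
by apply/seteqP; split=> w //=; rewrite eqxx.
Qed.

Lemma eq_aeq X Y : (forall w, X w = Y w) -> aeq X Y.
Proof. by move=> /funext ->; exact: aeq_refl. Qed.

Lemma aeq_sym X Y : aeq X Y -> aeq Y X.
Proof. by move=> XY; rewrite /as_eq -[RHS]XY; apply: eq_pr => w; rewrite eq_sym. Qed.

Lemma aeq_trans X Y Z : measurable_fun setT X -> measurable_fun setT Y ->
  measurable_fun setT Z -> aeq X Y -> aeq Y Z -> aeq X Z.
Proof.
move=> mX mY mZ XY YZ; apply/eqP; rewrite eq_le pr_ge0 andbT -YZ.
apply: (pr_le_null _ _ _ XY); try exact: event_neq.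
by move=> w /[swap] /negPn/eqP ->.
Qed.

Lemma aeqD X Y X' Y' : measurable_fun setT X -> measurable_fun setT Y ->
  measurable_fun setT X' -> measurable_fun setT Y' -> aeq X Y -> aeq X' Y' ->
  aeq (fun w => X w + X' w) (fun w => Y w + Y' w).
Proof.
move=> mX mY mX' mY' XY XY'; apply/eqP; rewrite eq_le pr_ge0 andbT -XY'.
apply: (pr_le_null _ _ _ XY); try by apply: event_neq => //; exact: measurable_funD.
by move=> w /[swap] /negPn/eqP ->; apply: contraNN => /eqP ->.
Qed.

Lemma aeqB X Y X' Y' : measurable_fun setT X -> measurable_fun setT Y ->
  measurable_fun setT X' -> measurable_fun setT Y' -> aeq X Y -> aeq X' Y' ->
  aeq (fun w => X w - X' w) (fun w => Y w - Y' w).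
Proof.
move=> mX mY mX' mY' XY XY'; apply/eqP; rewrite eq_le pr_ge0 andbT -XY'.
apply: (pr_le_null _ _ _ XY); try by apply: event_neq => //; exact: measurable_funB.
by move=> w /[swap] /negPn/eqP ->; apply: contraNN => /eqP ->.
Qed.

Lemma aeqZ X Y (c : R) : measurable_fun setT X -> measurable_fun setT Y ->
  aeq X Y -> aeq (fun w => c * X w) (fun w => c * Y w).
Proof.
move=> mX mY XY; apply/eqP; rewrite eq_le pr_ge0 andbT -[leRHS]XY.
apply: pr_le; try by apply: event_neq => //; exact: measurable_funM.
by move=> w; apply: contraNN => /eqP ->.
Qed.

Lemma aeq_lin (I : eqType) (s : seq I) (a : I -> R) (X Y : I -> Omega -> R) :
  (forall i, measurable_fun setT (X i)) -> (forall i, measurable_fun setT (Y i)) ->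
  (forall i, i \in s -> aeq (X i) (Y i)) ->
  aeq (fun w => \sum_(i <- s) a i * X i w) (fun w => \sum_(i <- s) a i * Y i w).
Proof.
move=> mX mY; elim: s => [|i s IH] XY.
  by apply: eq_aeq => w; rewrite !big_nil.
rewrite (_ : (fun w => _) = (fun w => a i * X i w + \sum_(i <- s) a i * X i w)); last first.
  by apply/funext => w; rewrite big_cons.
rewrite (_ : (fun w => \sum_(i <- _) _ * Y _ _) = (fun w =>
  a i * Y i w + \sum_(i <- s) a i * Y i w)); last first.
  by apply/funext => w; rewrite big_cons.
have ms (Z : I -> Omega -> R) : (forall i, measurable_fun setT (Z i)) ->
    measurable_fun setT (fun w => \sum_(i <- s) a i * Z i w).
  by move=> mZ; apply: measurable_sum => j; exact: measurable_funM.
apply: aeqD; try exact: measurable_funM; try exact: ms.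
  by apply: aeqZ => //; apply: XY; rewrite mem_head.
by apply: IH => j js; apply: XY; rewrite inE js orbT.
Qed.

Lemma pr_aeq X Y (f : R -> bool) : measurable_fun setT X -> measurable_fun setT Y ->
  event (fun w => f (X w)) -> event (fun w => f (Y w)) -> aeq X Y ->
  pr (fun w => f (X w)) = pr (fun w => f (Y w)).
Proof.
move=> mX mY mfX mfY XY; apply/eqP; rewrite eq_le; apply/andP; split.
  apply: (pr_le_null _ _ _ XY) => //; first exact: event_neq.
  by move=> w /[swap] /negPn/eqP ->.
apply: (pr_le_null _ _ _ XY) => //; first exact: event_neq.
by move=> w /[swap] /negPn/eqP ->.
Qed.

Lemma pr_aeq_lt X Y c : measurable_fun setT X -> measurable_fun setT Y ->
  aeq X Y -> pr (fun w => c < `|X w|) = pr (fun w => c < `|Y w|).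
Proof.
by move=> mX mY XY; apply: (@pr_aeq X Y (fun x => c < `|x|)) => //; exact: event_norm_lt.
Qed.

Lemma pr_aeq_le X Y c : measurable_fun setT X -> measurable_fun setT Y ->
  aeq X Y -> pr (fun w => c <= `|X w|) = pr (fun w => c <= `|Y w|).
Proof.
by move=> mX mY XY; apply: (@pr_aeq X Y (fun x => c <= `|x|)) => //; exact: event_norm_le.
Qed.

Lemma tail_small X (e : R) : measurable_fun setT X -> 0 < e ->
  exists c : R, pr (fun w => c < `|X w|) <= e.
Proof.
move=> mX e0.
pose F (n : nat) := [set w | n%:R < `|X w|].
have mF n : measurable (F n) by exact: event_norm_lt.
have F0 : \bigcap_n F n = set0.
  apply/seteqP; split=> // w H.
  have h := ltW (archi_boundP (normr_ge0 (X w))).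
  by have := H (Num.Def.archi_bound `|X w|) I; rewrite /F /= ltNge h.
have cF : P (F n) @[n --> \oo] --> P (\bigcap_n F n).
  apply: nonincreasing_cvg_mu => //.
  - by rewrite (le_lt_trans (probability_le1 _ _))// ltey.
  - exact: bigcapT_measurable.
  - move=> m n mn; apply/subsetPset => w; apply: le_lt_trans.
    by rewrite ler_nat.
rewrite F0 measure0 in cF.
have /cF : nbhs (0 : \bar R) [set x | (x < e%:E)%E].
  by apply: open_nbhs_nbhs; split; [exact: open_ereal_lt_ereal|rewrite /= lte_fin].
case=> n _ /(_ n (leqnn n)) /= Fn; exists n%:R.
by rewrite -lee_fin -P_pr ?ltW//; exact: event_norm_lt.
Qed.

Lemma tails_small (I : finType) (X : I -> Omega -> R) (e : R) :
  (forall i, measurable_fun setT (X i)) -> 0 < e ->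
  exists c : R, forall i, pr (fun w => c < `|X i w|) <= e.
Proof.
move=> mX e0; have /choice[c cP] : forall i, exists c : R, pr (fun w => c < `|X i w|) <= e.
  by move=> i; exact: tail_small.
exists (\sum_i `|c i|) => i; apply: le_trans (cP i).
apply: pr_le; try exact: event_norm_lt; move=> w; apply: le_lt_trans.
by rewrite (bigD1 i)//= (le_trans (ler_norm _))// lerDl sumr_ge0.
Qed.

End AlmostEverywhere.

Lemma bigcup_finE (I : finType) (T : Type) (Q : pred I) (A : I -> set T) :
  \bigcup_(i in [set i | Q i]) A i = \big[setU/set0]_(i | Q i) A i.
Proof.
rewrite -bigcup_seq_cond; congr (\bigcup_(i in _) _).
by apply/seteqP; split=> i /=; rewrite mem_index_enum.
Qed.

(** * Almost surely additive set functions *)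

Section Additive.
Context (R : realType) (dO dS : measure_display) (Omega : measurableType dO)
  (P : probability Omega R) (S : measurableType dS).
Local Notation pr := (Pr P).
Local Notation aeq := (as_eq P).
Local Notation ind := (@bool_ind R).
Local Notation sgr := (@bool_sign R).
Implicit Types (G A : set S).

(** The value on each set is a representative of a class, chosen separately, so additivity can only
    hold off a null set depending on [A] and [B]. *)
Definition ae_additive (nu : set S -> Omega -> R) : Prop :=
  (forall A, measurable A -> measurable_fun setT (nu A)) /\
  (forall A B, measurable A -> measurable B -> A `&` B = set0 ->
    aeq (nu (A `|` B)) (fun w => nu A w + nu B w)).

Context (nu : set S -> Omega -> R) (nu_add : ae_additive nu).
Let m_nu := nu_add.1.

Lemma ae_additive_set0 : aeq (nu set0) (fun=> 0).
Proof.
have m0 := m_nu measurable0.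
have := nu_add.2 set0 set0 measurable0 measurable0 (setI0 _); rewrite setU0 => H.
apply/eqP; rewrite eq_le pr_ge0 andbT -[leRHS]H.
apply: pr_le; try by apply: event_neq => //; exact: measurable_funD.
by move=> w; apply: contraNN => /eqP h; apply/eqP; lra.
Qed.

Lemma ae_additive_sum (I : finType) (A : I -> set S) (Q : pred I) :
  (forall i, measurable (A i)) -> trivIset setT A ->
  aeq (nu (\bigcup_(i in [set i | Q i]) A i)) (fun w => \sum_(i | Q i) nu (A i) w).
Proof.
move=> mA tA; rewrite bigcup_finE -big_filter.
rewrite (_ : (fun w => _) = (fun w => \sum_(i <- [seq i <- index_enum I | Q i]) nu (A i) w));
  last first.
  by apply/funext => w; rewrite big_filter.
have : uniq [seq i <- index_enum I | Q i] by rewrite filter_uniq// index_enum_uniq.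
elim: [seq _ <- _ | _] => [_|i s IH /= /andP[si us]].
  rewrite big_nil (_ : (fun w => _) = fun=> 0); first exact: ae_additive_set0.
  by apply/funext => w; rewrite big_nil.
have mU : measurable (\big[setU/set0]_(j <- s) A j) by exact: bigsetU_measurable.
have ms : measurable_fun setT (fun w => \sum_(j <- s) nu (A j) w).
  by apply: measurable_sum => j; exact: m_nu.
rewrite big_cons (_ : (fun w => _) = (fun w => nu (A i) w + \sum_(j <- s) nu (A j) w)); last first.
  by apply/funext => w; rewrite big_cons.
apply: (@aeq_trans _ _ _ _ _ (fun w => nu (A i) w + nu (\big[setU/set0]_(j <- s) A j) w)).
- by apply: m_nu; exact: measurableU.
- by apply: measurable_funD; exact: m_nu.
- by apply: measurable_funD => //; exact: m_nu.
- apply: nu_add.2 => //; apply/seteqP; split => // x [Ai].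
  rewrite -bigcup_seq => -[j /= js Aj].
  have ij : i = j by apply: (tA i j) => //; exists x.
  by move: si; rewrite ij js.
- apply: aeqD; try exact: m_nu; rewrite //; last exact: IH.
  exact: aeq_refl.
Qed.

(** Integrating [multiplier_pointwise] bounds the left side by tails of signed sums with weights of
    total 15. A signed sum is a difference of two values of [nu], which halves the level and costs a
    factor 2. As 31 exceeds 30, non-strict estimates suffice for the contradiction. *)
Lemma multiplier (I : finType) (B : I -> set S) (a : I -> R) (c : R) :
  (forall i, measurable (B i)) -> trivIset setT B -> (forall i, `|a i| <= 1) -> 0 < c ->
  exists Q : pred I,
    pr (fun w => c < `|\sum_i a i * nu (B i) w|) <=
    31 * pr (fun w => c / 8 <= `|nu (\bigcup_(i in [set i | Q i]) B i) w|).
Proof.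
move=> mB tB a1 c0.
have mnB i : measurable_fun setT (nu (B i)) by exact: m_nu.
pose Z (r : {ffun I -> bool}) w := \sum_i sgr (r i) * nu (B i) w.
have mZ r : measurable_fun setT (Z r) by exact: measurable_lin.
pose U (Q : pred I) := \bigcup_(i in [set i | Q i]) B i.
have mU Q : measurable (U Q) by rewrite /U bigcup_finE; exact: bigsetU_measurable.
have ineq : pr (fun w => c < `|\sum_i a i * nu (B i) w|) <=
    \sum_r multiplier_weight a r * pr (fun w => c / 4 <= `|Z r w|).
  have mX : event (fun w => c < `|\sum_i a i * nu (B i) w|).
    by apply: event_norm_lt; exact: measurable_lin.
  apply: (has_mean_le (has_mean_ind P mX)); last first.
    by move=> w; exact: (multiplier_pointwise a1 (fun i => nu (B i) w) c0).
  apply: has_mean_sum => r; apply: has_meanZ; apply: has_mean_ind.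
  exact: event_norm_le (mZ r).
have half r : exists Q : pred I, pr (fun w => c / 4 <= `|Z r w|) <=
    2 * pr (fun w => c / 8 <= `|nu (U Q) w|).
  have ZE : aeq (Z r) (fun w => nu (U (fun i => ~~ r i)) w - nu (U r) w).
    apply: (@aeq_trans _ _ _ _ _
      (fun w => \sum_(i | ~~ r i) nu (B i) w - \sum_(i | r i) nu (B i) w)) => //.
    - by apply: measurable_funB; exact: measurable_sum_cond.
    - by apply: measurable_funB; exact: m_nu.
    - apply: eq_aeq => w; rewrite /Z (bigID (fun i => r i)) /= addrC -sumrN.
      congr (_ + _); apply: eq_bigr => i; last by move=> ->; rewrite sgr_boolE mulN1r.
      by move=> /negbTE ->; rewrite sgr_boolE mul1r.
    - apply: aeq_sym; apply: aeqB; try exact: m_nu; try exact: measurable_sum_cond;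
        exact: ae_additive_sum.
  rewrite (pr_aeq_le _ _ _ ZE)//; last by apply: measurable_funB; exact: m_nu.
  have two : pr (fun w => c / 4 <= `|nu (U (fun i => ~~ r i)) w - nu (U r) w|) <=
      pr (fun w => c / 8 <= `|nu (U (fun i => ~~ r i)) w|) +
      pr (fun w => c / 8 <= `|nu (U r) w|).
    apply: le_trans (pr_or P _ _); try by apply: event_norm_le; exact: m_nu.
    apply: pr_le.
    - by apply: event_norm_le; apply: measurable_funB; exact: m_nu.
    - by apply: event_or; apply: event_norm_le; exact: m_nu.
    move=> w h; have tri := ler_normB (nu (U (fun i => ~~ r i)) w) (nu (U r) w).
    by case: leP => //= h1; case: leP => // h2; exfalso; lra.
  have [le|/ltW le] := leP (pr (fun w => c / 8 <= `|nu (U r) w|))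
      (pr (fun w => c / 8 <= `|nu (U (fun i => ~~ r i)) w|)).
    by exists (fun i => ~~ r i); lra.
  by exists (fun i => r i); lra.
apply: contrapT => /forallNP none; set p := pr _ in ineq none.
have lt_p Q : 31 * pr (fun w => c / 8 <= `|nu (U Q) w|) < p.
  by rewrite ltNge; apply/negP; exact: none.
have p0 : 0 < p by apply: le_lt_trans (lt_p xpred0); rewrite mulr_ge0 ?pr_ge0.
have : p <= \sum_r multiplier_weight a r * (2 * p / 31).
  apply: le_trans ineq _; apply: ler_sum => r _; rewrite ler_wpM2l ?multiplier_weight_ge0//.
  by have [Q] := half r; have := lt_p Q; lra.
by rewrite -mulr_suml multiplier_weight_sum; lra.
Qed.

End Additive.

(** * Unboundedness survives the removal of a random part *)

Section Unbounded.
Context (R : realType) (dO dS : measure_display) (Omega : measurableType dO)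
  (P : probability Omega R) (S : measurableType dS).
Local Notation pr := (Pr P).
Local Notation aeq := (as_eq P).
Local Notation ind := (@bool_ind R).
Local Notation sgr := (@bool_sign R).
Implicit Types (G A : set S) (e q : R).
Context (nu : set S -> Omega -> R) (nu_add : ae_additive P nu).
Let m_nu := nu_add.1.

(** Coefficients are allowed because the splitting argument multiplies pieces by random scalars;
    [unbounded_range] returns to plain sets at the cost of the factor 31. *)
Definition unbounded_at e G : Prop := forall c : R,
  exists (I : finType) (B : I -> set S) (a : I -> R),
    [/\ forall i, measurable (B i), forall i, B i `<=` G, trivIset setT B,
        forall i, `|a i| <= 1 & e <= pr (fun w => c < `|\sum_i a i * nu (B i) w|)].

Definition range_unbounded_at e G : Prop := forall c : R,
  exists E, [/\ measurable E, E `<=` G & e <= pr (fun w => c < `|nu E w|)].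

Lemma unbounded_range e G : unbounded_at e G -> range_unbounded_at (e / 31) G.
Proof.
move=> unb c; have c0 : 0 < 8 * (`|c| + 1) by rewrite mulr_gt0// ltr_wpDl.
have [I [B [a [mB BG tB a1 eB]]]] := unb (8 * (`|c| + 1)).
have [Q le] := multiplier nu_add mB tB a1 c0.
set E := \bigcup_(i in _) B i in le.
have mE : measurable E by rewrite /E bigcup_finE; exact: bigsetU_measurable.
exists E; split => //; first by apply: bigcup_sub => i _; exact: BG.
rewrite ler_pdivrMr// mulrC; apply: le_trans eB _; apply: le_trans le _.
rewrite ler_pM2l//; apply: pr_le; first by apply: event_norm_le; exact: m_nu.
  by apply: event_norm_lt; exact: m_nu.
move=> w; rewrite mulrC mulKf//; apply: lt_le_trans.
by rewrite (le_lt_trans (ler_norm c))// ltrDl.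
Qed.

Section Split.
Context (I : finType) (A : I -> set S) (M : nat) (G : set S).
Hypotheses (mA : forall i, measurable (A i)) (tA : trivIset setT A)
  (GA : G `<=` \bigcup_i A i).
Let N : R := M.+1%:R.
Let N_gt0 : 0 < N := ltr0Sn _ _.

Definition unselected (l : {ffun I -> 'I_M.+1}) : set S :=
  \bigcup_(i in [set i | ~~ selected l i]) A i.

(* Multiplying the parts of a large sum by independent random scalars makes
   all its partial sums large at once, up to a set of relative size [1 / N]. *)
Lemma scaled_parts_large (x : I -> R) (c0 : R) : 0 < c0 ->
  ind (#|I|%:R * (2 * N * c0) < `|\sum_i x i|) * (1 - N^-1) ^+ 2 <=
  unif_exp (fun l : {ffun I -> 'I_M.+1} => unif_exp (fun t : {ffun I -> 'I_M.+1} =>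
    ind (c0 < `|\sum_(i | ~~ selected l i) (t i).+1%:R / N * x i|))).
Proof.
move=> c0_gt0; have [big|_] := ltP; last first.
  rewrite mul0r; apply: uexp_ge0 => [|l]; first exact: card_lab_gt0.
  by apply: uexp_ge0 => [|t]; [exact: card_lab_gt0|exact: ind_ge0].
rewrite {1}/ind mul1r.
have [i0 xi0] : exists i0, 2 * N * c0 < `|x i0|.
  apply: contrapT => /forallNP none; move: big; apply/negP; rewrite -leNgt.
  apply: le_trans (ler_norm_sum _ _ _) _; rewrite mulr_natl -sumr_const.
  by apply: ler_sum => i _; rewrite leNgt; apply/negP; exact: none.
have sum1 (i : I) : \sum_(v : 'I_M.+1) #|'I_M.+1|%:R^-1 = 1 :> R.
  exact/unif_sum1/card_lab_gt0.
have w0 (i : I) (v : 'I_M.+1) : 0 <= #|'I_M.+1|%:R^-1 :> R by exact: unif_ge0.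
have good_count (Q : pred 'I_M.+1) : (#|[pred v | ~~ Q v]| <= 1)%N ->
    1 - N^-1 <= \sum_v #|'I_M.+1|%:R^-1 * ind (Q v).
  move=> bad1; rewrite lerBlDr -[leLHS](sum1 i0) -[X in _ + X]mulr1 card_ord -/N.
  apply: (@le_trans _ _ (\sum_v N^-1 * (ind (Q v) + ind (~~ Q v)))).
    by apply: ler_sum => v _; rewrite /bool_ind; case: (Q v); rewrite /= ?addr0 ?add0r mulr1.
  under eq_bigr do rewrite mulrDr; rewrite big_split /= lerD2l -mulr_sumr ler_pM2l ?invr_gt0//.
  apply: (@le_trans _ _ (#|[pred v | ~~ Q v]|%:R)); last by rewrite lern1.
  rewrite -sum1_card natr_sum [leRHS]big_mkcond ler_sum// => v _.
  by rewrite inE /bool_ind; case: (Q v).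
(* Only the label of [i0] varies first, then only its scalar. Each time at most one of the [N]
   values fails, whence the square of [1 - 1/N]. *)
rewrite expr2; apply: (@fexp_ge_coord _ _ _ _ w0 sum1 i0) => l.
apply: (@le_trans _ _ (\sum_v #|'I_M.+1|%:R^-1 * (ind (v != ord0) * (1 - N^-1)))).
  under eq_bigr do rewrite mulrA; rewrite -mulr_suml ler_wpM2r//.
    by rewrite subr_ge0 invf_le1// ler1n.
  by apply: good_count; rewrite -(card1 (ord0 : 'I_M.+1)); apply/eq_leq/eq_card => v;
    rewrite !inE negbK.
apply: ler_sum => v _; rewrite ler_wpM2l// ?invr_ge0 ?ler0n//.
have [_|v0] := boolP (v == ord0).
  rewrite mul0r; apply: uexp_ge0 => [|t]; [exact: card_lab_gt0|exact: ind_ge0].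
rewrite mul1r; apply: (@fexp_ge_coord _ _ _ _ w0 sum1 i0) => t.
apply: good_count.
set l' := upd l i0 v; have sel0 : ~~ selected l' i0 by rewrite /selected upd_same.
pose rest := \sum_(i | ~~ selected l' i && (i != i0)) (t i).+1%:R / N * x i.
have E u : \sum_(i | ~~ selected l' i) (upd t i0 u i).+1%:R / N * x i =
    u.+1%:R / N * x i0 + rest.
  rewrite (bigD1 i0)//= upd_same; congr (_ + _).
  by apply: eq_bigr => i /andP[_ ii0]; rewrite upd_other.
(* Two different scalars at [i0] give sums at distance at least [|x i0| / N > 2 * c0], so at most
   one sum lies in [[-c0, c0]]. *)
apply/card_le1_eqP => u u'; rewrite !inE !E -!leNgt => h h'.
apply/eqP; apply: contraT => uu'.
have : `|(u%:R - u'%:R) / N * x i0| <= 2 * c0.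
  rewrite (_ : _ * _ = (u.+1%:R / N * x i0 + rest) - (u'.+1%:R / N * x i0 + rest)).
    by apply: le_trans (ler_normB _ _) _; rewrite [leRHS]mulr_natl mulr2n lerD.
  by rewrite -!natr1; ring.
apply/contraTT => _; rewrite -ltNge.
rewrite !normrM normfV (gtr0_norm N_gt0).
have d1 : 1 <= `|u%:R - u'%:R| :> R.
  have : (u < u')%N || (u' < u)%N by rewrite -neq_ltn eq_sym (inj_eq val_inj).
  case/orP => lt; [rewrite distrC|]; rewrite -natrB ?(ltnW lt)// normr_nat ler1n subn_gt0//.
rewrite mulrAC ltr_pdivlMr//; apply: (@lt_le_trans _ _ `|x i0|); last by rewrite ler_peMl.
by apply: le_lt_trans xi0; rewrite mulrAC.
Qed.

(** For a bad labelling some level is exceeded only with probability below [(1 - q) * e], and [c0]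
    dominates these finitely many levels. Start from a sum that is huge on an event [V] of
    probability at least [e]: by [scaled_parts_large] its unselected scaled parts exceed [c0] on
    most of [V] on average, whereas each bad labelling loses at least the fraction [q] of [V]. *)
Lemma split_unbounded e q : 0 < e -> 0 <= q <= 1 -> unbounded_at e G ->
  q * unif_exp (fun l => ind (~~ `[< unbounded_at ((1 - q) * e) (unselected l) >]))
    <= 2 / N.
Proof.
move=> e0 /andP[q0 q1] unb.
pose bad l := ~~ `[< unbounded_at ((1 - q) * e) (unselected l) >].
have /choice[c cP] : forall l, exists c : R, bad l ->
    forall (J : finType) (B : J -> set S) (a : J -> R),
    (forall i, measurable (B i)) -> (forall i, B i `<=` unselected l) ->
    trivIset setT B -> (forall i, `|a i| <= 1) ->
    pr (fun w => c < `|\sum_i a i * nu (B i) w|) < (1 - q) * e.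
  move=> l; have [/asboolP/existsNP[c cN]|good] := boolP (bad l); last by exists 0.
  exists c => _ J B a mB BG tB a1; rewrite ltNge; apply/negP => h.
  by apply: cN; exists J, B, a.
pose c0 := 1 + \sum_l `|c l|.
have c0_gt0 : 0 < c0 by rewrite ltr_pwDl// sumr_ge0.
have c_le l : c l <= c0.
  rewrite /c0 (bigD1 l)//= addrCA (le_trans (ler_norm _))// lerDl.
  by rewrite addr_ge0// sumr_ge0.
have [J [B [a [mB BG tB a1 eB]]]] := unb (#|I|%:R * (2 * N * c0)).
pose BA j i := B j `&` A i.
have mBA j i : measurable (BA j i) by exact: measurableI.
pose X i w := \sum_j a j * nu (BA j i) w.
have mX i : measurable_fun setT (X i) by apply: measurable_lin => j; exact: m_nu.
pose V w := #|I|%:R * (2 * N * c0) < `|\sum_i X i w|.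
have mV : event V by apply: event_norm_lt; exact: measurable_sum_cond.
have eV : e <= pr V.
  apply: le_trans eB _; rewrite /V (@pr_aeq_lt _ _ _ _ _ (fun w => \sum_i X i w)) //.
  - by apply: measurable_lin => j; exact: m_nu.
  - exact: measurable_sum_cond.
  rewrite (_ : (fun w => \sum_i X i w) = fun w => \sum_j a j * \sum_i nu (BA j i) w).
    apply: aeq_lin => [j|j|j _]; [exact: m_nu|by apply: measurable_sum_cond => i; exact: m_nu|].
    rewrite {1}(_ : B j = \bigcup_(i in [set i | xpredT i]) BA j i).
      apply: (ae_additive_sum nu_add) => // i i' _ _ [s [[_ Ai] [_ Ai']]].
      by apply: (@tA i i') => //; exists s.
    rewrite -setI_bigcupr; apply/esym/setIidPl => s /BG /GA [i _ Ai].
    by exists i.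
  apply/funext => w; rewrite exchange_big; apply: eq_bigr => j _ /=.
  by rewrite mulr_sumr.
pose Y (l t : {ffun I -> 'I_M.+1}) w := \sum_(i | ~~ selected l i) (t i).+1%:R / N * X i w.
have mY l t : measurable_fun setT (Y l t) by exact: measurable_lin.
pose E l t w := V w && (c0 < `|Y l t w|).
have mE l t : event (E l t) by apply: event_and => //; exact: event_norm_lt.
have ineq : pr V * (1 - N^-1) ^+ 2 <= unif_exp (fun l => unif_exp (fun t => pr (E l t))).
  have hV := has_meanZ ((1 - N^-1) ^+ 2) (has_mean_ind P mV).
  rewrite mulrC; apply: (has_mean_le hV).
    apply: has_mean_uexp => l; apply: has_mean_uexp => t; apply: has_mean_ind.
    exact: mE.
  move=> w; have [Vw|Vw] := boolP (V w); last first.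
    rewrite mulr0; apply: uexp_ge0 => [|l]; first exact: card_lab_gt0.
    by apply: uexp_ge0 => [|t]; [exact: card_lab_gt0|exact: ind_ge0].
  rewrite mulrC; have := scaled_parts_large (fun i => X i w) c0_gt0.
  by rewrite -/(V w) Vw /E Vw.
have badE l t : bad l -> pr (E l t) <= (1 - q) * pr V.
  move=> bl; apply: (@le_trans _ _ ((1 - q) * e)); last first.
    by rewrite ler_wpM2l// subr_ge0.
  (* Selected pieces are emptied instead of removed, which keeps the index type [J * I]. *)
  pose B' (p : J * I) := if selected l p.2 then set0 else BA p.1 p.2.
  pose a' (p : J * I) := if selected l p.2 then 0 else (t p.2).+1%:R / N * a p.1.
  have mB' p : measurable (B' p) by rewrite /B'; case: ifP.
  have B'G p : B' p `<=` unselected l.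
    by rewrite /B'; case: ifPn => [_ s []|sp s [_ As]]; exists p.2.
  have tB' : trivIset setT B'.
    move=> [j i] [j' i'] _ _ [s []]; rewrite /B' /=.
    case: ifP => // _ [Bs As]; case: ifP => // _ [Bs' As'].
    by congr pair; [apply: (tB j j') => //; exists s|apply: (@tA i i') => //; exists s].
  have a'1 p : `|a' p| <= 1.
    rewrite /a'; case: ifP => _; first by rewrite normr0.
    rewrite normrM mulr_ile1// ger0_norm ?divr_ge0//.
    by rewrite ler_pdivrMr// mul1r ler_nat.
  apply/ltW; apply: le_lt_trans (cP l bl _ B' a' mB' B'G tB' a'1).
  apply: pr_le => //.
    by apply: event_norm_lt; apply: measurable_lin => p; exact: m_nu.
  move=> w /andP[_ h]; apply: le_lt_trans (c_le l) _.
  rewrite (_ : \sum_p _ = Y l t w)//.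
  rewrite -(pair_bigA _ (fun j i => a' (j, i) * nu (B' (j, i)) w)) /= exchange_big /=.
  rewrite /Y [RHS]big_mkcond; apply: eq_bigr => i _; rewrite /a' /B' /=.
  case: (selected l i) => /=; first by rewrite big1// => j _; rewrite mul0r.
  by rewrite mulr_sumr; apply: eq_bigr => j _; rewrite mulrA.
have le_V l t : pr (E l t) <= pr V by apply: pr_le => // w /andP[].
have V0 : 0 < pr V by exact: lt_le_trans eV.
have : unif_exp (fun l => unif_exp (fun t => pr (E l t))) <=
    unif_exp (fun l => pr V * (1 - q * ind (bad l))).
  apply: uexp_le => l; rewrite -[leRHS](@uexp_cst _ I 'I_M.+1 (card_lab_gt0 M)).
  apply: uexp_le => t; have [bl|_] := boolP (bad l).
    by rewrite mulr1 mulrC badE.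
  by rewrite mulr0 subr0 mulr1.
pose u := unif_exp (fun l => ind (bad l)).
have -> : unif_exp (fun l => pr V * (1 - q * ind (bad l))) = pr V * (1 - q * u).
  by rewrite /unif_exp fexpZ fexpB fexpZ -![fexp _ _]/(unif_exp _) uexp_cst ?card_lab_gt0.
move=> le_u.
have : (1 - N^-1) ^+ 2 <= 1 - q * u.
  by rewrite -(ler_pM2l V0); exact: le_trans le_u.
rewrite -[q * _]/(q * u); move: (q * u) (N^-1) => z t.
by have := sqr_ge0 t; rewrite (_ : (1 - t) ^+ 2 = 1 - 2 * t + t ^+ 2); [lra|ring].
Qed.

End Split.
End Unbounded.

(** * A random part contains a set of non-small measure *)

Section ManyHits.
Context (R : realType) (dO dS : measure_display) (Omega : measurableType dO)
  (P : probability Omega R) (S : measurableType dS).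
Local Notation pr := (Pr P).
Local Notation aeq := (as_eq P).
Local Notation ind := (@bool_ind R).
Local Notation sgr := (@bool_sign R).
Implicit Types (G A : set S) (e q : R).
Context (nu : set S -> Omega -> R) (nu_add : ae_additive P nu).
Let m_nu := nu_add.1.

Section Cells.
Context (K : nat) (E : nat -> set S) (G : set S).
Local Notation I := {ffun 'I_K -> bool}.

Definition signature (s : S) : I := [ffun l : 'I_K => `[< E l s >]].

(** For [j <= K] the nonempty cells are the atoms, within [G], of the algebra generated by the first
    [j] sets [E l]. *)
Definition cell (j : nat) (r : I) : set S := G `&` [set s | prefix j (signature s) = r].

Lemma measurable_cell j r : measurable G -> (forall l, (l < j)%N -> measurable (E l)) ->
  measurable (cell j r).
Proof.
move=> mG mE; apply: measurableI => //.
rewrite (_ : [set s | _] = \bigcap_(l in [set: 'I_K]) [set s | (l < j)%N && `[< E l s >] = r l]).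
  apply: fin_bigcap_measurable => [|l _]; first exact: finite_finset.
  have [lj|_] := boolP (l < j)%N; last first.
    rewrite /=; case: (r l); last by rewrite (_ : [set _ | _] = setT)//; apply/seteqP; split.
    by rewrite (_ : [set _ | _] = set0)//; apply/seteqP; split.
  rewrite /=; case: (r l).
    rewrite (_ : [set _ | _] = E l); first exact: mE.
    by apply/seteqP; split=> s /=; [move/asboolP|move=> ?; exact/asboolP].
  rewrite (_ : [set _ | _] = ~` E l); first by apply: measurableC; exact: mE.
  by apply/seteqP; split=> s /=; [move/asboolPn|move=> ?; exact/asboolPn].
apply/seteqP; split=> s /=.
  by move=> <- l _; rewrite !ffunE.
by move=> H; apply/ffunP => l; rewrite !ffunE; exact: H.
Qed.

Lemma cell_prefix j r : \bigcup_(i in [set i | prefix j i == r]) cell K i = cell j r.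
Proof.
have full (i : I) : prefix K i = i by apply/ffunP => l; rewrite ffunE ltn_ord.
apply/seteqP; split=> s.
  by move=> [i /eqP <- [Gs /=]]; rewrite full => <-; split.
move=> [Gs /= sr]; exists (signature s); first by rewrite /= sr.
by split => //=; rewrite full.
Qed.

Lemma cell_mem (j : 'I_K) : E j `<=` G -> \bigcup_(i in [set i : I | i j]) cell K i = E j.
Proof.
have full (i : I) : prefix K i = i by apply/ffunP => l; rewrite ffunE ltn_ord.
move=> EG; apply/seteqP; split=> s.
  by move=> [i /= ij [Gs /=]]; rewrite full => si; move: ij; rewrite -si ffunE => /asboolP.
move=> Es; exists (signature s); first by rewrite /= ffunE; exact/asboolP.
by split; [exact: EG|rewrite /= full].
Qed.

Lemma trivIset_cell : trivIset setT (cell K).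
Proof. by move=> i i' _ _ [s [[_ /= <-] [_ /= <-]]]. Qed.

End Cells.

Lemma eq_cell K (E E' : nat -> set S) G j r :
  (forall l, (l < j)%N -> E l = E' l) -> @cell K E G j r = cell E' G j r.
Proof.
move=> EE'; congr (_ `&` _); apply/seteqP; split=> s /= <-; apply/ffunP => l;
  by rewrite !ffunE; case: ltnP => //= lj; rewrite EE'.
Qed.

(** The order of choice matters: the sets before [E n] determine finitely many cells, a bound [b n]
    is taken for these, and only then is [E n] chosen beyond the threshold computed from [b n]. *)
Lemma large_levels K M k e delta G : 0 < delta -> measurable G -> range_unbounded_at P nu e G ->
  forall n, exists (E : nat -> set S) (b : nat -> R), forall j, (j < n)%N ->
    [/\ measurable (E j), E j `<=` G,
        e <= pr (fun w => threshold K M k (b j) < `|nu (E j) w|) &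
        forall r, pr (fun w => b j < `|nu (@cell K E G j r) w|) <= delta].
Proof.
move=> d0 mG unb; elim=> [|n [E [b IH]]]; first by exists (fun=> set0), (fun=> 0).
have mE l : (l < n)%N -> measurable (E l) by move=> /IH [].
have mc r : measurable_fun setT (nu (@cell K E G n r)).
  by apply: m_nu; apply: measurable_cell.
have [c cP] := tails_small P mc d0.
have [F [mF FG eF]] := unb (threshold K M k c).
exists (fun l => if l == n then F else E l), (fun l => if l == n then c else b l).
move=> j; rewrite ltnS leq_eqVlt => /orP[/eqP ->|jn].
  rewrite eqxx; split=> // r; rewrite (@eq_cell _ _ E) // => l ln.
  by rewrite ltn_eqF.
rewrite ltn_eqF//; have [? ? ? Hb] := IH j jn; split=> // r.
rewrite (@eq_cell _ _ E) // => l lj.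
by rewrite ltn_eqF// (ltn_trans lj).
Qed.

Definition hit_at e (F : set S) : Prop :=
  exists E, [/\ measurable E, E `<=` F & e <= pr (fun w => 16^-1 <= `|nu E w|)].

(** Integrated, the left side of [hit_rate_ge] is at least [e / 600]: every level is large with
    probability at least [e], the term [k / K] costs at most [e / 4], and so do all the cell bounds
    together. Without a hit, [multiplier] caps each rate at [31 * (e / 1200 / 62) = e / 2400]. If
    [u] is the proportion of labellings with a hit, then [2 * (u + e / 2400) >= e / 600]. *)
Lemma many_hits K M k e G : (0 < K)%N -> M.+1 = (100 * k)%N -> 0 < e ->
  4 * k%:R <= e * K%:R -> measurable G -> range_unbounded_at P nu e G ->
  exists A : {ffun 'I_K -> bool} -> set S,
    [/\ forall i, measurable (A i), trivIset setT A, G = \bigcup_i A i &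
      e / 2400 <= unif_exp (fun l : {ffun _ -> 'I_M.+1} =>
        ind `[< hit_at (e / 1200 / 62) (\bigcup_(i in [set i | selected l i]) A i) >])].
Proof.
move=> K0 MK e0 kK mG unb.
have KR : 0 < K%:R :> R by rewrite ltr0n.
pose I := {ffun 'I_K -> bool}.
have I0 : 0 < #|{: I}|%:R :> R.
  by rewrite ltr0n; apply/card_gt0P; exists [ffun=> true].
have d0 : 0 < e / (4 * K%:R * #|{: I}|%:R) by rewrite divr_gt0// !mulr_gt0.
have [E [b Eb]] := @large_levels K M k e _ G d0 mG unb K.
pose A : I -> set S := cell E G K.
have mA i : measurable (A i) by apply: measurable_cell => // l /Eb [].
have tA : trivIset setT A by exact: trivIset_cell.
exists A; split => //.
  apply/seteqP; split=> s; last by move=> [i _ []].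
  move=> Gs; exists (prefix K (signature K E s)) => //.
pose x i w := nu (A i) w.
have mx i : measurable_fun setT (x i) by exact: m_nu.
pose U (j : 'I_K) w := threshold K M k (b j) < `|\sum_(i : I) (i j)%:R * x i w|.
pose bad (j : 'I_K) (r : I) w := b j < `|\sum_(i | prefix j i == r) x i w|.
have mU j : event (U j) by apply: event_norm_lt; exact: measurable_lin.
have mbad j r : event (bad j r) by apply: event_norm_lt; exact: measurable_sum_cond.
have prU j : e <= pr (U j).
  have [mE EG le _] := Eb j (ltn_ord j); apply: le_trans le _; rewrite le_eqVlt; apply/orP;
    left; apply/eqP.
  apply: pr_aeq_lt; [exact: m_nu|exact: measurable_lin|].
  rewrite -{1}(cell_mem EG) (_ : (fun w => _) = fun w => \sum_(i : I | i j) nu (A i) w).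
    exact: ae_additive_sum.
  apply/funext => w; rewrite [RHS]big_mkcond; apply: eq_bigr => i _.
  by case: (i j); rewrite ?mul1r ?mul0r.
have prbad j r : pr (bad j r) <= e / (4 * K%:R * #|{: I}|%:R).
  have [_ _ _ le] := Eb j (ltn_ord j); apply: le_trans (le r).
  rewrite le_eqVlt; apply/orP; left; apply/eqP; apply: pr_aeq_lt.
  - exact: measurable_sum_cond.
  - by apply: m_nu; apply: measurable_cell => // l lj; have [] := Eb l (ltn_trans lj (ltn_ord j)).
  - by rewrite -cell_prefix; apply: aeq_sym; exact: ae_additive_sum.
pose C := ('I_K * I + 'I_K)%type.
pose E1 (l : {ffun I -> 'I_M.+1}) (r : {ffun I -> bool}) w :=
  1 <= `|\sum_(i | selected l i) sgr (r i) * x i w|.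
pose E2 (l : {ffun I -> 'I_M.+1}) (r : {ffun C -> bool}) w :=
  1 <= `|\sum_(i | selected l i) (\sum_c sgr (r c) * test R c i) * x i w|.
have mE1 l r : event (E1 l r) by apply: event_norm_le; exact: measurable_lin.
have mE2 l r : event (E2 l r) by apply: event_norm_le; exact: measurable_lin.
have ineq : 300^-1 * ((\sum_j pr (U j) - k%:R) / K%:R - \sum_j \sum_r pr (bad j r)) <=
    unif_exp (fun l => unif_exp (fun r => pr (E1 l r))) + unif_exp (fun l =>
      unif_exp (fun r => pr (E2 l r))).
  have meanL : has_mean P (fun w => 300^-1 * (K%:R^-1 * (\sum_j ind (U j w) - k%:R) - \sum_j
    \sum_r ind (bad j r w)))
      (300^-1 * (K%:R^-1 * (\sum_j pr (U j) - k%:R) - \sum_j \sum_r pr (bad j r))).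
    apply: has_meanZ; apply: has_meanB.
      apply: has_meanZ; apply: has_meanB; last exact: has_mean_cst.
      by apply: has_mean_sum => j; apply: has_mean_ind.
    by apply: has_mean_sum => j; apply: has_mean_sum => r; apply: has_mean_ind.
  have meanR : has_mean P (fun w => unif_exp (fun l => unif_exp (fun r =>
    ind (E1 l r w))) + unif_exp (fun l => unif_exp (fun r => ind (E2 l r w))))
     (unif_exp (fun l => unif_exp (fun r => pr (E1 l r))) + unif_exp (fun l =>
       unif_exp (fun r => pr (E2 l r)))).
    apply: has_meanD; apply: has_mean_uexp => l; apply: has_mean_uexp => r;
      exact: has_mean_ind.
  rewrite [X in X - _]mulrC; apply: (has_mean_le meanL meanR) => w.
  rewrite [X in X - _]mulrC.
  exact: (hit_rate_ge K0 MK (fun j => b j) (fun i => x i w)).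
have lower : e / 600 <= 300^-1 * ((\sum_j pr (U j) - k%:R) / K%:R - \sum_j \sum_r pr (bad j r)).
  have sU : e * K%:R <= \sum_j pr (U j).
    by rewrite mulr_natr -[K in X in X <= _]card_ord -sumr_const ler_sum.
  have sb : \sum_j \sum_r pr (bad j r) <= e / 4.
    apply: (@le_trans _ _ (\sum_(j < K) \sum_(r : I) e / (4 * K%:R * #|{: I}|%:R))).
      by apply: ler_sum => j _; apply: ler_sum => r _.
    rewrite !sumr_const card_ord -mulrnA -[leLHS]mulr_natr natrM.
    by rewrite le_eqVlt; apply/orP; left; apply/eqP; field; rewrite !gt_eqF.
  have : 3 / 4 * e <= (\sum_j pr (U j) - k%:R) / K%:R.
    by rewrite ler_pdivlMr//; lra.
  by lra.
pose good (l : {ffun I -> 'I_M.+1}) := `[< hit_at (e / 1200 / 62) (\bigcup_(i in [set i |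
  selected l i]) A i) >].
have small_in_prob l (a : I -> R) : ~~ good l -> (forall i, `|a i| <= 1) ->
    pr (fun w => 1 <= `|\sum_(i | selected l i) a i * x i w|) <= 31 * (e / 1200 / 62).
  move=> /asboolPn bl a1.
  pose a' i := if selected l i then a i else 0.
  pose B i := if selected l i then A i else set0.
  have mB i : measurable (B i) by rewrite /B; case: ifP.
  have tB : trivIset setT B.
    move=> i i' _ _ [s []]; rewrite /B; case: ifP => // _ As; case: ifP => // _ As'.
    by apply: (tA i i') => //; exists s.
  have a'1 i : `|a' i| <= 1 by rewrite /a'; case: ifP => // _; rewrite normr0.
  (* [multiplier] has a strict inequality on its left side, hence a level below 1; the level 1/2
     becomes [(1/2) / 8 = 1/16] in [hit_at]. *)
  have half : 0 < 2^-1 :> R by rewrite invr_gt0.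
  have [Q le] := multiplier nu_add mB tB a'1 half.
  apply: le_trans (_ : _ <= pr (fun w => 2^-1 < `|\sum_i a' i * nu (B i) w|)) _.
    apply: pr_le.
    - by apply: event_norm_le; exact: measurable_lin.
    - by apply: event_norm_lt; apply: measurable_lin => i; exact: m_nu.
    move=> w h; rewrite (_ : \sum_i _ = \sum_(i | selected l i) a i * x i w).
      by apply: lt_le_trans h; lra.
    rewrite [RHS]big_mkcond; apply: eq_bigr => i _; rewrite /a' /B.
    by case: ifP; rewrite ?mul0r.
  apply: le_trans le _; rewrite ler_pM2l// leNgt; apply/negP => h; apply: bl.
  exists (\bigcup_(i in [set i | Q i]) B i); split.
  - by rewrite bigcup_finE; exact: bigsetU_measurable.
  - move=> s [i _]; rewrite /B; case: ifPn => // li As; by exists i.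
  - rewrite (_ : 16^-1 = 2^-1 / 8 :> R); first exact: ltW.
    by field.
have upper (F : {ffun I -> 'I_M.+1} -> R) : (forall l, F l <= 1) ->
    (forall l, ~~ good l -> F l <= 31 * (e / 1200 / 62)) ->
    unif_exp F <= unif_exp (fun l => ind (good l)) + 31 * (e / 1200 / 62).
  move=> F1 Fb; rewrite -[X in _ + X](@uexp_cst _ I 'I_M.+1 (card_lab_gt0 M)).
  rewrite /unif_exp -fexpD; apply: (@uexp_le _ I 'I_M.+1) => l; have [gl|bl] := boolP (good l).
    by rewrite (le_trans (F1 l))// lerDl; lra.
  by rewrite add0r Fb.
have bound (D : finType) (F : {ffun I -> 'I_M.+1} -> {ffun D -> bool} -> Omega -> bool) l c :
    (forall r, pr (F l r) <= c) -> unif_exp (fun r => pr (F l r)) <= c.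
  move=> H; rewrite -[leRHS](@uexp_cst _ D bool card_bool_gt0); exact: uexp_le.
have u1 : unif_exp (fun l => unif_exp (fun r => pr (E1 l r))) <= unif_exp (fun l =>
  ind (good l)) + 31 * (e / 1200 / 62).
  apply: upper => l; first by apply: bound => r; exact: pr_le1.
  move=> bl; apply: bound => r; apply: small_in_prob => // i.
  by rewrite /bool_sign normrX normrN normr1 expr1n.
have u2 : unif_exp (fun l => unif_exp (fun r => pr (E2 l r))) <= unif_exp (fun l =>
  ind (good l)) + 31 * (e / 1200 / 62).
  apply: upper => l; first by apply: bound => r; exact: pr_le1.
  move=> bl; apply: bound => r; apply: small_in_prob => // i.
  apply: le_trans (sum_test_le1 R K0 i); apply: le_trans (ler_norm_sum _ _ _) _.
  apply: ler_sum => c _; rewrite normrM /bool_sign normrX normrN normr1 expr1n.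
  by rewrite mul1r.
move: (unif_exp (fun l => ind (good l))) u1 u2 => u u1 u2; lra.
Qed.

End ManyHits.

(** * Boundedness of measures with values in L0 *)

Section Boundedness.
Context (R : realType) (dO dS : measure_display) (Omega : measurableType dO)
  (P : probability Omega R) (S : measurableType dS).
Local Notation pr := (Pr P).
Local Notation ind := (@bool_ind R).
Context (nu : set S -> Omega -> R) (nu_add : ae_additive P nu).

(** Over the labellings, the selected part has a hit with probability at least [kap], while the
    unselected part fails to be unbounded with probability at most [2 / (q * N)]. Since
    [N = 100 * k] with [k > 2 / (q * kap)], some labelling has both good properties. The number [K]
    of levels is chosen after [k]. *)
Lemma peel e e' (G : set S) : 0 < e' -> e' < e -> measurable G ->
  unbounded_at P nu e G ->
  exists FG : set S * set S,
    [/\ measurable FG.1, measurable FG.2, FG.1 `<=` G & FG.2 `<=` G] /\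
    [/\ FG.1 `&` FG.2 = set0, unbounded_at P nu e' FG.2 &
        e / 31 / 1200 / 62 <= pr (fun w => 16^-1 <= `|nu FG.1 w|)].
Proof.
move=> e'0 e'e mG unb; have e0 : 0 < e by exact: lt_trans e'e.
pose q := 1 - e' / e.
have q0 : 0 < q by rewrite subr_gt0 ltr_pdivrMr// mul1r.
have q1 : q <= 1 by rewrite gerBl divr_ge0// ltW.
have runb := unbounded_range nu_add unb.
set r := e / 31 in runb *; have r0 : 0 < r by rewrite divr_gt0.
have [kap kapE] : exists kap, kap = r / 2400 by exists (r / 2400).
have kap_gt0 : 0 < kap by rewrite kapE; lra.
have kap0 : 0 < q * kap by exact: mulr_gt0.
pose k := (Num.Def.archi_bound (2 / (q * kap))).+1.
have kP : 2 / (q * kap) < k%:R.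
  apply: lt_le_trans (archi_boundP _) _; first by apply: divr_ge0 => //; exact: ltW.
  by rewrite ler_nat leqnSn.
pose K := (Num.Def.archi_bound (4 * k%:R / r)).+1.
have kK : 4 * k%:R <= r * K%:R.
  rewrite -ler_pdivrMl// mulrC; apply: le_trans (ltW (archi_boundP _)) _.
    by rewrite divr_ge0 ?mulr_ge0// ltW.
  by rewrite ler_nat leqnSn.
pose M := (100 * k).-1; have MK : M.+1 = (100 * k)%N by [].
have [A [mA tA GA]] := many_hits nu_add (isT : (0 < K)%N) MK r0 kK mG runb.
rewrite -kapE => many.
have GA' : G `<=` \bigcup_i A i by rewrite -GA.
have few := split_unbounded nu_add M mA tA GA' e0 _ unb.
have {few} := few q; rewrite (ltW q0) q1 => /(_ isT) few.
have qe : (1 - q) * e = e' by rewrite /q subKr divfK// gt_eqF.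
rewrite qe in few.
pose good (l : {ffun _ -> 'I_M.+1}) :=
  `[< hit_at P nu (r / 1200 / 62) (\bigcup_(i in [set i | selected l i]) A i) >].
pose bad l := ~~ `[< unbounded_at P nu e' (@unselected _ _ _ A M l) >].
have [l [gl bl]] : exists l, good l /\ ~~ bad l.
  apply: contrapT => /forallNP none.
  have : unif_exp (fun l => ind (good l)) <= unif_exp (fun l => ind (bad l)).
    apply: uexp_le => l; apply: ind_le => gl; apply: contraT => bl.
    by case: (none l).
  move=> gb; have : q * kap <= 2 / M.+1%:R.
    apply: le_trans few; rewrite ler_pM2l//; exact: le_trans gb.
  rewrite ler_pdivlMr ?ltr0n// -ler_pdivlMl// mulrC leNgt => /negP; apply.
  apply: lt_le_trans kP _; rewrite ler_nat MK.
  by rewrite leq_pmull.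
move: gl => /asboolP[E [mE EF rE]].
have mUn : measurable (@unselected _ _ _ A M l).
  by rewrite /unselected (bigcup_finE (fun i => ~~ selected l i)); exact: bigsetU_measurable.
exists (E, @unselected _ _ _ A M l); split; split => //=.
- by move=> s /EF [i _ As]; rewrite GA; exists i.
- by move=> s [i _ As]; rewrite GA; exists i.
- apply/seteqP; split=> // s [/EF[i /= li As] [i' /= li' As']].
  have ii' : i = i' by apply: (tA i i') => //; exists s.
  by move: li'; rewrite -ii' li.
- by move: bl; rewrite negbK => /asboolP.
Qed.

Hypothesis nu_exh : forall E : nat -> set S, (forall n, measurable (E n)) ->
  trivIset setT E -> forall eps : R, 0 < eps ->
  exists n, pr (fun w => eps <= `|nu (E n) w|) < eps.

(* The theorem of Talagrand and of Kalton, Peck and Roberts: measures with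
   values in L0 are bounded. *)
Theorem L0_measure_bounded (e : R) : 0 < e -> ~ unbounded_at P nu e setT.
Proof.
move=> e0 unb.
(* Each peeling lowers the level strictly. These levels start at [e] and stay above [e / 2], so all
   the peeled sets are hit with probability at least [rho]. *)
pose en n : R := e / 2 * (1 + n.+1%:R^-1).
have en_gt n : e / 2 < en n by rewrite /en mulrDr mulr1 ltrDl mulr_gt0 ?invr_gt0 ?divr_gt0.
have en0 n : 0 < en n by apply: lt_trans (en_gt n); rewrite divr_gt0.
have en_dec n : en n.+1 < en n.
  by rewrite /en ltr_pM2l ?divr_gt0// ltrD2l ltf_pV2 ?posrE// ltr_nat.
pose inv n (G : set S) := measurable G /\ unbounded_at P nu (en n) G.
have /choice[f fP] : forall nG : nat * set S, exists FG : set S * set S, inv nG.1 nG.2 ->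
    [/\ measurable FG.1, FG.1 `<=` nG.2, FG.2 `<=` nG.2 & FG.1 `&` FG.2 = set0] /\
    inv nG.1.+1 FG.2 /\ en nG.1 / 31 / 1200 / 62 <= pr (fun w => 16^-1 <= `|nu FG.1 w|).
  move=> [n G]; have [[mG uG]|] := pselect (inv n G); last by exists (set0, set0).
  have [FG [[? ? ? ?] [? ? ?]]] := peel (en0 n.+1) (en_dec n) mG uG.
  by exists FG.
pose G := fix G n := if n is m.+1 then (f (m, G m)).2 else setT.
pose F n := (f (n, G n)).1.
have invG n : inv n (G n).
  elim: n => [|n IH]; last by have [_ [? _]] := fP (n, G n) IH.
  have e0E : en 0 = e by rewrite /en invr1; field.
  by split => //=; rewrite e0E.
have FP n := fP (n, G n) (invG n).
have G_dec m n : (m <= n)%N -> G n `<=` G m.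
  elim: n => [|n IH]; first by rewrite leqn0 => /eqP ->.
  rewrite leq_eqVlt => /orP[/eqP -> //|]; rewrite ltnS => /IH.
  by apply: subset_trans; have [[]] := FP n.
have mF n : measurable (F n) by have [[]] := FP n.
have dF m n : (m < n)%N -> F m `&` F n = set0.
  move=> mn; apply/seteqP; split=> // s [Fm Fn].
  have [[_ _ _ <-] _] := FP m; split => //.
  have [[_ FG _ _] _] := FP n.
  exact: (G_dec m.+1 n mn) (FG _ Fn).
have tF : trivIset setT F.
  move=> i j _ _ [s [Fi Fj]]; have [ij|ji|//] := ltngtP i j.
    by have : (F i `&` F j) s by []; rewrite dF.
  by have : (F j `&` F i) s by []; rewrite dF.
pose rho := e / 2 / 31 / 1200 / 62.
have rho0 : 0 < rho by rewrite /rho; lra.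
pose eps := Num.min 16^-1 rho.
have eps0 : 0 < eps by rewrite lt_min rho0 andbT; lra.
have [n] := nu_exh mF tF eps0; apply/negP; rewrite -leNgt.
have [_ [_ le]] := FP n.
apply: (@le_trans _ _ rho); first by rewrite ge_min lexx orbT.
apply: (@le_trans _ _ (pr (fun w => 16^-1 <= `|nu (F n) w|))).
  by apply: le_trans le; rewrite /rho /=; have := en_gt n; lra.
apply: pr_le; try exact: event_norm_le (nu_add.1 _ (mF n)).
by move=> w h; apply: le_trans h; rewrite ge_min lexx.
Qed.

End Boundedness.

(** * Convergence in probability and completeness of L0 *)

Section ConvergenceInProbability.
Context (R : realType) (dO : measure_display) (Omega : measurableType dO)
  (P : probability Omega R).
Local Notation pr := (Pr P).
Local Notation aeq := (as_eq P).
Implicit Types (X Y Z : Omega -> R).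

(** One parameter serves for size and probability, as in the Ky Fan metric, so that parameters
    simply add under sums. *)
Definition small_in_prob (e : R) X := pr (fun w => e <= `|X w|) <= e.

Lemma small_mono X (e e' : R) : measurable_fun setT X -> e <= e' -> small_in_prob e X ->
  small_in_prob e' X.
Proof.
move=> mX ee' sX; apply: (le_trans _ ee'); apply: le_trans sX.
by apply: pr_le; try exact: event_norm_le; move=> w; exact: le_trans ee'.
Qed.

Lemma measurable_L0 (X : L0 P) : measurable_fun setT X.
Proof. exact: (@measurable_funP _ _ _ _ setT (repr X : {mfun Omega >-> measurableTypeR R})). Qed.

Lemma L0_ext (X Y : L0 P) : aeq X Y -> X = Y.
Proof.
move=> XY; rewrite -[X]reprK -[Y]reprK; apply/eqquotP => /=.
apply/asboolP; exists [set w | X w != Y w]; split.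
- exact: event_neq (measurable_L0 X) (measurable_L0 Y).
- exact: (etrans (P_pr P (event_neq (measurable_L0 X) (measurable_L0 Y))) (congr1 EFin XY)).
- by move=> w /= H; apply/eqP => e; apply: H => _; exact: e.
Qed.

Lemma L0_of X : measurable_fun setT X -> exists Y : L0 P, aeq Y X.
Proof.
move=> mX; have mX' : @measurable_fun _ _ Omega (measurableTypeR R) setT X := mX.
pose F : {mfun Omega >-> measurableTypeR R} :=
  HB.pack X (isMeasurableFun.Build _ _ _ (measurableTypeR R) X mX').
have : \pi_({mfun_ P, Omega >-> measurableTypeR R})%qT (repr (\pi_({mfun_ P,
  Omega >-> measurableTypeR R})%qT F)) =
  \pi_({mfun_ P, Omega >-> measurableTypeR R})%qT F by rewrite reprK.
move=> /eqquotP /asboolP[N [mN N0 NP]].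
exists (\pi_({mfun_ P, Omega >-> measurableTypeR R})%qT F).
apply/eqP; rewrite eq_le pr_ge0 andbT -lee_fin -P_pr.
  apply: (@le_trans _ _ (P N)); last by rewrite N0.
  apply: le_measure; rewrite ?inE//.
    by apply: event_neq => //; exact: measurable_L0.
  move=> w /= neq; apply: NP => /= /(_ Logic.I) /eqP e; move: neq;
    rewrite /L0_fun /aqEqMfun_to_fun e.
  by [].
by apply: event_neq => //; exact: measurable_L0.
Qed.

Definition tends_in_prob (X : nat -> Omega -> R) Y : Prop :=
  forall e, 0 < e -> exists N, forall n, (N <= n)%N -> small_in_prob e (fun w => X n w - Y w).

Lemma cvg_in_probP (X : nat -> Omega -> R) Y :
  (forall n, measurable_fun setT (X n)) -> measurable_fun setT Y ->
  cvg_in_prob P X Y <-> tends_in_prob X Y.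
Proof.
move=> mX mY.
have mE n e : event (fun w => e <= `|X n w - Y w|).
  by apply: event_norm_le; exact: measurable_funB.
split=> [H e e0|H eps eps0].
  have /fine_cvgP[_] := H e e0 => /cvgrPdist_le /(_ e e0)[N _ HN].
  exists N => n Nn; have := HN n Nn; rewrite /= sub0r normrN.
  by move=> /(le_trans _); apply; exact: ler_norm.
apply/fine_cvgP; split.
  by apply: nearW => n; rewrite (P_pr P (mE n eps)).
apply/cvgrPdist_le => e e0; have me0 : 0 < Num.min eps e by rewrite lt_min eps0.
have [N HN] := H _ me0.
exists N => // n /= /HN h; rewrite sub0r normrN ger0_norm ?fine_ge0//.
apply: (@le_trans _ _ (pr (fun w => Num.min eps e <= `|X n w - Y w|))).
  by apply: pr_le => // w; apply: le_trans; rewrite ge_min lexx.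
by apply: le_trans h _; rewrite ge_min lexx orbT.
Qed.

Lemma small_aeq e X Y : measurable_fun setT X -> measurable_fun setT Y ->
  aeq X Y -> small_in_prob e X -> small_in_prob e Y.
Proof. by move=> mX mY XY; rewrite /small_in_prob (pr_aeq_le _ mX mY XY). Qed.

Lemma smallD a b X Y : measurable_fun setT X -> measurable_fun setT Y ->
  small_in_prob a X -> small_in_prob b Y -> small_in_prob (a + b) (fun w => X w + Y w).
Proof.
move=> mX mY sX sY; have mXe := event_norm_le a mX; have mYe := event_norm_le b mY.
apply: le_trans (lerD sX sY); apply: le_trans (pr_or P mXe mYe).
apply: pr_le; [by apply: event_norm_le; exact: measurable_funD|exact: event_or|].
move=> w h; have tri := ler_normD (X w) (Y w).
by case: (leP a) => //= h1; case: (leP b) => // h2; exfalso; lra.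
Qed.

Lemma smallN e X : small_in_prob e X -> small_in_prob e (fun w => - X w).
Proof.
rewrite /small_in_prob (@eq_pr _ _ _ P (fun w => e <= `|- X w|) (fun w => e <= `|X w|))//.
by move=> w; rewrite normrN.
Qed.

Lemma smallB a b X Y : measurable_fun setT X -> measurable_fun setT Y ->
  small_in_prob a X -> small_in_prob b Y -> small_in_prob (a + b) (fun w => X w - Y w).
Proof.
by move=> mX mY sX /smallN; apply: smallD => //; exact: measurable_funN.
Qed.

Lemma small0 e : 0 < e -> small_in_prob e (fun=> 0).
Proof.
move=> e0; rewrite /small_in_prob (@eq_pr _ _ _ _ _ (fun=> false)); last first.
  by move=> w; rewrite normr0 leNgt e0.
by rewrite /Pr (_ : [set w | _] = set0) ?measure0 ?ltW//; apply/seteqP; split.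
Qed.

Lemma aeq0P X : measurable_fun setT X -> (forall e, 0 < e -> small_in_prob e X) -> aeq X (fun=> 0).
Proof.
move=> mX H; apply/eqP; rewrite eq_le pr_ge0 andbT; apply/ler_addgt0Pl => e e0.
rewrite addr0.
pose A n := [set w | n.+1%:R^-1 <= `|X w|].
have mA n : measurable (A n) by exact: event_norm_le.
have cA : P (A n) @[n --> \oo] --> P (\bigcup_n A n).
  apply: nondecreasing_cvg_mu => //; first exact: bigcupT_measurable.
  move=> m n mn; apply/subsetPset => w; apply: le_trans.
  by rewrite lef_pV2 ?posrE// ler_nat.
have -> : pr (fun w => X w != 0) = fine (P (\bigcup_n A n)).
  rewrite /Pr; congr (fine (P _)); apply/seteqP; split=> w /=.
    move=> X0; have Xp : 0 < `|X w| by rewrite normr_gt0.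
    exists (Num.Def.archi_bound `|X w|^-1) => //=; rewrite /A /=.
    rewrite -[leRHS]invrK lef_pV2 ?posrE ?invr_gt0//.
    have h := archi_boundP (ltW (_ : 0 < `|X w|^-1)).
    apply: le_trans (ltW (h _)) _; first by rewrite invr_gt0.
    by rewrite ler_nat.
  by move=> [n _]; rewrite /A /= -normr_gt0; apply: lt_le_trans; rewrite invr_gt0.
have cA' : fine (P (A n)) @[n --> \oo] --> fine (P (\bigcup_n A n)).
  apply: fine_cvg; rewrite fineK//; apply: fin_num_measure.
  exact: bigcupT_measurable.
rewrite -(cvg_lim _ cA')//; apply: limr_le; first by apply/cvg_ex; eexists; exact: cA'.
near=> n; pose m := Num.min e n.+1%:R^-1.
have m0 : 0 < m by rewrite lt_min e0 invr_gt0 ltr0n.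
apply: (@le_trans _ _ (pr (fun w => m <= `|X w|))).
  apply: pr_le; try exact: event_norm_le.
  by move=> w; apply: le_trans; rewrite ge_min lexx orbT.
by apply: le_trans (H m m0) _; rewrite ge_min lexx.
Unshelve. all: by end_near. Qed.

Lemma smallZ (c C e : R) X : 1 <= C -> `|c| <= C -> 0 <= e -> measurable_fun setT X ->
  small_in_prob e X -> small_in_prob (C * e) (fun w => c * X w).
Proof.
move=> C1 cC e0 mX sX; have C0 : 0 < C by exact: lt_le_trans C1.
apply: (@le_trans _ _ (pr (fun w => e <= `|X w|))).
  apply: pr_le; try apply: event_norm_le => //; first exact: measurable_funM.
  move=> w; rewrite normrM => h; rewrite -(ler_pM2l C0); apply: le_trans h _.
  by rewrite ler_wpM2r.
by apply: le_trans sX _; rewrite ler_peMl.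
Qed.

Lemma small_tends (a b : R) (X : nat -> Omega ->
  R) Y : (forall n, measurable_fun setT (X n)) -> measurable_fun setT Y ->
  tends_in_prob X Y -> (exists N, forall n, (N <= n)%N -> small_in_prob a (X n)) -> a < b ->
    small_in_prob b Y.
Proof.
move=> mX mY XY [N aX] ab; have ba : 0 < b - a by rewrite subr_gt0.
have [M HM] := XY _ ba.
have sX := aX (maxn N M) (leq_maxl _ _); have sY := HM (maxn N M) (leq_maxr _ _).
have mD := measurable_funB (mX (maxn N M)) mY.
have := smallB (mX _) mD sX sY; rewrite addrC subrK.
rewrite /small_in_prob (@eq_pr _ _ _ P _ (fun w => b <= `|Y w|))// => w.
by rewrite opprB addrC subrK.
Qed.

Lemma tends_aeq (X X' : nat -> Omega -> R) Y Y' :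
  (forall n, measurable_fun setT (X n)) -> (forall n, measurable_fun setT (X' n)) ->
  measurable_fun setT Y -> measurable_fun setT Y' ->
  (forall n, aeq (X n) (X' n)) -> aeq Y Y' -> tends_in_prob X Y -> tends_in_prob X' Y'.
Proof.
move=> mX mX' mY mY' XX' YY' XY e e0; have [N HN] := XY e e0; exists N => n Nn.
apply: small_aeq (HN n Nn); try exact: measurable_funB.
exact: aeqB.
Qed.

Lemma tendsD (X X' : nat -> Omega -> R) Y Y' :
  (forall n, measurable_fun setT (X n)) -> (forall n, measurable_fun setT (X' n)) ->
  measurable_fun setT Y -> measurable_fun setT Y' ->
  tends_in_prob X Y -> tends_in_prob X' Y' ->
  tends_in_prob (fun n w => X n w + X' n w) (fun w => Y w + Y' w).
Proof.
move=> mX mX' mY mY' XY XY' e e0; have e2 : 0 < e / 2 by rewrite divr_gt0.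
have [N HN] := XY _ e2; have [M HM] := XY' _ e2.
exists (maxn N M) => n; rewrite geq_max => /andP[/HN h /HM h'].
have := smallD (measurable_funB (mX n) mY) (measurable_funB (mX' n) mY') h h'.
rewrite -splitr /small_in_prob (@eq_pr _ _ _ P _ (fun w =>
  e <= `|X n w + X' n w - (Y w + Y' w)|))// => w.
by rewrite opprD addrACA.
Qed.

Lemma tendsZ (c : R) (X : nat -> Omega -> R) Y :
  (forall n, measurable_fun setT (X n)) -> measurable_fun setT Y ->
  tends_in_prob X Y -> tends_in_prob (fun n w => c * X n w) (fun w => c * Y w).
Proof.
move=> mX mY XY e e0; pose C := 1 + `|c|.
have C0 : 0 < C by rewrite ltr_pwDl.
have [N HN] := XY (e / C) (divr_gt0 e0 C0); exists N => n /HN h.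
have := @smallZ c C (e / C) _ _ _ _ (measurable_funB (mX n) mY) h.
have -> : C * (e / C) = e by rewrite mulrC divfK ?gt_eqF.
rewrite lerDl lerDr ler01 normr_ge0 divr_ge0 ?ltW// => /(_ isT isT isT).
rewrite /small_in_prob (@eq_pr _ _ _ P _ (fun w => e <= `|c * X n w - c * Y w|))// => w.
by rewrite mulrBr.
Qed.

Lemma tends_unique (X : nat -> Omega -> R) Y Z :
  (forall n, measurable_fun setT (X n)) -> measurable_fun setT Y -> measurable_fun setT Z ->
  tends_in_prob X Y -> tends_in_prob X Z -> aeq Y Z.
Proof.
move=> mX mY mZ XY XZ.
have mD : measurable_fun setT (fun w => Y w - Z w) by exact: measurable_funB.
have : aeq (fun w => Y w - Z w) (fun=> 0).
  apply: aeq0P => // e e0; have e2 : 0 < e / 2 by rewrite divr_gt0.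
  have [N HN] := XY _ e2; have [M HM] := XZ _ e2.
  have h := HN _ (leq_maxl N M); have h' := HM _ (leq_maxr N M).
  have := smallB (measurable_funB (mX (maxn N M)) mZ) (measurable_funB (mX (maxn N M)) mY) h' h.
  rewrite -splitr /small_in_prob (@eq_pr _ _ _ P _ (fun w => e <= `|Y w - Z w|))// => w.
  by rewrite opprB addrC addrA subrK.
by rewrite /as_eq (@eq_pr _ _ _ P _ (fun w => Y w != Z w))// => w; rewrite subr_eq0.
Qed.

Lemma tends_cauchy (X : nat -> Omega -> R) Y :
  (forall n, measurable_fun setT (X n)) -> measurable_fun setT Y -> tends_in_prob X Y ->
  forall e, 0 < e -> exists N, forall m n, (N <= m)%N -> (N <= n)%N ->
    small_in_prob e (fun w => X m w - X n w).
Proof.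
move=> mX mY XY e e0; have e2 : 0 < e / 2 by rewrite divr_gt0.
have [N HN] := XY _ e2; exists N => m n /HN hm /HN hn.
have := smallB (measurable_funB (mX m) mY) (measurable_funB (mX n) mY) hm hn.
rewrite -splitr /small_in_prob (@eq_pr _ _ _ P _ (fun w => e <= `|X m w - X n w|))// => w.
by rewrite opprB addrA subrK.
Qed.

Section Completeness.
Context (X : nat -> Omega -> R) (mX : forall n, measurable_fun setT (X n)).
Hypothesis cauchy_X : forall e, 0 < e -> exists N, forall m n, (N <= m)%N -> (N <= n)%N ->
    small_in_prob e (fun w => X m w - X n w).

(** Borel-Cantelli along a fast subsequence: off the null set [E] it converges pointwise, and the
    Cauchy property carries the whole sequence to the same limit. *)
Lemma prob_complete : exists Y : L0 P, tends_in_prob X Y.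
Proof.
pose d k : R := 1 / (2 ^ (k + 1))%:R.
have d0 k : 0 < d k by rewrite divr_gt0// ltr0n expn_gt0.
have dS k : d k.+1 = d k / 2.
  by rewrite /d addSn expnS natrM invfM mulrCA mulrC.
have d_half k : d k <= 2^-1.
  elim: k => [|k IH]; first by rewrite /d add0n expn1 mul1r.
  by rewrite dS; have := d0 k; lra.
have /choice[N NP] : forall k, exists N, forall m n, (N <= m)%N -> (N <= n)%N ->
    small_in_prob (d k) (fun w => X m w - X n w) by move=> k; exact: cauchy_X.
(* Summing makes [nk] nondecreasing and at least [N k]; the added [k] makes it unbounded. *)
pose nk k := (\sum_(i < k.+1) N i + k)%N.
have nk_mono k : (nk k <= nk k.+1)%N by rewrite /nk leq_add// [leqRHS]big_ord_recr leq_addr.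
have nkN k : (N k <= nk k)%N by rewrite /nk big_ord_recr /= -addnA addnCA leq_addr.
pose A k := [set w | d k <= `|X (nk k.+1) w - X (nk k) w|].
have mdiff m n : measurable_fun setT (fun w => X m w - X n w) by exact: measurable_funB.
have mA k : measurable (A k) by exact: event_norm_le.
have PA k : (P (A k) <= (d k)%:E)%E.
  rewrite /A (P_pr P (event_norm_le (d k) (mdiff _ _))) lee_fin; apply: NP; last exact: nkN.
  exact: leq_trans (nk_mono k).
pose T k := \bigcup_(j >= k) A j.
have mT k : measurable (T k) by exact: bigcup_measurable.
pose E := lim_sup_set A.
have mE : measurable E by apply: bigcapT_measurable.
have PE : P E = 0%E.
  apply: lim_sup_set_cvg0 => //; apply: (@le_lt_trans _ _ (\sum_(n <oo) (d n)%:E)%E).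
    by apply: lee_nneseries => // n _; exact: PA.
  by rewrite (cvg_lim _ (@cvg_geometric_eseries_half R 1 0))// ltry.
(* The bound telescopes, because [d i = 2 * d i - 2 * d i.+1]. *)
have near_k k w i : ~ T k w -> (k <= i)%N -> `|X (nk i) w - X (nk k) w| <= 2 * d k - 2 * d i.
  move=> nT; elim: i => [|i IH]; first by rewrite leqn0 => /eqP ->; rewrite !subrr normr0.
  rewrite leq_eqVlt => /orP[/eqP <-|]; first by rewrite !subrr normr0.
  rewrite ltnS => ki; have := IH ki.
  have : `|X (nk i.+1) w - X (nk i) w| < d i.
    by rewrite ltNge; apply/negP => h; apply: nT; exists i.
  have := ler_distD (X (nk i) w) (X (nk i.+1) w) (X (nk k) w).
  by rewrite (dS i); have := d0 i; lra.
have d_cvg (e : R) : 0 < e -> exists k, 2 * d k < e.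
  move=> e0; exists (Num.Def.archi_bound e^-1).
  have h : e^-1 < (2 ^ (Num.Def.archi_bound e^-1))%:R.
    apply: lt_trans (archi_boundP _) _; first by rewrite invr_ge0 ltW.
    by rewrite ltr_nat ltn_expl.
  rewrite /d addn1 expnS natrM invfM mul1r mulrA divff ?mul1r//.
  by rewrite -[ltRHS]invrK ltf_pV2 ?posrE ?invr_gt0// ltr0n expn_gt0.
(* Being 0 on [E], the sequence converges everywhere, so its limit is measurable. *)
pose Z k w := X (nk k) w * \1_(~` E) w.
have mZ k : measurable_fun setT (Z k).
  by apply: measurable_funM => //; apply: measurable_indic; exact: measurableC.
have cZ w : cvgn (fun k => Z k w).
  rewrite /Z indicE; case: (boolP (w \in ~` E)) => [/set_mem wE|_]; last first.
    by under eq_fun do rewrite mulr0; exact: is_cvg_cst.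
  under eq_fun do rewrite mulr1.
  have [k nT] : exists k, ~ T k w.
    apply: contrapT => /forallNP H; apply: wE => k _.
    by apply: contrapT; exact: H.
  apply/cauchy_cvgP/cauchy_exP => e e0.
  have [l de] := d_cvg e e0; pose m := maxn k l.
  exists (X (nk m) w); exists m => // i /= mi; rewrite /ball /= distrC.
  have nTm : ~ T m w by move=> [j /= mj Aj]; apply: nT; exists j => //=;
    rewrite (leq_trans _ mj)// leq_maxl.
  apply: le_lt_trans (near_k m w i nTm mi) _.
  have dl : d m <= d l.
    have := leq_maxr k l; rewrite -/m => /subnK <-.
    elim: (m - l)%N => [|a IHa]; first by rewrite add0n.
    by rewrite addSn dS; have := d0 (a + l)%N; lra.
  by have := d0 i; lra.
pose Y0 w := limn (fun k => Z k w).
have mY0 : measurable_fun setT Y0 by apply: (measurable_fun_cvg mZ) => w _; exact: cZ.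
have [Y YY0] := L0_of mY0; exists Y.
have mY := measurable_L0 Y.
suff : tends_in_prob X Y0.
  by apply: tends_aeq => //; [move=> n; exact: aeq_refl|exact: aeq_sym].
have cT : P (T k) @[k --> \oo] --> P E.
  by apply: lim_sup_set_cvg => //; rewrite (le_lt_trans (probability_le1 _ _))// ?ltry//;
    exact: bigcup_measurable.
rewrite PE in cT.
move=> e e0; have e2 : 0 < e / 2 by rewrite divr_gt0.
have [M MP] := cauchy_X e2.
have /fine_cvgP[_ /cvgrPdist_le /(_ _ e2)[k1 _ Hk1]] := cT.
have [k2 dk2] := d_cvg _ e2.
pose k := maxn (maxn k1 k2) M.
have MTk : (M <= nk k)%N.
  by apply: leq_trans (leq_maxr (maxn k1 k2) M) _; rewrite -/k leq_addl.
exists M => n Mn.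
have sub : small_in_prob (e / 2) (fun w => X n w - X (nk k) w) by exact: MP.
have k1k : (k1 <= k)%N by rewrite /k -maxnA leq_maxl.
have d_k2 : d k <= d k2.
  have : (k2 <= k)%N by rewrite /k leq_max leq_maxr.
  move=> /subnK <-; elim: (k - k2)%N => [|a IHa]; first by rewrite add0n.
  by rewrite addSn dS; have := d0 (a + k2)%N; lra.
have sub' : small_in_prob (e / 2) (fun w => X (nk k) w - Y0 w).
  rewrite /small_in_prob; apply: (@le_trans _ _ (fine (P (T k)))); last first.
    have := Hk1 k k1k; rewrite sub0r normrN; apply: le_trans; exact: ler_norm.
  rewrite -lee_fin -P_pr; last by apply: event_norm_le; exact: measurable_funB.
  rewrite fineK ?fin_num_measure//; apply: le_measure; rewrite ?inE//.
    by apply: event_norm_le; exact: measurable_funB.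
  move=> w /= h; apply: contrapT => nT; move: h; apply/negP; rewrite -ltNge.
  have wE : w \in ~` E by apply/mem_set => /(_ k Logic.I).
  have cY : X (nk i) w @[i --> \oo] --> Y0 w.
    by have := cZ w; rewrite /Y0 /Z indicE wE; under eq_fun do rewrite mulr1.
  have : `|Y0 w - X (nk k) w| <= 2 * d k.
    have cY' : `|X (nk i) w - X (nk k) w| @[i --> \oo] --> `|Y0 w - X (nk k) w|.
      by apply: cvg_norm; apply: cvgB => //; exact: cvg_cst.
    rewrite -(cvg_lim _ cY')//; apply: limr_le; first by apply/cvg_ex; eexists; exact: cY'.
    exists k => // i /= ki; apply: le_trans (near_k k w i nT ki) _.
    by have := d0 i; lra.
  by rewrite distrC; lra.
have := smallD (mdiff _ _) (measurable_funB (mX (nk k)) mY0) sub sub'.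
rewrite -splitr /small_in_prob (@eq_pr _ _ _ P _ (fun w => e <= `|X n w - Y0 w|))// => w.
by rewrite addrA subrK.
Qed.

End Completeness.

End ConvergenceInProbability.

(** * Uniform countable additivity *)

Section Nikodym.
Context (R : realType) (dO dS : measure_display) (Omega : measurableType dO)
  (P : probability Omega R) (S : measurableType dS).
Local Notation pr := (Pr P).
Local Notation aeq := (as_eq P).
Local Notation small := (small_in_prob P).

(** Lets a pointwise deduction from at most three almost sure identities be carried out as if they
    held everywhere; the gliding hump combines three. *)
Lemma aeq_imp3 (X Y : 'I_3 -> Omega -> R) (Z W : Omega -> R) :
  (forall i, measurable_fun setT (X i)) -> (forall i, measurable_fun setT (Y i)) ->
  measurable_fun setT Z -> measurable_fun setT W ->
  (forall i, aeq (X i) (Y i)) ->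
  (forall w, (forall i, X i w = Y i w) -> Z w = W w) -> aeq Z W.
Proof.
move=> mX mY mZ mW XY H.
pose n w := [|| X ord0 w != Y ord0 w, X 1 w != Y 1 w | X 2 w != Y 2 w].
have mi i : event (fun w => X i w != Y i w) by exact: event_neq.
have mn12 := event_or (mi 1) (mi 2).
have mn : event n := event_or (mi ord0) mn12.
have n0 : pr n = 0.
  apply/eqP; rewrite eq_le pr_ge0 andbT.
  apply: le_trans (pr_or P (mi ord0) mn12) _; rewrite XY add0r.
  by apply: le_trans (pr_or P (mi 1) (mi 2)) _; rewrite !XY addr0.
apply/eqP; rewrite eq_le pr_ge0 andbT -[leRHS]n0.
apply: pr_le => //; first exact: event_neq.
move=> w; apply: contraNT; rewrite !negb_or !negbK => /and3P[/eqP h0 /eqP h1 /eqP h2].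
apply/eqP/H => i; case: i => [[|[|[|//]]]] i3.
- by rewrite (_ : Ordinal i3 = ord0)//; apply: val_inj.
- by rewrite (_ : Ordinal i3 = 1)//; apply: val_inj.
- by rewrite (_ : Ordinal i3 = 2)//; apply: val_inj.
Qed.

Definition vanishing (D : nat -> set S) : Prop :=
  [/\ forall n, measurable (D n), forall m n, (m <= n)%N -> D n `<=` D m &
      \bigcap_n D n = set0].

(** Countable additivity enters as continuity at the empty set, the form in which it is made uniform
    below. *)
Definition L0_measure (nu : set S -> Omega -> R) : Prop :=
  ae_additive P nu /\
  forall D, vanishing D -> forall e, 0 < e ->
    exists N, forall n, (N <= n)%N -> small e (nu (D n)).

Lemma vanishingI D A : measurable A -> vanishing D -> vanishing (fun n => A `&` D n).
Proof.
move=> mA [mD dD D0]; split.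
- by move=> n; exact: measurableI.
- by move=> m n mn s [As /(dD m n mn)].
- apply/seteqP; split => // s H; have : (\bigcap_n D n) s by move=> n _; have [] := H n Logic.I.
  by rewrite D0.
Qed.

Section OneMeasure.
Context (nu : set S -> Omega -> R) (nuM : L0_measure nu).
Let m_nu := nuM.1.1.

Lemma L0_measureD A B : measurable A -> measurable B -> A `&` B = set0 ->
  aeq (nu (A `|` B)) (fun w => nu A w + nu B w).
Proof. exact: nuM.1.2. Qed.

Lemma L0_measureID A B : measurable A -> measurable B ->
  aeq (nu A) (fun w => nu (A `\` B) w + nu (A `&` B) w).
Proof.
move=> mA mB; rewrite -{1}[A](setDUK (@subIsetl _ A B)) setUC setDIr setDv set0U.
apply: L0_measureD; [exact: measurableD|exact: measurableI|].
by apply/seteqP; split=> // s [[_ nB] [_ /nB]].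
Qed.

Lemma small_part e A B : measurable A -> measurable B -> 0 < e ->
  small (e / 2) (nu (A `&` B)) -> small (e / 2) (nu (A `\` B)) -> small e (nu A).
Proof.
move=> mA mB e0 sI sD; have mI := m_nu (measurableI _ _ mA mB).
have mD := m_nu (measurableD mA mB).
apply: (@small_aeq _ _ _ _ _ (fun w => nu (A `\` B) w + nu (A `&` B) w)).
- exact: measurable_funD.
- exact: m_nu.
- exact/aeq_sym/L0_measureID.
- by rewrite [e]splitr; exact: smallD.
Qed.

(** [E n] is the difference of two consecutive tails of the union, and the tails vanish. *)
Lemma L0_measure_exhaustive (E : nat -> set S) : (forall n, measurable (E n)) ->
  trivIset setT E -> forall e, 0 < e -> exists N, forall n, (N <= n)%N -> small e (nu (E n)).
Proof.
move=> mE tE e e0; pose D n := \bigcup_(k >= n) E k.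
have mD n : measurable (D n) by exact: bigcup_measurable.
have vD : vanishing D.
  split => // [m n mn s [k /= nk Eks]|]; first by exists k => //=; exact: leq_trans nk.
  apply/seteqP; split => // s H; have [k _ Ek] := H 0%N Logic.I.
  have [k' /= kk' Ek'] := H k.+1 Logic.I.
  have : k = k' by apply: tE => //; exists s.
  by move=> kE; move: kk'; rewrite -kE ltnn.
have e2 : 0 < e / 2 by rewrite divr_gt0.
have [N HN] := nuM.2 _ vD _ e2; exists N => n Nn.
have DE : D n = E n `|` D n.+1.
  apply/seteqP; split=> s.
    move=> [k /=]; rewrite leq_eqVlt => /orP[/eqP -> Ek|nk Ek]; [by left|right].
    by exists k.
  by move=> [Es|[k /= nk Ek]]; [exists n => //=|exists k => //=; exact: ltnW].
have disj : E n `&` D n.+1 = set0.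
  apply/seteqP; split=> // s [Es [k /= nk Ek]].
  have : n = k by apply: tE => //; exists s.
  by move=> nE; move: nk; rewrite -nE ltnn.
have h := L0_measureD (mE n) (mD n.+1) disj; rewrite -DE in h.
have mm A : measurable A -> measurable_fun setT (nu A) by exact: m_nu.
apply: (@small_aeq _ _ _ _ _ (fun w => nu (D n) w - nu (D n.+1) w)).
- by apply: measurable_funB; exact: mm.
- exact: mm.
- apply: (@aeq_imp3 (fun=> nu (D n)) (fun=> fun w => nu (E n) w + nu (D n.+1) w)).
  + by move=> _; exact: mm.
  + by move=> _; apply: measurable_funD; exact: mm.
  + by apply: measurable_funB; exact: mm.
  + exact: mm.
  + by [].
  + by move=> w /(_ ord0) ->; rewrite addrK.
- rewrite [e]splitr; apply: smallB; try exact: mm; apply: HN => //.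
  exact: leqW.
Qed.

(** Otherwise each [D n] contains a set of non-small measure. Removing from it a far [D l], which
    takes away little measure, leaves disjoint sets of non-small measure, against
    [L0_measure_exhaustive]. *)
Lemma L0_measure_uniform D : vanishing D -> forall e, 0 < e -> exists N, forall n, (N <= n)%N ->
  forall A, measurable A -> A `<=` D n -> small e (nu A).
Proof.
move=> vD e e0; have [mD dD D0] := vD.
apply: contrapT => /forallNP none.
have /choice[A AP] : forall n, exists A, [/\ measurable A, A `<=` D n & ~ small e (nu A)].
  move=> n; apply: contrapT => H; apply: (none n) => m nm A mA AD.
  apply: contrapT => nsA; apply: H; exists A; split => //.
  exact: subset_trans (dD _ _ nm).
have e2 : 0 < e / 2 by rewrite divr_gt0.
have /choice[l lP] : forall n, exists l, (n < l)%N /\ small (e / 2) (nu (A n `&` D l)).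
  move=> n; have [mA AD _] := AP n.
  have [N HN] := nuM.2 _ (vanishingI mA vD) _ e2.
  by exists (maxn N n.+1); split; [exact: leq_maxr|exact/HN/leq_maxl].
pose n_ i := iter i l 0%N.
pose F i := A (n_ i) `\` D (n_ i.+1).
have mF i : measurable (F i) by apply: measurableD => //; have [] := AP (n_ i).
have n_mono i j : (i <= j)%N -> (n_ i <= n_ j)%N.
  elim: j => [|j IH]; first by rewrite leqn0 => /eqP ->.
  rewrite leq_eqVlt => /orP[/eqP -> //|/IH /leq_trans]; apply.
  by have [/ltnW] := lP (n_ j).
have dF i j : (i < j)%N -> F i `&` F j = set0.
  move=> ij; apply/seteqP; split=> // s [[_ nD] [Aj _]]; apply: nD.
  by have [_ AD _] := AP (n_ j); exact/(dD _ _ (n_mono _ _ ij))/AD.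
have tF : trivIset setT F.
  move=> i j _ _ [s [Fi Fj]]; have [ij|ji|//] := ltngtP i j.
    by have : (F i `&` F j) s by []; rewrite dF.
  by have : (F j `&` F i) s by []; rewrite dF.
have [N /(_ N (leqnn N)) sF] := L0_measure_exhaustive mF tF e2.
have [mA _ []] := AP (n_ N).
by apply: small_part sF => //; have [] := lP (n_ N).
Qed.

End OneMeasure.

(* Nikodym's theorem, by a gliding hump: if uniformity failed, one could find
   disjoint sets [A i] and indices [l i < m i] such that on the union [E] of
   the [A i] the difference of the measures [m i] and [l i] is essentially the
   value of measure [m i] on [A i], hence does not tend to 0. *)
Lemma nikodym_uniform (nu : nat -> set S -> Omega -> R) D :
  (forall m, L0_measure (nu m)) ->
  (forall A, measurable A -> forall e, 0 < e -> exists N, forall m l, (N <= m)%N -> (N <= l)%N ->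
     small e (fun w => nu m A w - nu l A w)) ->
  vanishing D -> forall e, 0 < e -> exists N, forall n, (N <= n)%N ->
    forall m A, measurable A -> A `<=` D n -> small e (nu m A).
Proof.
move=> nuM cauchy vD e e0; have [mD dD D0] := vD.
have mm m A : measurable A -> measurable_fun setT (nu m A) by exact: (nuM m).1.1.
apply: contrapT => /forallNP none.
have bad n : exists m A, [/\ measurable A, A `<=` D n & ~ small e (nu m A)].
  apply: contrapT => H; apply: (none n) => n' nn' m A mA AD.
  apply: contrapT => nsA; apply: H; exists m, A; split => //.
  exact: subset_trans (dD _ _ nn').
(* The final decomposition has six terms of size [h]. *)
pose h := e / 8; have h0 : 0 < h by rewrite divr_gt0.
have unif m : exists N, forall A, measurable A -> A `<=` D N -> small h (nu m A).
  by have [N HN] := L0_measure_uniform (nuM m) vD h0; exists N; exact: HN.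
have unifs l : exists N, forall m, (m <= l)%N -> forall A, measurable A -> A `<=` D N ->
    small h (nu m A).
  have /choice[N NP] := unif; exists (\sum_(m < l.+1) N m)%N => m ml A mA AD.
  apply: NP => //; apply: subset_trans AD _; apply: dD.
  by rewrite (bigD1 (Ordinal (ml : (m < l.+1)%N)))//= leq_addr.
(* A state consists of the step number [i], an index [n] into [D] and the union [F] of the humps so
   far. A step returns indices [l <= m] whose measures nearly agree on [F], a set [A] in [D n'] that
   is not small for [m] although [l] is small inside [D n'], and [n''] such that [m] is small inside
   [D n'']. *)
pose ok (st : nat * nat * set S) (r : nat * nat * (nat * nat * set S)) :=
  let: (i, n, F) := st in let: (l, m, (n', n'', A)) := r in
  [/\ (i <= l)%N, (l <= m)%N, (n <= n')%N & (n' <= n'')%N] /\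
  [/\ measurable A, A `<=` D n', ~ small e (nu m A) &
    [/\ small h (fun w => nu m F w - nu l F w),
      forall B, measurable B -> B `<=` D n' -> small h (nu l B) &
      forall B, measurable B -> B `<=` D n'' -> small h (nu m B)]].
have /choice[next nextP] : forall st, exists r, measurable st.2 -> ok st r.
  move=> [[i n] F] /=; have [mF|] := pselect (measurable F); last first.
    by exists (0%N, 0%N, (0%N, 0%N, set0)).
  have [N0 HN0] := cauchy F mF h h0.
  pose l := maxn i N0.
  have [N1 HN1] := unifs l; pose n' := maxn n N1.
  have [m [A [mA AD nsA]]] := bad n'.
  have small_l m' B : (m' <= l)%N -> measurable B -> B `<=` D n' -> small h (nu m' B).
    move=> m'l mB BD; apply: (HN1 m') => //; apply: subset_trans BD _; apply: dD.
    exact: leq_maxr.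
  (* All measures up to [l] are small inside [D n'], so one that is not small on [A] comes later. *)
  have lm : (l <= m)%N.
    rewrite leqNgt; apply/negP => /ltnW ml; apply: nsA.
    apply: (@small_mono _ _ _ _ _ h) (small_l m A ml mA AD); first exact: mm.
    by rewrite /h; lra.
  have [N2 HN2] := unif m.
  exists (l, m, (n', maxn n' N2, A)) => _ /=; split; first by split; rewrite ?leq_maxl.
  split => //; split.
  - by apply: HN0 => //; [apply: leq_trans lm|]; exact: leq_maxr.
  - by move=> B mB BD; exact: small_l.
  - move=> B mB BD; apply: HN2 => //; apply: subset_trans BD _; apply: dD.
    exact: leq_maxr.
pose cut (r : nat * nat * (nat * nat * set S)) := r.2.2 `\` D r.2.1.2.
pose step (st : nat * nat * set S) := let r := next st in
  (st.1.1.+1, r.2.1.2, st.2 `|` cut r).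
pose st := fix st i := if i is j.+1 then step (st j) else (0%N, 0%N, set0).
have m_st i : measurable (st i).2.
  elim: i => [|i IH] //=; apply: measurableU => //; apply: measurableD => //.
  have := nextP (st i) IH; rewrite /ok; case: (st i) (next (st i)) =>
    [[a b] F] [[l m] [[n' n''] A]] /=.
  by case=> _ [].
have st_i i : (st i).1.1 = i by elim: i => [|i IH] //=; rewrite IH.
pose l_ i := (next (st i)).1.1; pose m_ i := (next (st i)).1.2.
pose n1 i := (next (st i)).2.1.1; pose n2 i := (next (st i)).2.1.2.
pose A_ i := (next (st i)).2.2; pose F_ i := (st i).2.
have okP i : [/\ (i <= l_ i)%N, (l_ i <= m_ i)%N, ((st i).1.2 <= n1 i)%N & (n1 i <= n2 i)%N] /\
  [/\ measurable (A_ i), A_ i `<=` D (n1 i), ~ small e (nu (m_ i) (A_ i)) &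
    [/\ small h (fun w => nu (m_ i) (F_ i) w - nu (l_ i) (F_ i) w),
      forall B, measurable B -> B `<=` D (n1 i) -> small h (nu (l_ i) B) &
      forall B, measurable B -> B `<=` D (n2 i) -> small h (nu (m_ i) B)]].
  move: (nextP (st i) (m_st i)) (st_i i); rewrite /l_ /m_ /n1 /n2 /A_ /F_.
  move: (next (st i)) => [[l m] [[n' n''] A]].
  by move: (st i) => [[a b] F] /= H <-.
have mA_ i : measurable (A_ i) by have [_ []] := okP i.
have mF_ i : measurable (F_ i) := m_st i.
pose C_ i := A_ i `\` D (n2 i).
have mC i : measurable (C_ i) by exact: measurableD.
have n2n1 i : (n2 i <= n1 i.+1)%N by have [[]] := okP i.+1.
have n2_mono i j : (i <= j)%N -> (n2 i <= n2 j)%N.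
  elim: j => [|j IH]; first by rewrite leqn0 => /eqP ->.
  rewrite leq_eqVlt => /orP[/eqP -> //|/IH /leq_trans]; apply.
  by apply: leq_trans (n2n1 j) _; have [[]] := okP j.+1.
have C_later i j : (i < j)%N -> C_ j `<=` D (n2 i).
  case: j => // j; rewrite ltnS => ij s [As _].
  have [_ [_ AD _ _]] := okP j.+1.
  exact: (dD _ _ (leq_trans (n2_mono _ _ ij) (n2n1 j))) (AD _ As).
have F_E i : F_ i = \bigcup_(j < i) C_ j.
  elim: i => [|i IH]; first by rewrite bigcup_mkord big_ord0.
  by rewrite bigcup_mkord big_ord_recr /= -bigcup_mkord -IH.
pose E := \bigcup_j C_ j; pose T_ i := \bigcup_(j >= i.+1) C_ j.
have mE : measurable E by exact: bigcupT_measurable.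
have mT i : measurable (T_ i) by exact: bigcup_measurable.
have T_D i : T_ i `<=` D (n2 i) by apply: bigcup_sub => j /= ij; exact: C_later.
have EE i : E = (F_ i `|` C_ i) `|` T_ i.
  rewrite F_E; apply/seteqP; split=> s.
    move=> [j _ Cj]; have [ji|ij|ji] := ltngtP j i; last by left; right; rewrite -ji.
      by left; left; exists j.
    by right; exists j.
  by move=> [[[j _ Cj]|Ci]|[j _ Cj]]; [exists j|exists i|exists j].
have FC i : F_ i `&` C_ i = set0.
  rewrite F_E; apply/seteqP; split=> // s [[j /= ji [_ nD]] Ci]; apply: nD.
  exact: C_later Ci.
have FCT i : (F_ i `|` C_ i) `&` T_ i = set0.
  rewrite F_E; apply/seteqP; split=> // s [[[j /= ji [_ nD]]|[_ nD]] /T_D Ts]; apply: nD => //.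
  exact: (dD _ _ (n2_mono _ _ (ltnW ji))).
have [N HN] := cauchy E mE h h0.
have [[iN lm _ n12] [_ AD nsA [sF sl sm]]] := okP N.
apply: nsA; set X := nu (m_ N); set Y := nu (l_ N).
have mX B : measurable B -> measurable_fun setT (X B) by exact: mm.
have mY B : measurable B -> measurable_fun setT (Y B) by exact: mm.
have three Z : L0_measure Z -> aeq (Z E) (fun w => Z (F_ N) w + Z (C_ N) w + Z (T_ N) w).
  move=> ZM; have mZ B : measurable B -> measurable_fun setT (Z B) by exact: ZM.1.1.
  have mFC : measurable (F_ N `|` C_ N) by exact: measurableU.
  rewrite {1}(EE N); apply: (@aeq_trans _ _ _ _ _ (fun w => Z (F_ N `|` C_ N) w + Z (T_ N) w)).
  - by apply: mZ; exact: measurableU.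
  - by apply: measurable_funD; exact: mZ.
  - by do 2?[apply: measurable_funD]; exact: mZ.
  - exact: L0_measureD.
  - apply: aeqD; try exact: mZ; first by apply: measurable_funD; exact: mZ.
      exact: L0_measureD.
    exact: aeq_refl.
pose AD2 := A_ N `&` D (n2 N); have mAD2 : measurable AD2 by exact: measurableI.
(* [X (A_ N)] rewritten: split off [AD2], then solve the decompositions of [X E] and [Y E] into
   [F_], [C_] and [T_] for [X (C_ N)]. Every term is now small. *)
pose G w := X AD2 w + (X E w - Y E w) - (X (F_ N) w - Y (F_ N) w) + Y (C_ N) w + Y (T_ N) w - X
  (T_ N) w.
have mXE : measurable_fun setT (fun w => X E w - Y E w) by apply: measurable_funB;
  [exact: mX|exact: mY].
have mXF : measurable_fun setT (fun w => X (F_ N) w - Y (F_ N) w) by apply: measurable_funB;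
  [exact: mX|exact: mY].
have m1 := measurable_funD (mX _ mAD2) mXE.
have m2 := measurable_funB m1 mXF.
have m3 := measurable_funD m2 (mY _ (mC N)).
have m4 := measurable_funD m3 (mY _ (mT N)).
have mG : measurable_fun setT G := measurable_funB m4 (mX _ (mT N)).
apply: (@small_aeq _ _ _ _ _ G) => //; first exact: mX.
  apply: aeq_sym; apply: (@aeq_imp3
    (fun i : 'I_3 => if val i == 0%N then X E else if val i == 1%N then Y E else X (A_ N))
    (fun i : 'I_3 => if val i == 0%N then (fun w => X (F_ N) w + X (C_ N) w + X (T_ N) w)
       else if val i == 1%N then (fun w => Y (F_ N) w + Y (C_ N) w + Y (T_ N) w)
       else (fun w => X (C_ N) w + X AD2 w))) => //.
  - by move=> i; do 2?[case: ifP => _]; first [exact: mX|exact: mY].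
  - by move=> i; do 2?[case: ifP => _]; do 2?[apply: measurable_funD]; first [exact: mX|exact: mY].
  - exact: mX.
  - move=> i; case: (val i == 0%N); first exact/three/nuM.
    case: (val i == 1%N); first exact/three/nuM.
    exact: (L0_measureID (nuM (m_ N))).
  - move=> w H; rewrite /G.
    by have := H ord0; have := H 1; have := H 2 => /= -> -> ->; ring.
have D12 : D (n2 N) `<=` D (n1 N) by exact: dD.
have s1 : small h (X AD2) by apply: sm => // s [].
have s2 : small h (fun w => X E w - Y E w) by apply: HN => //; exact: leq_trans lm.
have s4 : small h (Y (C_ N)) by apply: sl => // s [/AD].
have s5 : small h (Y (T_ N)) by apply: sl => //; exact: subset_trans (T_D N) _.
have s6 : small h (X (T_ N)) by exact: sm.
have t1 := smallD (mX _ mAD2) mXE s1 s2.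
have t2 := smallB m1 mXF t1 sF.
have t3 := smallD m2 (mY _ (mC N)) t2 s4.
have t4 := smallD m3 (mY _ (mT N)) t3 s5.
have t5 := smallB m4 (mX _ (mT N)) t4 s6.
by apply: small_mono t5 => //; rewrite /h; lra.
Qed.

End Nikodym.

(** * Integration with respect to a stochastic measure *)

Section StochasticMeasure.
Context (R : realType) (dO dS : measure_display) (Omega : measurableType dO)
  (P : probability Omega R) (S : measurableType dS).
Local Notation pr := (Pr P).
Local Notation aeq := (as_eq P).
Local Notation small := (small_in_prob P).
Context (mu : set S -> L0 P) (mu_sm : stochastic_measure mu).
Implicit Types (A B : set S) (f g : {sfun S >-> R}).

Definition mu_fun A : Omega -> R := mu A.

Lemma measurable_mu A : measurable_fun setT (mu_fun A).
Proof. exact: measurable_L0. Qed.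

Lemma mu_tends (A : nat -> set S) : (forall k, measurable (A k)) -> trivIset setT A ->
  tends_in_prob P (fun n w => \sum_(k < n) mu_fun (A k) w) (mu_fun (\bigcup_k A k)).
Proof.
move=> mA tA; apply/cvg_in_probP; last exact: mu_sm.
- by move=> n; apply: measurable_sum => k; exact: measurable_mu.
- exact: measurable_mu.
Qed.

(** For the constant sequence of empty sets, consecutive partial sums differ by [mu set0], and they
    form a Cauchy sequence. *)
Lemma mu_set0 : aeq (mu_fun set0) (fun=> 0).
Proof.
apply: aeq0P => [|e e0]; first exact: measurable_mu.
have mX n : measurable_fun setT (fun w => \sum_(k < n) mu_fun set0 w).
  by apply: measurable_sum => k; exact: measurable_mu.
have := mu_tends (fun=> measurable0) (@trivIset_set0 _ _ _) .
rewrite bigcup0// => /(tends_cauchy mX (measurable_mu _)) /(_ e e0)[N].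
move=> /(_ N.+1 N (leqnSn N) (leqnn N)).
rewrite /small_in_prob (@eq_pr _ _ _ P _ (fun w => e <= `|mu_fun set0 w|))// => w.
by rewrite big_ord_recr /= addrAC subrr add0r.
Qed.

Lemma mu_additive : ae_additive P mu_fun.
Proof.
split=> [A _|A B mA mB AB0]; first exact: measurable_mu.
have mk k : measurable (bigcup2 A B k) by case: k => [|[|k]] /=.
have tAB : trivIset setT (bigcup2 A B).
  by rewrite -trivIset_bigcup2.
have := mu_tends mk tAB; rewrite bigcup2E => lim.
pose X n w := \sum_(k < n) mu_fun (bigcup2 A B k) w.
have mX n : measurable_fun setT (X n) by apply: measurable_sum => k; exact: measurable_mu.
have XE n : aeq (X n.+2) (fun w => mu_fun A w + mu_fun B w).
  elim: n => [|n IH]; first by apply: eq_aeq => w; rewrite /X !big_ord_recl big_ord0 /= addr0.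
  have mAB : measurable_fun setT (fun w => mu_fun A w + mu_fun B w).
    by apply: measurable_funD; exact: measurable_mu.
  rewrite /X; under [X in as_eq P X]eq_fun do rewrite big_ord_recr /=.
  rewrite (_ : (fun w => mu_fun A w + mu_fun B w) =
    (fun w => (mu_fun A w + mu_fun B w) + 0)); last by apply/funext => w; rewrite addr0.
  by apply: aeqD => //; [exact: mX|exact: measurable_mu|exact: mu_set0].
apply: (@tends_unique _ _ _ _ (fun n => X n.+2)) => //.
- exact: measurable_mu.
- by apply: measurable_funD; exact: measurable_mu.
- by move=> e e0; have [N HN] := lim e e0; exists N => n Nn; apply: HN; exact/leqW/leqW.
- move=> e e0; exists 0%N => n _.
  apply: (@small_aeq _ _ _ _ _ (fun=> 0)) (small0 _ e0) => //.
    by apply: measurable_funB => //; apply: measurable_funD; exact: measurable_mu.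
  apply: aeq_sym; rewrite (_ : (fun=> 0) = (fun w =>
    (mu_fun A w + mu_fun B w) - (mu_fun A w + mu_fun B w))).
    have mAB : measurable_fun setT (fun w => mu_fun A w + mu_fun B w).
      by apply: measurable_funD; exact: measurable_mu.
    by apply: aeqB => //; exact: aeq_refl.
  by apply/funext => w; rewrite subrr.
Qed.

(** The partial sums over the disjoint differences of consecutive [D k] tend to the value on [D 0],
    with remainder the value on [D n]. *)
Lemma mu_L0_measure : L0_measure P mu_fun.
Proof.
split=> [|D [mD dD D0] e e0]; first exact: mu_additive.
pose E k := D k `\` D k.+1.
have mE k : measurable (E k) by exact: measurableD.
have tE : trivIset setT E.
  have H i j : (i < j)%N -> E i `&` E j = set0.
    move=> ij; apply/seteqP; split=> // s [[_ nD] [Dj _]]; apply: nD.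
    exact: dD Dj.
  move=> i j _ _ [s [Ei Ej]]; have [ij|ji|//] := ltngtP i j.
    by have : (E i `&` E j) s by []; rewrite H.
  by have : (E j `&` E i) s by []; rewrite H.
pose X n w := \sum_(k < n) mu_fun (E k) w.
have mX n : measurable_fun setT (X n) by apply: measurable_sum => k; exact: measurable_mu.
have XE n : aeq (fun w => X n w + mu_fun (D n) w) (mu_fun (D 0%N)).
  elim: n => [|n IH]; first by apply: eq_aeq => w; rewrite /X big_ord0 add0r.
  have mXD k l : measurable_fun setT (fun w => X k w + mu_fun (D l) w).
    by apply: measurable_funD; [exact: mX|exact: measurable_mu].
  apply: (aeq_trans _ _ _ _ IH); try exact: mXD; try exact: measurable_mu.
  rewrite (_ : (fun w => X n.+1 w + _) = fun w => X n w + (mu_fun (E n) w + mu_fun (D n.+1) w)).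
    apply: aeqD => //; try exact: measurable_mu.
    - by apply: measurable_funD; exact: measurable_mu.
    - exact: aeq_refl.
    - apply: aeq_sym; rewrite {1}(_ : D n = E n `|` D n.+1).
        apply: mu_additive.2 => //; apply/seteqP; split=> // s [[]] //.
      by rewrite /E setUC setDUK//; exact: dD.
  by apply/funext => w; rewrite /X big_ord_recr /= addrA.
have EU : \bigcup_k E k = D 0%N.
  apply/seteqP; split=> [s [k _ [Dk _]]|s Ds]; first exact: dD Dk.
  have [n nDn] : exists n, ~ D n s.
    by apply/existsNP => H; have : (\bigcap_n D n) s by []; rewrite D0.
  elim: n nDn => [//|n IH] nD; have [Dn|] := pselect (D n s); last exact: IH.
  by exists n.
have := mu_tends mE tE; rewrite EU => /(_ e e0)[N HN].
exists N => n /HN sX.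
have : small e (fun w => - mu_fun (D n) w).
  have mXD : measurable_fun setT (fun w => X n w - mu_fun (D 0%N) w).
    by apply: measurable_funB => //; exact: measurable_mu.
  have mN : measurable_fun setT (fun w => - mu_fun (D n) w).
    by apply: measurable_funN; exact: measurable_mu.
  apply: small_aeq sX => //.
  apply: (@aeq_imp3 _ _ _ _ (fun=> fun w => X n w + mu_fun (D n) w) (fun=> mu_fun (D 0%N))) => //.
  - by move=> _; apply: measurable_funD => //; exact: measurable_mu.
  - by move=> _; exact: measurable_mu.
  - by move=> w /(_ ord0) <-; rewrite opprD addrA subrr add0r.
by move=> /smallN; rewrite /small_in_prob (@eq_pr _ _ _ P _ (fun w =>
  e <= `|mu_fun (D n) w|))// => w; rewrite opprK.
Qed.

End StochasticMeasure.

(** * Integrals of simple functions *)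

Section SimpleIntegral.
Context (R : realType) (dO dS : measure_display) (Omega : measurableType dO)
  (P : probability Omega R) (S : measurableType dS).
Local Notation pr := (Pr P).
Local Notation aeq := (as_eq P).
Local Notation small := (small_in_prob P).
Context (mu : set S -> L0 P) (mu_sm : stochastic_measure mu).
Implicit Types (A B : set S) (f g : {sfun S >-> R}).
Local Notation T := (simple_int mu).
Local Notation mu_fun := (mu_fun mu).

Let values f := fset_set (range f).

Let values_mem f s : f s \in values f.
Proof. by rewrite in_fset_set ?inE; [exists s|exact: fimfunP]. Qed.

Lemma simple_intE A f : T A f = fun w =>
  \sum_(c <- values f) c * mu_fun (f @^-1` [set c] `&` A) w.
Proof.
by apply/funext => w; rewrite /simple_int fsbig_finite.
Qed.

Lemma measurable_simple_int A f : measurable_fun setT (T A f).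
Proof.
rewrite simple_intE; apply: measurable_sum => c.
by apply: measurable_funM => //; exact: measurable_mu.
Qed.

(** Blocks of [q] may be empty and values of [phi] may repeat, so several simple functions can share
    one labelling. *)
Definition factors (I : finType) (q : S -> I) (phi : I -> R) f : Prop :=
  forall s, f s = phi (q s).

Definition measurable_label (I : finType) (q : S -> I) : Prop :=
  forall i, measurable (q @^-1` [set i]).

Lemma measurable_label_pair (I J : finType) (q : S -> I) (q' : S -> J) :
  measurable_label q -> measurable_label q' -> measurable_label (fun s => (q s, q' s)).
Proof.
move=> mq mq' [i j]; rewrite (_ : _ @^-1` _ = q @^-1` [set i] `&` q' @^-1` [set j]).
  exact: measurableI.
by apply/seteqP; split=> s /= [-> ->].
Qed.

Lemma simple_factors_onto f : exists (n : nat) (q : S -> 'I_n) (phi : 'I_n -> R),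
  [/\ measurable_label q, factors q phi f & forall i, exists s, phi i = f s].
Proof.
have lt s : (index (f s) (values f) < size (values f))%N by rewrite index_mem values_mem.
exists (size (values f)), (fun s => Ordinal (lt s)), (fun i => nth 0 (values f) i); split.
  move=> i; rewrite (_ : _ @^-1` _ = f @^-1` [set nth 0 (values f) i]).
    exact: measurable_funPTI.
  apply/seteqP; split=> s /=; first by move=> <- /=; rewrite nth_index// values_mem.
  by move=> e; apply: val_inj => /=; rewrite e index_uniq// fset_uniq.
- by move=> s /=; rewrite nth_index// values_mem.
- move=> i; have : nth 0 (values f) i \in values f by rewrite mem_nth.
  by rewrite in_fset_set ?inE => [[s _ <-]|]; [exists s|exact: fimfunP].
Qed.

Lemma simple_factors f : exists (n : nat) (q : S -> 'I_n) (phi : 'I_n -> R),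
  measurable_label q /\ factors q phi f.
Proof.
by have [n [q [phi [mq fE _]]]] := simple_factors_onto f; exists n, q, phi.
Qed.

Lemma simple_int_factors (I : finType) (q : S -> I) phi A f :
  measurable A -> measurable_label q -> factors q phi f ->
  aeq (T A f) (fun w => \sum_i phi i * mu_fun (q @^-1` [set i] `&` A) w).
Proof.
move=> mA mq fE; rewrite simple_intE.
pose B i := q @^-1` [set i] `&` A.
have mB i : measurable (B i) by exact: measurableI.
have tB : trivIset setT B by move=> i j _ _ [s [[/= <- _] [/= <- _]]].
have mmu := measurable_mu mu.
have mf c : measurable (f @^-1` [set c] `&` A) by apply: measurableI => //;
  exact: measurable_funPTI.
(* A block whose value is not attained is empty. Replacing its measure by 0 lets the blocks be
   regrouped by attained values. *)
pose Y i w := if phi i \in values f then mu_fun (B i) w else 0.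
have mY i : measurable_fun setT (Y i).
  by rewrite /Y; case: (_ \in _); [exact: mmu|exact: measurable_cst].
have mlinB : measurable_fun setT (fun w => \sum_i phi i * mu_fun (B i) w).
  by apply: measurable_lin => i; exact: mmu.
have mlinY : measurable_fun setT (fun w => \sum_i phi i * Y i w) by exact: measurable_lin.
have mlinf : measurable_fun setT (fun w => \sum_(c <- values f) c * mu_fun (f @^-1` [set c] `&`
  A) w).
  by apply: measurable_sum => c; apply: measurable_funM => //; exact: mmu.
apply: (aeq_trans mlinf mlinY mlinB); last first.
  apply: aeq_lin => // i _.
  rewrite /Y; case: (boolP (phi i \in values f)) => [_|nv]; first exact: aeq_refl.
  have -> : B i = set0.
    by apply/seteqP; split=> // s [/= qs _]; move: nv; rewrite -qs -fE values_mem.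
  apply: aeq_sym; exact: mu_set0.
rewrite (_ : (fun w => \sum_i phi i * Y i w) =
    fun w => \sum_(c <- values f) c * \sum_(i | phi i == c) mu_fun (B i) w).
  apply: aeq_lin => [c|c|c _]; [exact: mmu|by apply: measurable_sum_cond => i; exact: mmu|].
  rewrite (_ : f @^-1` [set c] `&` A = \bigcup_(i in [set i | phi i == c]) B i).
    exact: (ae_additive_sum (mu_additive mu_sm)).
  apply/seteqP; split=> s.
    by move=> [/= fs As]; exists (q s) => //=; rewrite -fE fs.
  by move=> [i /= /eqP <- [/= <- As]]; split.
apply/funext => w; under [RHS]eq_bigr do rewrite mulr_sumr big_mkcond.
rewrite exchange_big /=; apply: eq_bigr => i _.
rewrite /Y; case: ifPn => [v|nv].
  rewrite (bigD1_seq (phi i)) ?fset_uniq//= eqxx big1 ?addr0// => c.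
  by rewrite eq_sym => /negbTE ->.
rewrite mulr0 big1_seq// => c /andP[_ cv]; case: eqP => // pc.
by move: nv; rewrite pc cv.
Qed.

Lemma simple_int_lin (a b : R) A f g (h : {sfun S >-> R}) : measurable A ->
  (forall s, h s = a * f s + b * g s) ->
  aeq (T A h) (fun w => a * T A f w + b * T A g w).
Proof.
move=> mA hE; have [n [q [phi [mq fE]]]] := simple_factors f.
have [m [q' [psi [mq' gE]]]] := simple_factors g.
have mp := measurable_label_pair mq mq'.
pose Q s := (q s, q' s).
have mmu := measurable_mu mu.
have rf := simple_int_factors mA mp (_ : factors Q (fun p => phi p.1) f).
have rg := simple_int_factors mA mp (_ : factors Q (fun p => psi p.2) g).
have rh := simple_int_factors mA mp (_ : factors Q (fun p => a * phi p.1 + b * psi p.2) h).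
have mlin c : measurable_fun setT (fun w => \sum_p c p * mu_fun (Q @^-1` [set p] `&` A) w).
  by apply: measurable_lin => p; exact: mmu.
have mT := measurable_simple_int A.
apply: (aeq_trans _ _ _ (rh _)) => //; first by apply: measurable_funD; exact: measurable_funM.
  by move=> s; rewrite hE fE gE.
apply: aeq_sym; rewrite (_ : (fun w => \sum_p _) = fun w =>
   a * (\sum_p phi p.1 * mu_fun (Q @^-1` [set p] `&` A) w) +
   b * (\sum_p psi p.2 * mu_fun (Q @^-1` [set p] `&` A) w)).
  apply: aeqD; try exact: measurable_funM.
    by apply: aeqZ => //; apply: rf.
  by apply: aeqZ => //; apply: rg.
apply/funext => w; rewrite !mulr_sumr -big_split; apply: eq_bigr => p _ /=; ring.
Qed.

Lemma simple_int_mul (I : finType) (q : S -> I) phi A f g (h : {sfun S >-> R}) :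
  measurable A -> measurable_label q -> factors q phi f -> (forall s, h s = f s * g s) ->
  aeq (T A h) (fun w => \sum_i phi i * T (q @^-1` [set i] `&` A) g w).
Proof.
move=> mA mq fE hE; have [m [q' [psi [mq' gE]]]] := simple_factors g.
have mp := measurable_label_pair mq mq'.
pose Q s := (q s, q' s).
have mmu := measurable_mu mu.
have rh := simple_int_factors mA mp (_ : factors Q (fun p => phi p.1 * psi p.2) h).
have mT B := measurable_simple_int B.
have mX : measurable_fun setT (fun w => \sum_p (phi p.1 * psi p.2) * mu_fun (Q @^-1` [set p] `&`
  A) w).
  by apply: measurable_lin => p; exact: mmu.
apply: (aeq_trans _ mX _ (rh _)) => //; first exact: measurable_lin.
  by move=> s; rewrite hE fE gE.
rewrite (_ : (fun w => \sum_p _) = fun w =>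
   \sum_i phi i * \sum_j psi j * mu_fun (q' @^-1` [set j] `&` (q @^-1` [set i] `&` A)) w).
  apply: aeq_lin => [i|i|i _]; [by apply: measurable_lin => j; exact: mmu|exact: mT|].
  apply: aeq_sym; apply: simple_int_factors => //; exact: measurableI.
apply/funext => w.
rewrite (eq_bigr (fun p => phi p.1 * psi p.2 * mu_fun (Q @^-1` [set (p.1, p.2)] `&` A) w));
  last by case.
rewrite -(pair_bigA _ (fun i j => phi i * psi j * mu_fun (Q @^-1` [set (i, j)] `&` A) w)) /=.
apply: eq_bigr => i _; rewrite mulr_sumr; apply: eq_bigr => j _; rewrite mulrA.
congr (_ * mu_fun _ w); rewrite setIA; congr (_ `&` _).
by apply/seteqP; split=> s /=; [move=> [-> ->]|move=> [<- <-]].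
Qed.

Lemma simple_int_L0_measure f : L0_measure P (T^~ f).
Proof.
have [n [q [phi [mq fE]]]] := simple_factors f.
have mmu := measurable_mu mu; have muM := mu_L0_measure mu_sm.
have mT B := measurable_simple_int B f.
have rf A mA := simple_int_factors mA mq fE (A := A).
pose X A w := \sum_i phi i * mu_fun (q @^-1` [set i] `&` A) w.
have mX A : measurable_fun setT (X A) by apply: measurable_lin => i; exact: mmu.
split; [split=> // A B mA mB AB0|].
  have mAB : measurable_fun setT (fun w => X A w + X B w) by exact: measurable_funD.
  apply: (aeq_trans (mT _) (mX _) _ (rf _ (measurableU _ _ mA mB))).
    by apply: measurable_funD.
  apply: (aeq_trans (mX _) mAB); first by apply: measurable_funD.
    rewrite (_ : (fun w => _) = fun w => \sum_i phi i * (mu_fun (q @^-1` [set i] `&` A) w +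
      mu_fun (q @^-1` [set i] `&` B) w)).
      apply: aeq_lin => [i|i|i _]; [exact: mmu|by apply: measurable_funD; exact: mmu|].
      rewrite setIUr; apply: (mu_additive mu_sm).2; try exact: measurableI.
      by rewrite setIACA AB0 setI0.
    by apply/funext => w; rewrite /X -big_split; apply: eq_bigr => i _ /=; rewrite mulrDr.
  by apply: aeqD => //; apply/aeq_sym/rf.
move=> D vD e e0; have [mD _ _] := vD.
suff H : forall s : seq 'I_n, forall e, 0 < e -> exists N, forall k, (N <= k)%N ->
    small e (fun w => \sum_(i <- s) phi i * mu_fun (q @^-1` [set i] `&` D k) w).
  have [N HN] := H (index_enum 'I_n) e e0; exists N => k /HN; apply: small_aeq => //.
    by apply: measurable_lin => i; exact: mmu.
  exact/aeq_sym/rf.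
elim=> [|i s IH] d d0.
  exists 0%N => k _; rewrite (_ : (fun w => _) = fun=> 0); first exact: small0.
  by apply/funext => w; rewrite big_nil.
have d2 : 0 < d / 2 by rewrite divr_gt0.
have [N HN] := IH _ d2.
pose C := 1 + `|phi i|; have C0 : 0 < C by rewrite ltr_pwDl.
have [M HM] := muM.2 _ (vanishingI (mq i) vD) _ (divr_gt0 d2 C0).
exists (maxn N M) => k; rewrite geq_max => /andP[/HN h1 /HM h2].
rewrite (_ : (fun w => _) = fun w => phi i * mu_fun (q @^-1` [set i] `&` D k) w +
   \sum_(j <- s) phi j * mu_fun (q @^-1` [set j] `&` D k) w); last first.
  by apply/funext => w; rewrite big_cons.
rewrite [d]splitr; apply: smallD => //.
- by apply: measurable_funM => //; exact: mmu.
- by apply: measurable_sum => j; apply: measurable_funM => //; exact: mmu.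
- rewrite (_ : d / 2 = C * (d / 2 / C)); last by rewrite [RHS]mulrC divfK ?gt_eqF.
  by apply: smallZ h2; rewrite ?lerDl ?lerDr//; exact/ltW/divr_gt0.
Qed.

(** The boundedness theorem enters the integration theory here. Its constant depends on [e] alone
    and is scaled by the bound of [f] on [A]. *)
Lemma simple_int_bounded e : 0 < e -> exists2 c : R, 0 < c & forall (b : R) A f, 0 < b ->
  measurable A -> (forall s, A s -> `|f s| <= b) -> pr (fun w => c * b < `|T A f w|) <= e.
Proof.
move=> e0; have := @L0_measure_bounded _ _ _ _ P S mu_fun (mu_additive mu_sm) _ e e0.
move=> bdd; have [c cP] : exists c : R, forall (I : finType) (B : I -> set S) (a : I -> R),
    (forall i, measurable (B i)) -> trivIset setT B -> (forall i, `|a i| <= 1) ->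
    pr (fun w => c < `|\sum_i a i * mu_fun (B i) w|) <= e.
  apply: contrapT => /forallNP H; apply: bdd.
    move=> E mE tE d d0; have d2 : 0 < d / 2 by rewrite divr_gt0.
    have [N HN] := L0_measure_exhaustive (mu_L0_measure mu_sm) mE tE d2.
    exists N; apply: le_lt_trans (_ : d / 2 < d); last by lra.
    apply: le_trans (HN N (leqnn N)).
    apply: pr_le; try by apply: event_norm_le; exact: measurable_mu.
    by move=> w; apply: le_trans; lra.
  move=> c; apply: contrapT => nc; apply: (H c) => I B a mB tB a1.
  rewrite leNgt; apply/negP => h; apply: nc; exists I, B, a; split => //.
  exact: ltW.
exists (1 + `|c|); first by rewrite ltr_pwDl.
move=> b A f b0 mA fb; have [n [q [phi [mq fE]]]] := simple_factors f.
have mmu := measurable_mu mu.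
pose B i := q @^-1` [set i] `&` A.
have mB i : measurable (B i) by exact: measurableI.
have tB : trivIset setT B by move=> i j _ _ [s [[/= <- _] [/= <- _]]].
(* A value beyond [b] can only belong to a block that misses [A], so its coefficient may be set to
   0. *)
pose a i := if `|phi i| <= b then phi i / b else 0.
have a1 i : `|a i| <= 1.
  rewrite /a; case: ifP => h; last by rewrite normr0.
  by rewrite normrM normfV (gtr0_norm b0) ler_pdivrMr// mul1r.
pose X w := \sum_i a i * mu_fun (B i) w.
have mX : measurable_fun setT X by apply: measurable_lin => i; exact: mmu.
have TE : aeq (T A f) (fun w => b * X w).
  have mbX : measurable_fun setT (fun w => b * X w) by exact: measurable_funM.
  have mY : measurable_fun setT (fun w => \sum_i phi i * mu_fun (B i) w).
    by apply: measurable_lin => i; exact: mmu.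
  apply: (aeq_trans (measurable_simple_int A f) mY mbX (simple_int_factors mA mq fE)).
  pose Y i w := if `|phi i| <= b then mu_fun (B i) w else 0.
  rewrite (_ : (fun w => b * X w) = fun w => \sum_i phi i * Y i w).
    apply: aeq_lin => [i|i|i _]; first exact: mmu.
      by rewrite /Y; case: (_ <= _); [exact: mmu|exact: measurable_cst].
    rewrite /Y; case: (boolP (`|phi i| <= b)) => [_|nb]; first exact: aeq_refl.
    rewrite (_ : B i = set0); first exact: mu_set0.
    apply/seteqP; split=> // s [/= qs As]; move: nb; rewrite -qs -fE.
    by rewrite fb.
  apply/funext => w; rewrite /X mulr_sumr; apply: eq_bigr => i _; rewrite /a /Y.
  case: ifP => _; last by rewrite mul0r !mulr0.
  by rewrite mulrA (mulrC b) divfK ?gt_eqF.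
rewrite (pr_aeq_lt _ (measurable_simple_int A f) _ TE); last exact: measurable_funM.
apply: le_trans (cP _ B a mB tB a1); apply: pr_le.
- by apply: event_norm_lt; exact: measurable_funM.
- exact: event_norm_lt.
- move=> w; rewrite normrM (gtr0_norm b0) mulrC ltr_pM2l//; apply: le_lt_trans.
  by rewrite (le_trans (ler_norm c))// lerDr.
Qed.

End SimpleIntegral.

(** * Pointwise approximation by simple functions *)

Section Approximation.
Context (R : realType) (dS : measure_display) (S : measurableType dS).

(** Positive and negative parts are approximated from below separately; since one of them vanishes
    at each point, the difference stays below [|f|] in modulus. *)
Lemma dominated_approximation (f : S -> R) : measurable_fun setT f ->
  exists fn : nat -> {sfun S >-> R}, (forall n s, `|fn n s| <= `|f s|) /\
    (forall s, fn n s @[n --> \oo] --> f s).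
Proof.
move=> mf.
pose fp s := Num.max (f s) 0; pose fm s := Num.max (- f s) 0.
have mp : measurable_fun setT fp by apply: measurable_maxr.
have mm : measurable_fun setT fm by apply: measurable_maxr => //; exact: measurable_funN.
have mEp : measurable_fun setT (EFin \o fp) by exact/measurable_EFinP.
have mEm : measurable_fun setT (EFin \o fm) by exact/measurable_EFinP.
have fp0 s : setT s -> (0 <= (EFin \o fp) s)%E by rewrite lee_fin /fp le_max lexx orbT.
have fm0 s : setT s -> (0 <= (EFin \o fm) s)%E by rewrite lee_fin /fm le_max lexx orbT.
pose ap n := nnsfun_approx measurableT mEp n; pose am n := nnsfun_approx measurableT mEm n.
have ap_le n s : 0 <= ap n s <= fp s.
  by rewrite fun_ge0 /= /ap nnsfun_approxE -lee_fin; exact: (le_approx _ fp0).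
have am_le n s : 0 <= am n s <= fm s.
  by rewrite fun_ge0 /= /am nnsfun_approxE -lee_fin; exact: (le_approx _ fm0).
have parts s : (0 <= f s) * (fp s = f s) * (fm s = 0) + (f s < 0) * (fp s = 0) * (fm s = - f s).
  have [h|h] := leP 0 (f s); [left|right].
    by split; [split => //; rewrite /fp max_l|rewrite /fm max_r// oppr_le0].
  by split; [split => //; rewrite /fp max_r// ltW|rewrite /fm max_l// oppr_ge0 ltW].
exists (fun n => (ap n : {sfun S >-> R}) - (am n : {sfun S >-> R})); split.
  move=> n s /=; have /andP[p0 p1] := ap_le n s; have /andP[m0 m1] := am_le n s.
  rewrite [X in `|X|](_ : _ = ap n s - am n s)// ler_norml.
  have [[[h e1] e2]|[[h e1] e2]] := parts s; rewrite e1 in p1; rewrite e2 in m1.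
    by rewrite (ger0_norm h); apply/andP; split; lra.
  by rewrite (ltr0_norm h); apply/andP; split; lra.
move=> s; have -> : f s = fp s - fm s.
  by have [[[_ ->] ->]|[[_ ->] ->]] := parts s; rewrite ?subr0 ?sub0r ?opprK.
have cp : ap n s @[n --> \oo] --> fp s.
  rewrite (_ : (fun n => ap n s) = (fun n => approx setT (EFin \o fp) n s)).
    exact: (cvg_approx fp0) (ltry _).
  by apply/funext => n; rewrite /ap nnsfun_approxE.
have cm : am n s @[n --> \oo] --> fm s.
  rewrite (_ : (fun n => am n s) = (fun n => approx setT (EFin \o fm) n s)).
    exact: (cvg_approx fm0) (ltry _).
  by apply/funext => n; rewrite /am nnsfun_approxE.
exact: cvgB cp cm.
Qed.

(** Off this set all [u m] with [m >= n] are bounded by [eta]. Together with [exceptional_vanishing]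
    it does the work of Egorov's theorem. *)
Definition exceptional (u : nat -> S -> R) (eta : R) (n : nat) : set S :=
  \bigcup_(m in [set m | (n <= m)%N]) [set s | eta < `|u m s|].

Lemma exceptional_vanishing (u : nat -> S -> R) (eta : R) : 0 < eta ->
  (forall n, measurable_fun setT (u n)) -> (forall s, u n s @[n --> \oo] --> (0 : R)) ->
  vanishing (exceptional u eta).
Proof.
move=> eta0 mu u0; split.
- move=> n; apply: bigcup_measurable => m _; exact: event_norm_lt.
- by move=> m n mn s [k /= nk h]; exists k => //=; exact: leq_trans nk.
- apply/seteqP; split=> // s H.
  have /cvgrPdist_le /(_ eta eta0)[N _ HN] := u0 s.
  have [m /= Nm] := H N Logic.I; rewrite ltNge => /negP; apply.
  by have := HN m Nm; rewrite sub0r normrN.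
Qed.

End Approximation.

(** * Uniform additivity below an integrable function *)

Section Domination.
Context (R : realType) (dO dS : measure_display) (Omega : measurableType dO)
  (P : probability Omega R) (S : measurableType dS).
Local Notation pr := (Pr P).
Local Notation aeq := (as_eq P).
Local Notation small := (small_in_prob P).
Context (mu : set S -> L0 P) (mu_sm : stochastic_measure mu).
Implicit Types (A B : set S) (D : nat -> set S) (f g : {sfun S >-> R}).
Local Notation T := (simple_int mu).
Let mT A f : measurable_fun setT (T A f) := measurable_simple_int mu A f.

Lemma simple_int_small e : 0 < e -> exists2 delta : R, 0 < delta & forall A f,
  measurable A -> (forall s, A s -> `|f s| <= delta) -> small e (T A f).
Proof.
move=> e0; have [c c0 cP] := simple_int_bounded mu_sm e0.
exists (e / (2 * c)); first by rewrite divr_gt0// mulr_gt0.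
move=> A f mA fd; apply: le_trans (cP _ A f _ mA fd); last by rewrite divr_gt0// mulr_gt0.
apply: pr_le; [exact: event_norm_le|exact: event_norm_lt|].
have -> : c * (e / (2 * c)) = e / 2 by field; rewrite gt_eqF.
by move=> w; apply: lt_le_trans; lra.
Qed.

Lemma multiplier_small (nu : set S -> Omega -> R) (I : finType) (q : S -> I) (phi : I -> R) eta A :
  ae_additive P nu -> measurable_label q -> (forall i, `|phi i| <= 1) -> 0 < eta -> measurable A ->
  (forall E, measurable E -> E `<=` A -> small eta (nu E)) ->
  small (31 * eta) (fun w => \sum_i phi i * nu (q @^-1` [set i] `&` A) w).
Proof.
move=> nu_add mq phi1 eta0 mA sE.
pose B i := q @^-1` [set i] `&` A.
have mB i : measurable (B i) by exact: measurableI.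
have tB : trivIset setT B by move=> i j _ _ [s [[/= <- _] [/= <- _]]].
have m_nu := nu_add.1.
have eta8 : 0 < 8 * eta by rewrite mulr_gt0.
have [Q QP] := multiplier nu_add mB tB phi1 eta8.
have mX : measurable_fun setT (fun w => \sum_i phi i * nu (B i) w).
  by apply: measurable_lin => i; exact: m_nu.
apply: le_trans (_ : pr (fun w => 8 * eta < `|\sum_i phi i * nu (B i) w|) <= _).
  apply: pr_le; [exact: event_norm_le|exact: event_norm_lt|].
  by move=> w; apply: lt_le_trans; lra.
apply: le_trans QP _; rewrite ler_pM2l// mulrAC divff ?mul1r//.
apply: sE; first by apply: fin_bigcup_measurable => // i _; exact: mB.
by move=> s [i _ []].
Qed.

(** All that the convergence theorems use of an integrable bound. By its form it is inherited by
    every smaller bound. *)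
Definition dominating (g : S -> R) : Prop :=
  forall D, vanishing D -> forall e, 0 < e -> exists N, forall n, (N <= n)%N ->
    forall A f, measurable A -> A `<=` D n -> (forall s, `|f s| <= g s) -> small e (T A f).

Lemma small_simple_intD e A f (h k : {sfun S >-> R}) : measurable A -> 0 < e ->
  (forall s, k s = f s + h s) -> small (e / 2) (T A f) -> small (e / 2) (T A h) -> small e (T A k).
Proof.
move=> mA e0 kE sf sh.
have := smallD (mT A f) (mT A h) sf sh; rewrite -splitr; apply: small_aeq => //.
  exact: measurable_funD.
have := @simple_int_lin _ _ _ _ _ _ _ mu_sm 1 1 A f h k mA.
have -> : (fun w => 1 * T A f w + 1 * T A h w) = (fun w => T A f w + T A h w).
  by apply/funext => w; rewrite !mul1r.
by move=> H; apply/aeq_sym/H => s; rewrite !mul1r.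
Qed.

(* The multiplier [psi = f / g] is a limit of simple [psi_l] with [|psi_l| <= 1], so
   the integral of [f] is a limit of integrals of [psi_l * gn l], which are controlled
   by the setwise convergent measures [T^~ (gn l)]. *)
Lemma setwise_cauchy_dominating (g : S -> R) (gn : nat -> {sfun S >-> R}) :
  measurable_fun setT g -> (forall s, gn n s @[n --> \oo] --> g s) ->
  (forall A, measurable A -> forall e, 0 < e -> exists N, forall m l, (N <= m)%N -> (N <= l)%N ->
     small e (fun w => T A (gn m) w - T A (gn l) w)) ->
  dominating (fun s => `|g s|).
Proof.
(* [31 * eta = e / 4]: half of [e] goes to the exceptional set, a quarter to [u l] off it, and this
   quarter to [k l]. *)
move=> mg gng cauchy D vD e e0; pose eta := e / 124.
have eta0 : 0 < eta by rewrite divr_gt0.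
have e2 : 0 < e / 2 by rewrite divr_gt0.
have e4 : 0 < e / 2 / 2 by rewrite divr_gt0.
have [N HN] := nikodym_uniform (fun m => simple_int_L0_measure mu_sm (gn m)) cauchy vD eta0.
exists N => n Nn A f mA AD fg.
(* Division by 0 gives 0, the right value because [f] vanishes where [g] does. *)
pose psi s := f s / g s.
have f0 s : g s = 0 -> f s = 0.
  by move=> g0; apply/normr0_eq0/eqP; rewrite eq_le normr_ge0 -(normr0 R) -g0 fg.
have psi1 s : `|psi s| <= 1.
  have [g0|g0] := eqVneq (g s) 0; first by rewrite /psi f0// mul0r normr0.
  by rewrite /psi normrM normfV ler_pdivrMr ?normr_gt0// mul1r.
have psiE s : psi s * g s = f s.
  have [g0|g0] := eqVneq (g s) 0; last by rewrite /psi divfK.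
  by rewrite f0// g0 mulr0.
have mpsi : measurable_fun setT psi.
  apply: measurable_funM => //.
  (* [powR] inverts only nonnegative numbers, whence the detour through [g ^+ 2]. *)
  rewrite (_ : (fun s => (g s)^-1) = fun s => g s * (@powR R ^~ (-1)) (g s ^+ 2)).
    apply: measurable_funM => //.
    apply: (measurableT_comp (@measurable_powR R (-1))).
    exact: measurable_funX.
  apply/funext => s; rewrite powR_inv1 ?sqr_ge0// expr2 invfM mulrA.
  have [->|g0] := eqVneq (g s) 0; first by rewrite invr0 mulr0.
  by rewrite divff ?mul1r.
have [psin [psin_le psin_cvg]] := dominated_approximation mpsi.
pose k l := (psin l : {sfun S >-> R}) * gn l.
pose u l : {sfun S >-> R} := f - k l.
have mu_ l : measurable_fun setT (u l : S -> R) by exact: measurable_funP.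
have u0 s : u l s @[l --> \oo] --> (0 : R).
  rewrite -(subrr (f s)) -{2}psiE; apply: cvgB; first exact: cvg_cst.
  exact: cvgM (psin_cvg s) (gng s).
have [delta delta0 sdelta] := simple_int_small e4.
have vE := exceptional_vanishing delta0 mu_ u0.
have [l sl] := (simple_int_L0_measure mu_sm f).2 _ (vanishingI mA vE) _ e2.
pose C := exceptional u delta l.
have mC : measurable C by have [mE _ _] := vE; exact: mE.
have mAC : measurable (A `\` C) by exact: measurableD.
apply: (small_part (simple_int_L0_measure mu_sm f) mA mC e0); first exact: sl.
apply: (@small_simple_intD _ _ (u l) (k l)) => //.
- by move=> s /=; rewrite -[LHS](subrK (k l s)).
- apply: sdelta => // s [_ nC]; rewrite leNgt; apply/negP => h; apply: nC; by exists l => /=.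
have [m [q [phi [mq qE phi_onto]]]] := simple_factors_onto (psin l).
have := simple_int_mul mu_sm mAC mq qE (_ : forall s, k l s = psin l s * gn l s).
move=> /(_ (fun=> erefl)) kE.
have mX : measurable_fun setT (fun w => \sum_i phi i * T (q @^-1` [set i] `&` (A `\` C)) (gn l) w).
  exact: measurable_lin.
apply: (small_aeq mX (mT _ _) (aeq_sym kE)).
have -> : e / 2 / 2 = 31 * eta by rewrite /eta; field.
apply: (multiplier_small (simple_int_L0_measure mu_sm (gn l)).1) => //.
  by move=> i; have [s ->] := phi_onto i; exact: le_trans (psin_le l s) (psi1 s).
by move=> E mE EA; apply: HN Nn _ _ mE _ => s /EA [/AD].
Qed.

Lemma dominatingZ (C : R) (g : S -> R) : 1 <= C -> dominating g -> dominating (fun s => C * g s).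
Proof.
move=> C1 dg D vD e e0; have C0 : 0 < C by exact: lt_le_trans C1.
have eC : 0 < e / C by rewrite divr_gt0.
have [N HN] := dg D vD _ eC; exists N => n Nn A f mA AD fg.
pose f' : {sfun S >-> R} := cst_sfun C^-1 * f.
have f'E s : f' s = C^-1 * f s by [].
have sf' : small (e / C) (T A f').
  apply: HN Nn _ _ mA AD _ => s; rewrite f'E normrM normfV (gtr0_norm C0) mulrC.
  by rewrite ler_pdivrMr// mulrC.
have := @smallZ _ _ _ P C C _ _ C1 _ (ltW eC) (mT A f') sf'.
rewrite (gtr0_norm C0) lexx => /(_ isT).
have -> : C * (e / C) = e by rewrite mulrC divfK ?gt_eqF.
apply: small_aeq => //; first exact: measurable_funM.
have := @simple_int_lin _ _ _ _ _ _ _ mu_sm C 0 A f' f' f mA.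
have -> : (fun w => C * T A f' w + 0 * T A f' w) = (fun w => C * T A f' w).
  by apply/funext => w; rewrite mul0r addr0.
move=> H; apply/aeq_sym/H => s; rewrite mul0r addr0 f'E mulrA divff ?mul1r// gt_eqF//.
Qed.

End Domination.

(** * The integral and its uniqueness *)

Section Integral.
Context (R : realType) (dO dS : measure_display) (Omega : measurableType dO)
  (P : probability Omega R) (S : measurableType dS).
Local Notation pr := (Pr P).
Local Notation aeq := (as_eq P).
Local Notation small := (small_in_prob P).
Local Notation tends := (tends_in_prob P).
Context (mu : set S -> L0 P) (mu_sm : stochastic_measure mu).
Implicit Types (A B : set S) (D : nat -> set S) (I J : set S -> L0 P).
Local Notation T := (simple_int mu).
Let mT A f : measurable_fun setT (T A f) := measurable_simple_int mu A f.

Lemma indefinite_intP (f : S -> R) I : is_indefinite_int mu f I <->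
  exists fn : nat -> {sfun S >-> R}, (forall s, fn n s @[n --> \oo] --> f s) /\
    forall A, measurable A -> tends (fun n => T A (fn n)) (I A).
Proof.
have E (fn : nat -> {sfun S >-> R}) A := cvg_in_probP P (fun n =>
  mT A (fn n)) (measurable_L0 (I A)).
by split=> -[fn [fnf H]]; exists fn; split=> // A /H /E.
Qed.

Lemma tends_simple_int_lin (a b : R) (f g h : nat -> {sfun S >-> R}) (X Y Z : L0 P) A :
  measurable A -> (forall n s, h n s = a * f n s + b * g n s) ->
  tends (fun n => T A (f n)) X -> tends (fun n => T A (g n)) Y ->
  aeq Z (fun w => a * X w + b * Y w) -> tends (fun n => T A (h n)) Z.
Proof.
move=> mA hE fX gY ZE; have mX := measurable_L0 X; have mY := measurable_L0 Y.
have mZ := measurable_L0 Z.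
have mM (c : R) (W : Omega -> R) : measurable_fun setT W -> measurable_fun setT (fun w => c * W w).
  by move=> mW; exact: measurable_funM.
apply: (@tends_aeq _ _ _ _ (fun n w => a * T A (f n) w + b * T A (g n) w) _
   (fun w => a * X w + b * Y w)) => //.
- by move=> n; apply: measurable_funD; exact: mM.
- by apply: measurable_funD; exact: mM.
- by move=> n; apply/aeq_sym/(simple_int_lin mu_sm).
- exact: aeq_sym.
apply: tendsD; try (by move=> *; exact: mM); [exact: tendsZ|exact: tendsZ].
Qed.

(** The difference of two approximating sequences tends to 0 pointwise, and its integrals converge
    on every set. Nikodym's theorem makes them uniformly small on the exceptional sets, and off
    these the integrands are small. The choice made in [sm_int] is thereby harmless. *)
Lemma indefinite_int_unique (f : S -> R) I J A : is_indefinite_int mu f I ->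
  is_indefinite_int mu f J -> measurable A -> I A = J A.
Proof.
move=> /indefinite_intP[fn [fnf fnI]] /indefinite_intP[gn [gnf gnJ]] mA; apply: L0_ext.
pose k n : {sfun S >-> R} := fn n - gn n.
have kE n s : k n s = 1 * fn n s + (-1) * gn n s by rewrite mul1r mulN1r.
have mD B : measurable_fun setT (fun w => I B w - J B w).
  by apply: measurable_funB; exact: measurable_L0.
have kIJ B : measurable B -> tends (fun n => T B (k n)) (fun w => I B w - J B w).
  move=> mB; have [K KE] := L0_of P (mD B); have mK := measurable_L0 K.
  apply: (@tends_aeq _ _ _ _ (fun n => T B (k n)) _ K) => //; first by move=> n; exact: aeq_refl.
  apply: (tends_simple_int_lin mB kE (fnI B mB) (gnJ B mB)).
  apply: (aeq_trans mK (mD B)) => //.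
    by apply: measurable_funD; apply: measurable_funM => //; exact: measurable_L0.
  by apply: eq_aeq => w; rewrite mul1r mulN1r.
have k0 s : k n s @[n --> \oo] --> (0 : R).
  by rewrite -(subrr (f s)); exact: cvgB (fnf s) (gnf s).
suff : aeq (fun w => I A w - J A w) (fun=> 0).
  by rewrite /as_eq (@eq_pr _ _ _ P _ (fun w => I A w != J A w))// => w; rewrite subr_eq0.
apply: aeq0P => // e e0; have e2 : 0 < e / 2 by rewrite divr_gt0.
have e4 : 0 < e / 2 / 2 by rewrite divr_gt0.
apply: (small_tends _ (mD A) (kIJ A mA) _ (_ : e / 2 < e)) => //; last by lra.
have [delta delta0 sdelta] := simple_int_small mu_sm e4.
have vD : vanishing (exceptional (k : nat -> S -> R) delta).
  by apply: exceptional_vanishing => // n; exact: measurable_funP.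
have [N HN] := nikodym_uniform (fun m => simple_int_L0_measure mu_sm (k m))
   (fun B mB => tends_cauchy (fun n => mT B (k n)) (mD B) (kIJ B mB)) vD e4.
exists N => n Nn; have mE : measurable (exceptional (k : nat -> S -> R) delta n).
  by have [mE _ _] := vD; exact: mE.
apply: (small_part (simple_int_L0_measure mu_sm (k n)) mA mE e2).
  by apply: HN Nn _ _ _ _; [exact: measurableI|exact: subIsetr].
apply: sdelta; first exact: measurableD.
by move=> s [_ nE]; rewrite leNgt; apply/negP => h; apply: nE; exists n => /=.
Qed.

Lemma sm_intE (f : S -> R) I A : is_indefinite_int mu f I -> measurable A ->
  sm_int mu A f = I A.
Proof.
move=> fI mA; rewrite /sm_int; case: xgetP => [X _ [J fJ <-]|/(_ (I A))]; last first.
  by case; exists I.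
exact: indefinite_int_unique fJ fI mA.
Qed.

Lemma indefinite_int_lin (a b : R) (f g h : S -> R) I J : is_indefinite_int mu f I ->
  is_indefinite_int mu g J -> (forall s, h s = a * f s + b * g s) ->
  exists K, is_indefinite_int mu h K /\ forall A, measurable A ->
    aeq (K A) (fun w => a * I A w + b * J A w).
Proof.
move=> /indefinite_intP[fn [fnf fnI]] /indefinite_intP[gn [gng gnJ]] hE.
have mIJ A : measurable_fun setT (fun w => a * I A w + b * J A w).
  by apply: measurable_funD; apply: measurable_funM => //; exact: measurable_L0.
have /choice[K KE] : forall A, exists X : L0 P, aeq X (fun w => a * I A w + b * J A w).
  by move=> A; exact: L0_of.
exists K; split=> [|A _]; last exact: KE.
apply/indefinite_intP.
pose k n : {sfun S >-> R} := cst_sfun a * fn n + cst_sfun b * gn n.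
exists k; split=> [s|A mA].
  by rewrite hE; apply: cvgD; apply: cvgM (cvg_cst _) _; [exact: fnf|exact: gng].
have kE n s : k n s = a * fn n s + b * gn n s by [].
exact: (tends_simple_int_lin mA kE (fnI A mA) (gnJ A mA) (KE A)).
Qed.

Lemma integrable_dominating (g : S -> R) : sm_integrable mu g ->
  dominating mu (fun s => `|g s|).
Proof.
move=> [mg [I /indefinite_intP[gn [gng gnI]]]].
apply: (setwise_cauchy_dominating mu_sm mg gng) => A mA.
exact: (tends_cauchy (fun n => mT A (gn n)) (measurable_L0 (I A)) (gnI A mA)).
Qed.

Section DominatedBy.
Context (g : S -> R) (g_dom : dominating mu g).

(** Cauchy in probability: off an exceptional set the differences [fn m - fn n] are uniformly small,
    and on it domination makes each of the two integrals small. *)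
Lemma dominated_simple_cvg (f : S -> R) (fn : nat -> {sfun S >-> R}) :
  measurable_fun setT f -> (forall s, `|f s| <= g s) -> 
  (forall n s, `|fn n s| <= `|f s|) -> (forall s, fn n s @[n --> \oo] --> f s) ->
  exists I, forall A, measurable A -> tends (fun n => T A (fn n)) (I A).
Proof.
move=> mf fg fn_le fnf.
suff /choice[I IP] : forall A, exists X : L0 P, measurable A -> tends (fun n => T A (fn n)) X.
  by exists I.
move=> A; have [mA|nA] := pselect (measurable A); last by exists (L0_zero P) => /nA.
suff [X XP] : exists X : L0 P, tends (fun n => T A (fn n)) X by exists X.
apply: prob_complete => // e e0; have e2 : 0 < e / 2 by rewrite divr_gt0.
have e4 : 0 < e / 2 / 2 by rewrite divr_gt0.
have e8 : 0 < e / 2 / 2 / 2 by rewrite divr_gt0.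
have [delta delta0 sdelta] := simple_int_small mu_sm e8.
have d4 : 0 < delta / 2 by rewrite divr_gt0.
pose u n s := fn n s - f s.
have mu_ n : measurable_fun setT (u n) by apply: measurable_funB => //; exact: measurable_funP.
have u0 s : u n s @[n --> \oo] --> (0 : R).
  by rewrite -(subrr (f s)); apply: cvgB; [exact: fnf|exact: cvg_cst].
have vD := exceptional_vanishing d4 mu_ u0; have [mD _ _] := vD.
have [N HN] := g_dom vD e8.
exists N => m n Nm Nn.
pose k : {sfun S >-> R} := fn m - fn n.
have kE s : k s = 1 * fn m s + (-1) * fn n s by rewrite mul1r mulN1r.
have kT B : measurable B -> aeq (T B k) (fun w => T B (fn m) w - T B (fn n) w).
  move=> mB; have := simple_int_lin mu_sm mB kE.
  rewrite (_ : (fun w => _) = fun w => T B (fn m) w - T B (fn n) w)//.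
  by apply/funext => w; rewrite mul1r mulN1r.
have mk B : measurable_fun setT (fun w => T B (fn m) w - T B (fn n) w) by exact: measurable_funB.
apply: (small_aeq (mT A k) (mk A) (kT A mA)).
pose C := exceptional u (delta / 2) N.
have mC : measurable C by exact: mD.
have mAC : measurable (A `&` C) by exact: measurableI.
apply: (small_part (simple_int_L0_measure mu_sm k) mA mC e0).
  apply: (small_aeq (mk _) (mT _ k) (aeq_sym (kT _ mAC))).
  have sC l : small (e / 2 / 2) (T (A `&` C) (fn l)).
    apply: (@small_mono _ _ _ _ _ (e / 2 / 2 / 2)) => //; first by lra.
    apply: HN (leqnn N) _ _ mAC (@subIsetr _ _ _) _ => s.
    exact: le_trans (fn_le l s) (fg s).
  by rewrite [e / 2]splitr; apply: smallB.
apply: (@small_mono _ _ _ _ _ (e / 2 / 2 / 2)) => //; first by lra.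
apply: sdelta => [|s [_ nC]]; first exact: measurableD.
have close l : (N <= l)%N -> `|u l s| <= delta / 2.
  by move=> Nl; rewrite leNgt; apply/negP => h; apply: nC; exists l.
have -> : k s = u m s - u n s by rewrite /u opprB addrA subrK.
apply: le_trans (ler_normB _ _) _.
by rewrite [delta]splitr; apply: lerD; exact: close.
Qed.

Lemma dominated_integrable (f : S -> R) : measurable_fun setT f ->
  (forall s, `|f s| <= g s) -> sm_integrable mu f.
Proof.
move=> mf fg; split=> //; have [fn [fn_le fnf]] := dominated_approximation mf.
have [I fnI] := dominated_simple_cvg mf fg fn_le fnf.
by exists I; apply/indefinite_intP; exists fn.
Qed.

(** By uniqueness the integral may be computed along simple functions below [|f|]; passing to the
    limit costs the step from [a] to [b]. *)
Lemma indefinite_int_small (f : S -> R) I (a b : R) A : measurable_fun setT f ->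
  (forall s, `|f s| <= g s) -> is_indefinite_int mu f I -> measurable A -> a < b ->
  (forall k : {sfun S >-> R}, (forall s, `|k s| <= `|f s|) -> small a (T A k)) -> small b (I A).
Proof.
move=> mf fg fI mA ab H; have [fn [fn_le fnf]] := dominated_approximation mf.
have [J fnJ] := dominated_simple_cvg mf fg fn_le fnf.
have fJ : is_indefinite_int mu f J by apply/indefinite_intP; exists fn.
rewrite (indefinite_int_unique fI fJ mA).
apply: (small_tends _ (measurable_L0 (J A)) (fnJ A mA) _ ab) => //.
by exists 0%N => n _; apply: H.
Qed.

Lemma dominated_cvg0 (fn : nat -> S -> R) (I : nat -> set S -> L0 P) :
  (forall n, measurable_fun setT (fn n)) -> (forall n s, `|fn n s| <= g s) ->
  (forall s, fn n s @[n --> \oo] --> (0 : R)) ->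
  (forall n, is_indefinite_int mu (fn n) (I n)) ->
  forall e, 0 < e -> exists N, forall n, (N <= n)%N -> small e (I n setT).
Proof.
move=> mfn fng fn0 fnI e e0; have e2 : 0 < e / 2 by rewrite divr_gt0.
have e4 : 0 < e / 2 / 2 by rewrite divr_gt0.
have [delta delta0 sdelta] := simple_int_small mu_sm e4.
have vD := exceptional_vanishing delta0 mfn fn0; have [mD _ _] := vD.
have [N HN] := g_dom vD e4; exists N => n Nn.
apply: (indefinite_int_small (mfn n) (fng n) (fnI n) measurableT (_ : e / 2 < e)); first by lra.
move=> k k_le.
apply: (small_part (simple_int_L0_measure mu_sm k) measurableT (mD n) e2).
  apply: HN Nn _ _ _ (@subIsetr _ _ _) _ => [|s]; first by rewrite setTI.
  exact: le_trans (k_le s) (fng n s).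
apply: sdelta => [|s [_ nD]]; first exact: measurableD.
apply: le_trans (k_le s) _; rewrite leNgt; apply/negP => h; apply: nD; by exists n => /=.
Qed.

End DominatedBy.
End Integral.

(** * Dominated convergence *)

Section DominatedConvergence.
Context (R : realType) (dO dS : measure_display) (Omega : measurableType dO)
  (P : probability Omega R) (S : measurableType dS).
Local Notation pr := (Pr P).
Local Notation aeq := (as_eq P).
Local Notation small := (small_in_prob P).
Local Notation tends := (tends_in_prob P).
Context (mu : set S -> L0 P) (mu_sm : stochastic_measure mu).
Implicit Types (A B : set S) (D : nat -> set S) (I J : set S -> L0 P).
Local Notation T := (simple_int mu).

Lemma indefinite_int_sum (U : Type) (r : seq U) (f : U -> S -> R) (J : U -> set S ->
  L0 P) (c : U -> R) :
  (forall i, is_indefinite_int mu (f i) (J i)) ->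
  exists K, is_indefinite_int mu (fun s => \sum_(i <- r) f i s * c i) K /\
    forall A, measurable A -> aeq (K A) (fun w => \sum_(i <- r) J i A w * c i).
Proof.
move=> fJ; elim: r => [|i r [K [rK KE]]].
  have [Z ZE] := L0_of P (@measurable_cst _ _ Omega _ setT (0 : R)).
  exists (fun=> Z); split=> [|A mA]; last by under eq_fun do rewrite big_nil.
  apply/indefinite_intP; exists (fun=> cst_sfun 0); split=> [s|A mA].
    by rewrite big_nil; exact: cvg_cst.
  move=> e e0; exists 0%N => n _; apply: (@small_aeq _ _ _ _ _ (fun=> 0)) (small0 _ e0) => //.
    by apply: measurable_funB; [exact: measurable_simple_int|exact: measurable_L0].
  have mZ := measurable_L0 Z; have mT := measurable_simple_int mu A (cst_sfun 0).
  apply: aeq_sym; rewrite (_ : (fun=> 0) = (fun w : Omega => 0 - 0 : R));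
    last by apply/funext => w; rewrite subr0.
  apply: aeqB => //.
  (* Linearity with both coefficients 0 evaluates the integral of the zero function. *)
  have := simple_int_lin mu_sm (f := cst_sfun 0) (g := cst_sfun 0) (h := cst_sfun 0) (a := 0) (b
    := 0) mA.
  rewrite (_ : (fun w => _) = fun=> 0); last by apply/funext => w; rewrite !mul0r addr0.
  by apply=> s; rewrite !mul0r addr0.
have sE s : \sum_(j <- i :: r) f j s * c j = c i * f i s + 1 * \sum_(j <- r) f j s * c j.
  by rewrite big_cons mul1r mulrC.
have [L [L_int LE]] := indefinite_int_lin mu_sm (fJ i) rK sE.
exists L; split=> // A mA; have mJ j := measurable_L0 (J j A).
have ms : measurable_fun setT (fun w => \sum_(j <- r) J j A w * c j).
  by apply: measurable_sum => j; exact: measurable_funM.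
have mKA := measurable_L0 (K A); have mi : measurable_fun setT (fun w =>
  c i * J i A w) by exact: measurable_funM.
apply: aeq_trans (LE A mA) _; first exact: measurable_L0.
- by apply: measurable_funD => //; exact: measurable_funM.
- by under eq_fun do rewrite big_cons; apply: measurable_funD => //; exact: measurable_funM.
rewrite [X in as_eq P X](_ : _ = fun w => c i * J i A w + K A w); last by apply/funext => w;
  rewrite mul1r.
rewrite [X in as_eq P _ X](_ : _ = fun w => c i * J i A w + \sum_(j <- r) J j A w * c j).
  by apply: aeqD => //; [exact: aeq_refl|exact: KE].
by apply/funext => w; rewrite big_cons mulrC.
Qed.

Context (g : S -> R) (g_dom : dominating mu g).

(** The differences [fn n - f] tend to 0 and are dominated by [2 * g]. *)
Lemma dominated_convergence_in_prob (fn : nat -> S -> R) (f : S -> R) (I : nat -> set S -> L0 P) J :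
  (forall n, measurable_fun setT (fn n)) -> measurable_fun setT f ->
  (forall n s, `|fn n s| <= g s) -> (forall s, `|f s| <= g s) ->
  (forall s, fn n s @[n --> \oo] --> f s) ->
  (forall n, is_indefinite_int mu (fn n) (I n)) -> is_indefinite_int mu f J ->
  tends (fun n => I n setT) (J setT).
Proof.
move=> mfn mf fng fg fnf fnI fJ e e0.
have /choice[K KP] n : exists K, is_indefinite_int mu (fun s =>
  fn n s - f s) K /\ forall A, measurable A ->
    aeq (K A) (fun w => 1 * I n A w + (-1) * J A w).
  by apply: (indefinite_int_lin mu_sm (fnI n) fJ) => s; rewrite mul1r mulN1r.
have [||||N HN] := dominated_cvg0 mu_sm (dominatingZ mu_sm (_ : 1 <= 2) g_dom) _ _ _ (fun n =>
  (KP n).1) e0.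
- by rewrite ler1n.
- by move=> n; exact: measurable_funB.
- by move=> n s; apply: le_trans (ler_normB _ _) _; rewrite mulr_natl mulr2n lerD.
- by move=> s; rewrite -(subrr (f s)); apply: cvgB; [exact: fnf|exact: cvg_cst].
exists N => n /HN; apply: small_aeq.
- exact: measurable_L0.
- by apply: measurable_funB; exact: measurable_L0.
have := (KP n).2 _ measurableT.
by rewrite [X in as_eq P _ X](_ : _ = fun w => I n setT w - J setT w)//; apply/funext => w;
  rewrite mul1r mulN1r.
Qed.

(* If [F n] had an integral of size [n.+1 * e], the integrals of [F n / n.+1] would
   contradict dominated convergence. *)
Lemma dominated_bounded_in_prob e : 0 < e -> exists c : R, forall (f : S -> R) I,
  measurable_fun setT f -> (forall s, `|f s| <= g s) -> is_indefinite_int mu f I ->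
  pr (fun w => c < `|I setT w|) <= e.
Proof.
move=> e0; apply: contrapT => /forallNP H.
have /choice[F FP] : forall n : nat, exists fI : (S -> R) * (set S -> L0 P),
    [/\ measurable_fun setT fI.1, forall s, `|fI.1 s| <= g s, is_indefinite_int mu fI.1 fI.2 &
      ~ (pr (fun w => n.+1%:R * e < `|fI.2 setT w|) <= e)].
  move=> n; apply: contrapT => nF; apply: (H (n.+1%:R * e)) => f I mf fg fI.
  by apply: contrapT => h; apply: nF; exists (f, I).
have /choice[K KP] n : exists K, is_indefinite_int mu (fun s => n.+1%:R^-1 * (F n).1 s) K /\
    forall A, measurable A -> aeq (K A) (fun w => n.+1%:R^-1 * (F n).2 A w + 0 * (F n).2 A w).
  have [_ _ fI _] := FP n.
  by apply: (indefinite_int_lin mu_sm fI fI) => s; rewrite mul0r addr0.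
have n0 n : 0 < n.+1%:R^-1 :> R by rewrite invr_gt0.
have [|||N HN] := dominated_cvg0 mu_sm g_dom _ _ _ (fun n => (KP n).1) e0.
- by move=> n; have [mf _ _ _] := FP n; exact: measurable_funM.
- move=> n s; have [_ fg _ _] := FP n; rewrite normrM gtr0_norm//.
  apply: le_trans (fg s); rewrite ler_piMl// invf_le1 ?ler1n//.
- move=> s; apply: (@squeeze_cvgr _ _ _ _ (fun n => - (n.+1%:R^-1 * g s)) (fun n =>
  n.+1%:R^-1 * g s)).
  + apply: nearW => n; have [_ fg _ _] := FP n.
    by rewrite -ler_norml normrM gtr0_norm// ler_pM2l.
  + by rewrite -oppr0 -(mul0r (g s)); apply: cvgN; apply: cvgMl; exact: cvg_harmonic.
  + by rewrite -(mul0r (g s)); apply: cvgMl; exact: cvg_harmonic.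
have [_ _ _] := FP N; apply.
have mI := measurable_L0 ((F N).2 setT); have mK := measurable_L0 (K N setT).
apply: le_trans (HN N (leqnn N)).
have m2 : measurable_fun setT (fun w => N.+1%:R^-1 * (F N).2 setT w + 0 * (F N).2 setT w).
  by apply: measurable_funD; exact: measurable_funM.
rewrite (pr_aeq_le e mK m2 ((KP N).2 _ measurableT)).
apply: pr_le; [exact: event_norm_lt|exact: event_norm_le|].
move=> w; rewrite mul0r addr0 normrM (gtr0_norm (n0 N)) => h.
by rewrite mulrC ler_pdivlMr// mulrC ltW.
Qed.

End DominatedConvergence.

(** * Jordan content *)

Section Boxes.
Context (R : realType) (d : nat).
Local Notation E := 'rV[R]_d.
Implicit Types (a b x y : E).

(** For [a <= b] the summands are the increments of the truncation of the breakpoints to [[a, b]],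
    so the sum telescopes. *)
Lemma breakpoint_sum (s : seq R) (a b : R) : sorted <=%R s -> a \in s -> b \in s ->
  Num.max 0 (b - a) = \sum_(j < (size s).-1) (s`_j.+1 - s`_j) * (a <= s`_j < b)%R%:R.
Proof.
move=> ss sa sb.
have mono i j : (i <= j)%N -> (j < size s)%N -> s`_i <= s`_j.
  move=> ij js; apply: (sorted_leq_nth le_trans le_refl 0 ss) => //.
  by rewrite inE; exact: leq_ltn_trans js.
have next (x : R) (j : nat) : x \in s -> (j < (size s).-1)%N -> s`_j < x -> s`_j.+1 <= x.
  move=> xs js jx; rewrite -(nth_index 0 xs); apply: (mono _ _); last by rewrite index_mem.
  rewrite ltnNge; apply/negP => h; move: jx; apply/negP; rewrite -leNgt.
  rewrite -(nth_index 0 xs); apply: (mono _ _) => //.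
  by rewrite (leq_trans js)// leq_pred.
have [ab|ba] := leP a b; last first.
  rewrite max_l ?big1//; last by rewrite subr_le0 ltW.
  by move=> j _; case: (boolP (_ <= _ < _)) => [/andP[h1 h2]|_]; [lra|rewrite mulr0].
pose clamp (x : R) := Num.min b (Num.max a x).
have clamp_lo (x : R) : x <= a -> clamp x = a.
  by move=> h; rewrite /clamp max_l// min_r.
have clamp_mid (x : R) : a <= x -> x <= b -> clamp x = x.
  by move=> h1 h2; rewrite /clamp max_r// min_r.
have clamp_hi (x : R) : b <= x -> clamp x = b.
  by move=> h; rewrite /clamp max_r ?min_l// (le_trans ab).
rewrite max_r ?subr_ge0//.
under eq_bigr => j _.
  rewrite (_ : _ * _ = clamp s`_j.+1 - clamp s`_j); last first.
    have js := ltn_ord j; have jS := mono j j.+1 (leqnSn j).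
    have {}jS : s`_j <= s`_j.+1 by apply: jS; rewrite -ltn_predRL.
    have [ja|ja] /= := ltP s`_j a.
      by rewrite mulr0 !clamp_lo ?subrr ?(ltW ja)//; exact: next.
    have [jb|jb] := ltP s`_j b.
      by rewrite mulr1 !clamp_mid ?(ltW jb)//; [exact: le_trans jS|exact: next].
    by rewrite mulr0 !clamp_hi ?subrr// (le_trans jb).
  over.
rewrite -(big_mkord xpredT (fun j => clamp s`_j.+1 - clamp s`_j)) telescope_sumr//.
have s0 : (0 < size s)%N by case: (s) sa.
rewrite clamp_hi; last first.
  by rewrite -[leLHS](nth_index 0 sb); apply: (mono _ _);
    rewrite ?prednK// -ltnS prednK// index_mem.
by rewrite clamp_lo// -[leRHS](nth_index 0 sa) mono// index_mem.
Qed.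

Lemma box_indicE a b x : \1_(box a b) x = \prod_i (a ord0 i <= x ord0 i < b ord0 i)%R%:R :> R.
Proof.
rewrite indicE; case: (boolP (x \in box a b)) => [/set_mem h|/negP h].
  by rewrite big1// => i _; rewrite h.
have [i hi] : exists i, ~~ (a ord0 i <= x ord0 i < b ord0 i).
  apply: contrapT => /forallNP H; apply: h; apply/mem_set => i.
  by apply: contrapT => /negP; exact: H.
by rewrite (bigD1 i)//= (negbTE hi) mul0r.
Qed.

(* On boxes with corners in the grid of breakpoints [s], the volume is a discrete
   measure carried by this grid; inequalities between sums of indicators thus pass
   to volumes. *)
Lemma box_volume_sum (s : seq R) a b : sorted <=%R s ->
  (forall i, a ord0 i \in s) -> (forall i, b ord0 i \in s) ->
  box_volume a b = \sum_(J : {ffun 'I_d -> 'I_(size s).-1})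
    (\prod_i (s`_(J i).+1 - s`_(J i))) * \1_(box a b) (\row_i s`_(J i)).
Proof.
move=> ss sa sb; rewrite /box_volume.
under eq_bigr do rewrite (breakpoint_sum ss (sa _) (sb _)).
rewrite bigA_distr_bigA; apply: eq_bigr => J _.
by rewrite big_split box_indicE; congr (_ * _); apply: eq_bigr => i _; rewrite mxE.
Qed.

Lemma box_volume_ge0 a b : 0 <= box_volume a b.
Proof. by apply: prodr_ge0 => i _; rewrite le_max lexx. Qed.

Lemma signed_volume_ge0 (I : finType) (a b : I -> E) (c : I -> R) :
  (forall x, 0 <= \sum_i c i * \1_(box (a i) (b i)) x) ->
  0 <= \sum_i c i * box_volume (a i) (b i).
Proof.
move=> H.
pose pts := [seq a u.1 ord0 u.2 | u <- enum {: I * 'I_d}] ++ [seq b u.1 ord0 u.2 | u <- enum {: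
  I * 'I_d}].
pose s := sort <=%R pts.
have ss : sorted <=%R s by exact/sort_sorted/le_total.
have sa i k : a i ord0 k \in s.
  by rewrite mem_sort mem_cat; apply/orP; left; apply/mapP; exists (i, k); rewrite ?mem_enum.
have sb i k : b i ord0 k \in s.
  by rewrite mem_sort mem_cat; apply/orP; right; apply/mapP; exists (i, k); rewrite ?mem_enum.
under eq_bigr do rewrite (box_volume_sum ss (sa _) (sb _)) mulr_sumr.
rewrite exchange_big; apply: sumr_ge0 => J _.
under eq_bigr do rewrite mulrCA.
rewrite -mulr_sumr; apply: mulr_ge0 => //; apply: prodr_ge0 => i _.
rewrite subr_ge0; apply: (sorted_leq_nth le_trans le_refl 0 ss) => //.
  by rewrite inE (leq_trans (ltn_ord _))// leq_pred.
by rewrite inE -ltn_predRL.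
Qed.

Lemma volume_le (I I' : finType) (a b : I -> E) (a' b' : I' -> E) :
  (forall x, \sum_i \1_(box (a i) (b i)) x <= \sum_i \1_(box (a' i) (b' i)) x :> R) ->
  \sum_i box_volume (a i) (b i) <= \sum_i box_volume (a' i) (b' i).
Proof.
move=> H.
pose glue (u : I -> E) (v : I' -> E) (k : I + I') := match k with inl i => u i | inr j => v j end.
pose c (k : I + I') : R := match k with inl i => -1 | inr j => 1 end.
have := @signed_volume_ge0 _ (glue a a') (glue b b') c.
rewrite !big_sumType /=; under [X in _ -> 0 <= X + _]eq_bigr do rewrite mulN1r.
under [X in _ -> 0 <= _ + X]eq_bigr do rewrite mul1r.
rewrite sumrN addrC subr_ge0; apply => x.
rewrite big_sumType /=; under eq_bigr do rewrite mulN1r.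
under [X in 0 <= _ + X]eq_bigr do rewrite mul1r.
by rewrite sumrN addrC subr_ge0.
Qed.

End Boxes.

(** * Jordan measurability through coverings and packings *)

Section Content.
Context (R : realType) (d : nat).
Local Notation E := 'rV[R]_d.
Implicit Types (a b x y : E) (A B Q : set E).

Lemma sum_indic_disjoint (I : finType) (X : I -> set E) A x : trivIset setT X ->
  (forall i, X i `<=` A) -> \sum_i \1_(X i) x <= \1_A x :> R.
Proof.
move=> tX XA; have [[i Xi]|none] := pselect (exists i, X i x).
  rewrite (bigD1 i)//= big1 ?addr0 => [|j ji].
    by rewrite !indicE !mem_set//; exact: XA Xi.
  rewrite indicE memNset// => Xj; move/eqP: ji; apply.
  by apply: tX => //; exists x.
rewrite big1 ?indicE// => i _; rewrite indicE memNset// => Xi.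
by apply: none; exists i.
Qed.

Lemma indic_le_sum (I : finType) (X : I -> set E) A x : A `<=` \bigcup_i X i ->
  \1_A x <= \sum_i \1_(X i) x :> R.
Proof.
move=> AX; rewrite {1}indicE; case: (boolP (x \in A)) => [/set_mem/AX[i _ Xi]|_].
  rewrite (bigD1 i)//= {1}indicE mem_set// lerDl.
  by apply: sumr_ge0 => j _; rewrite indicE.
by apply: sumr_ge0 => j _; rewrite indicE.
Qed.

Lemma boxI a b a' b' : box a b `&` box a' b' =
  box (\row_i Num.max (a ord0 i) (a' ord0 i)) (\row_i Num.min (b ord0 i) (b' ord0 i)).
Proof.
apply/seteqP; split=> x /=.
  move=> [h h'] i; have /andP[h1 h2] := h i; have /andP[h3 h4] := h' i.
  by rewrite !mxE ge_max h1 h3 lt_min h2 h4.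
move=> h; split=> i; have := h i; rewrite !mxE ge_max lt_min.
  by move=> /andP[/andP[-> _] /andP[-> _]].
by move=> /andP[/andP[_ ->] /andP[_ ->]].
Qed.

Lemma outer_content_le A n (a b : 'I_n -> E) : A `<=` \bigcup_i box (a i) (b i) ->
  outer_content A <= \sum_i box_volume (a i) (b i).
Proof.
move=> AX; apply: ge_inf; last by exists n, a, b.
exists 0 => _ [m [p [q [_ ->]]]]; apply: sumr_ge0 => i _; exact: box_volume_ge0.
Qed.

Lemma packing_le_covering A m n (p q : 'I_m -> E) (a b : 'I_n -> E) :
  \bigcup_i box (p i) (q i) `<=` A -> trivIset setT (fun i => box (p i) (q i)) ->
  A `<=` \bigcup_i box (a i) (b i) ->
  \sum_i box_volume (p i) (q i) <= \sum_i box_volume (a i) (b i).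
Proof.
move=> XA tX AX; apply: volume_le => x; apply: le_trans (indic_le_sum x AX).
by apply: sum_indic_disjoint => // i; apply: subset_trans XA => y Xy; exists i.
Qed.

Lemma bounded_cube A : bounded_set A ->
  exists L : nat, A `<=` box (const_mx (- L%:R)) (const_mx L%:R).
Proof.
move=> [M [_ HM]]; exists (Num.bound `|M + 1|) => x Ax i.
have ML := le_lt_trans (ler_norm (M + 1)) (archi_boundP (normr_ge0 (M + 1))).
have : `|x| <= M + 1 by apply: HM => //; rewrite ltrDl.
rewrite [leLHS]/Num.norm /= mx_normrE => h; rewrite !mxE.
have := le_trans (le_bigmax _ (fun ij : 'I_1 * 'I_d => `|x ij.1 ij.2|) (ord0, i)) h.
by rewrite /= ler_norml => /andP[h1 h2]; apply/andP; split; lra.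
Qed.

(** Coverings and packings within [e / 2] of the infimum and the supremum. These are genuine bounds
    because a cube covers [A] and the empty packing is admissible. *)
Lemma jordan_gap A : jordan_measurable A -> forall e, 0 < e ->
  exists n (a b : 'I_n -> E) m (p q : 'I_m -> E),
    [/\ A `<=` \bigcup_i box (a i) (b i), \bigcup_i box (p i) (q i) `<=` A,
      trivIset setT (fun i => box (p i) (q i)),
      \sum_i box_volume (a i) (b i) <= \sum_i box_volume (p i) (q i) + e &
      outer_content A <= \sum_i box_volume (p i) (q i) + e].
Proof.
move=> [bA ioA] e e0; have e2 : 0 < e / 2 by rewrite divr_gt0.
have [L A0] := bounded_cube bA; set a0 := const_mx _ in A0; set b0 := const_mx _ in A0.
have A0' : A `<=` \bigcup_(i : 'I_1) box a0 b0 by move=> x /A0; exists ord0.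
have [|v [n [a [b [AX ->]]]] hv] := @inf_adherent R [set v | exists (n : nat) (a b : 'I_n -> E),
    A `<=` \bigcup_i box (a i) (b i) /\ v = \sum_(i < n) box_volume (a i) (b i)] _ e2.
  split; first by exists (\sum_(i < 1) box_volume a0 b0), 1%N, (fun=> a0), (fun=> b0).
  by exists 0 => _ [m [p [q [_ ->]]]]; apply: sumr_ge0 => i _; exact: box_volume_ge0.
have [|v' [m [p [q [XA tX ->]]]] hv'] := @sup_adherent R [set v | exists (n : nat) (a b : 'I_n
  -> E),
    [/\ \bigcup_i box (a i) (b i) `<=` A,
        trivIset setT (fun i => box (a i) (b i)) &
        v = \sum_(i < n) box_volume (a i) (b i)]] _ e2.
  split.
    exists 0, 0%N, (fun=> 0), (fun=> 0); split; last by rewrite big_ord0.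
      by move=> x [[]].
    by move=> [].
  exists (\sum_(i < n) box_volume (a i) (b i)) => _ [k [p [q [XA tX ->]]]].
  exact: packing_le_covering XA tX AX.
exists n, a, b, m, p, q; move: ioA hv hv'; rewrite /inner_content.
set s := sup _; rewrite /outer_content; set t := inf _ => ioA hv hv'.
by split => //; lra.
Qed.

Lemma jordan_gapP A : bounded_set A -> (forall e, 0 < e ->
  exists n (a b : 'I_n -> E) m (p q : 'I_m -> E),
    [/\ A `<=` \bigcup_i box (a i) (b i), \bigcup_i box (p i) (q i) `<=` A,
      trivIset setT (fun i => box (p i) (q i)) &
      \sum_i box_volume (a i) (b i) <= \sum_i box_volume (p i) (q i) + e]) -> jordan_measurable A.
Proof.
move=> bA H; split => //; apply/eqP; rewrite eq_le; apply/andP; split; last first.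
  apply/ler_addgt0Pr => e e0; have [n [a [b [m [p [q [AX XA tX h]]]]]]] := H e e0.
  apply: le_trans (outer_content_le AX) _; apply: le_trans h _; rewrite lerD2r.
  apply: ub_le_sup; last by exists m, p, q.
  exists (\sum_(i < n) box_volume (a i) (b i)) => _ [k [p' [q' [XA' tX' ->]]]].
  exact: packing_le_covering XA' tX' AX.
have [L A0] := bounded_cube bA; set a0 := const_mx _ in A0; set b0 := const_mx _ in A0.
have A0' : A `<=` \bigcup_(i : 'I_1) box a0 b0 by move=> x /A0; exists ord0.
apply: ge_sup.
  exists 0, 0%N, (fun=> 0), (fun=> 0); split; last by rewrite big_ord0.
    by move=> x [[]].
  by move=> [].
move=> _ [m [p [q [XA tX ->]]]]; apply: lb_le_inf.
  by exists (\sum_(i < 1) box_volume a0 b0), 1%N, (fun=> a0), (fun=> b0).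
by move=> _ [n [a [b [AX ->]]]]; exact: packing_le_covering XA tX AX.
Qed.

(** Intersecting all boxes with [box a b] does not widen the gap: covering count minus packing count
    is nonnegative at every point, so restricting it to a box decreases it, and [volume_le] carries
    this comparison to volumes. *)
Lemma jordan_measurable_box A a b : jordan_measurable A -> jordan_measurable (A `&` box a b).
Proof.
move=> jA; have [bA _] := jA; apply: jordan_gapP.
  by have [M [Mr HM]] := bA; exists M; split => // N MN x [Ax _]; exact: HM N MN x Ax.
move=> e e0; have [n [u [v [m [p [q [AX XA tX gap _]]]]]]] := jordan_gap jA e0.
pose lo (w : E) : E := \row_i Num.max (w ord0 i) (a ord0 i).
pose hi (w : E) : E := \row_i Num.min (w ord0 i) (b ord0 i).
have boxE w z : box (lo w) (hi z) = box w z `&` box a b by rewrite boxI.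
exists n, (lo \o u), (hi \o v), m, (lo \o p), (hi \o q); split.
- by move=> x [/AX[i _ h] Qx]; exists i => //=; rewrite boxE.
- by move=> x [i _] /=; rewrite boxE => -[h Qx]; split => //; apply: XA; exists i.
- apply: sub_trivIset (@subset_refl _ _) _ => i j _ _ [x [/=]]; rewrite !boxE => -[h _] [h' _].
  by apply: tX => //; exists x.
pose glue k l (f : 'I_k -> E) (g : 'I_l -> E) (i : 'I_k + 'I_l) := match i with inl i =>
  f i | inr j => g j end.
have := @volume_le R d _ _ (glue _ _ (lo \o u) p) (glue _ _ (hi \o v) q) (glue _ _ u (lo \o p))
  (glue _ _ v (hi \o q)).
rewrite !big_sumType /= => H.
suff : \sum_i box_volume (lo (u i)) (hi (v i)) + \sum_i box_volume (p i) (q i) <=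
  \sum_i box_volume (u i) (v i) + \sum_i box_volume (lo (p i)) (hi (q i)).
  by move=> h; move: h gap => /=; lra.
apply: H => x; rewrite !big_sumType /=.
under eq_bigr do rewrite boxE indicI.
under [X in _ <= _ + X]eq_bigr do rewrite boxE indicI.
rewrite -!mulr_suml.
have : \sum_i \1_(box (p i) (q i)) x <= \sum_i \1_(box (u i) (v i)) x :> R.
  apply: le_trans (indic_le_sum x AX).
  by apply: sum_indic_disjoint => // i; apply: subset_trans XA => y Xy; exists i.
rewrite [\1_(box a b) x]indicE; case: (_ \in _) => h.
  by rewrite !mulr1.
by rewrite !mulr0 add0r addr0.
Qed.

End Content.

(** * Contents of cells and existence of fine partitions *)

Section Partitions.
Context (R : realType) (d : nat).
Local Notation E := 'rV[R]_d.
Implicit Types (a b x y : E) (A B Q : set E).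

Lemma box_interior_point a b x : box a b x ->
  interior (box a b) (\row_i ((a ord0 i + b ord0 i) / 2)).
Proof.
move=> abx; set y := \row_i _.
pose r := \big[Num.min/1]_i ((b ord0 i - a ord0 i) / 2).
have r0 : 0 < r.
  by apply: lt_bigmin => // i _; have /andP[h1 h2] := abx i; rewrite divr_gt0//; lra.
apply/nbhs_ballP; exists r => //= z; rewrite mx_norm_ball /ball_ /= => yz i.
have : `|(y - z) ord0 i| < (b ord0 i - a ord0 i) / 2.
  apply: lt_le_trans (bigmin_le 1 i (fun i => (b ord0 i - a ord0 i) / 2)); apply: le_lt_trans yz.
  rewrite [leRHS]/Num.norm /= mx_normrE.
  exact: (le_bigmax _ (fun ij : 'I_1 * 'I_d => `|(y - z) ij.1 ij.2|) (ord0, i)).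
by rewrite !mxE ltr_norml => /andP[h1 h2]; apply/andP; split; lra.
Qed.

(** The intersection of two boxes is a box, and a nonempty box has an interior point. *)
Lemma interior_disjoint_boxes A A' a b a' b' : A° `&` A'° = set0 ->
  box a b `<=` A -> box a' b' `<=` A' -> box a b `&` box a' b' = set0.
Proof.
move=> AA' bA bA'; apply/seteqP; split=> // x xI; exfalso.
pose u : E := \row_i Num.max (a ord0 i) (a' ord0 i).
pose v : E := \row_i Num.min (b ord0 i) (b' ord0 i).
have uvx : box u v x by rewrite -boxI.
have := box_interior_point uvx; rewrite -boxI interiorI => -[h h'].
have : (A° `&` A'°) (\row_i ((u ord0 i + v ord0 i) / 2)).
  by split; [exact: interiorS bA _ h|exact: interiorS bA' _ h'].
by rewrite AA'.
Qed.

(** Cells may overlap outside their interiors, but boxes packed into different cells cannot.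
    Packings that nearly exhaust the cells thus form together one packing of a cube containing
    [B]. *)
Lemma content_sum_bounded B : bounded_set B -> exists C : R, forall p : tagged_partition B,
  \sum_(i < tp_size p) jordan_content (tp_cell i) <= C.
Proof.
move=> bB; have [L BL] := bounded_cube bB; set a0 := const_mx _ in BL; set b0 := const_mx _ in BL.
exists (\sum_(i < 1) box_volume a0 b0) => p; apply/ler_addgt0Pr => e e0.
(* The successor covers the partition without cells. *)
pose n := tp_size p; pose del : R := e / n.+1%:R.
have del0 : 0 < del by rewrite divr_gt0.
have packing (i : 'I_n) : exists w : {m : nat & (('I_m -> E) * ('I_m -> E))%type},
    [/\ \bigcup_j box ((tagged w).1 j) ((tagged w).2 j) `<=` tp_cell i,
      trivIset setT (fun j => box ((tagged w).1 j) ((tagged w).2 j)) &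
      outer_content (tp_cell i) <= \sum_j box_volume ((tagged w).1 j) ((tagged w).2 j) + del].
  have [_ [_ [_ [m [u [v [_ uvA tuv _ h]]]]]]] := jordan_gap (tp_jordan i) del0.
  by exists (existT _ m (u, v)).
have /choice[w wP] : forall i : 'I_n, _ := packing.
pose uv i := tagged (w i).
have uvP i : [/\ \bigcup_j box ((uv i).1 j) ((uv i).2 j) `<=` tp_cell i,
    trivIset setT (fun j => box ((uv i).1 j) ((uv i).2 j)) &
    outer_content (tp_cell i) <= \sum_j box_volume ((uv i).1 j) ((uv i).2 j) + del] := wP i.
apply: (@le_trans _ _ (\sum_(i < n) (\sum_j box_volume ((uv i).1 j) ((uv i).2 j) + del))).
  by apply: ler_sum => i _; have [_ _ h] := uvP i.
rewrite big_split lerD //=; last first.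
  rewrite sumr_const card_ord -[leLHS]mulr_natr /del mulrAC ler_pdivrMr// ler_pM2l//.
  by rewrite ler_nat.
rewrite (sig_big_dep (fun=> true) (fun _ _ => true) (fun i j =>
  box_volume ((uv i).1 j) ((uv i).2 j))) /=.
apply: volume_le => x; rewrite big_ord1; apply: sum_indic_disjoint.
  move=> [i j] [i' j'] _ _ /= [y [h h']].
  have [uvi ti _] := uvP i; have [uvi' ti' _] := uvP i'.
  have ii' : i = i'.
    apply/eqP; apply: contrapT => /negP neq.
    have : (box ((uv i).1 j) ((uv i).2 j) `&` box ((uv i').1 j') ((uv i').2 j')) y by [].
    rewrite (interior_disjoint_boxes (tp_interior neq))//.
      by apply: subset_trans uvi => z; exists j.
    by apply: subset_trans uvi' => z; exists j'.
  by subst i'; congr existT; apply: ti => //; exists y.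
move=> [i j] /= y h; apply: BL; rewrite -(tp_cover p); exists i => //.
by have [uvi _ _] := uvP i; apply: uvi; exists j.
Qed.

Section Grid.
Context (B : set E) (L : nat) (BL : B `<=` box (const_mx (- L%:R)) (const_mx L%:R)).
Context (jB : jordan_measurable B) (N : nat).
Local Notation K := (L.*2 * N.+1)%N.
Let corner (J : {ffun 'I_d -> 'I_K}) (k : nat) : E := \row_i ((J i + k)%:R / N.+1%:R - L%:R).
Let cube J := box (corner J 0) (corner J 1).

Let N0 : 0 < N.+1%:R :> R. Proof. by rewrite ltr0n. Qed.

Let cubeP J x : cube J x <-> forall i, (J i)%:R <= (x ord0 i + L%:R) * N.+1%:R < (J i).+1%:R.
Proof.
have H i : ((J i + 0)%:R / N.+1%:R - L%:R <= x ord0 i < (J i + 1)%:R / N.+1%:R - L%:R) =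
  ((J i)%:R <= (x ord0 i + L%:R) * N.+1%:R < (J i).+1%:R).
  by rewrite lerBlDr ltrBrDr ler_pdivrMr// ltr_pdivlMr// addn0 addn1.
by split=> h i; have := h i; rewrite ?mxE ?H.
Qed.

Let cube_unique J J' x : cube J x -> cube J' x -> J = J'.
Proof.
move=> /cubeP h /cubeP h'; apply/ffunP => i; apply: ord_inj.
by rewrite -(truncn_def (h i)) -(truncn_def (h' i)).
Qed.

Let cube_cover x : B x -> exists J, cube J x.
Proof.
move=> /BL xL; pose t i := (x ord0 i + L%:R) * N.+1%:R.
have t0 i : 0 <= t i.
  by have := xL i; rewrite !mxE => /andP[h _]; rewrite mulr_ge0//; lra.
have tK i : (Num.trunc (t i) < K)%N.
  rewrite truncn_lt_nat// natrM ltr_pM2r// -addnn natrD.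
  by have := xL i; rewrite !mxE => /andP[_ h]; lra.
exists [ffun i => Ordinal (tK i)]; apply/cubeP => i; rewrite ffunE /=.
exact: truncn_itv.
Qed.

Let diam_cube J x y : cube J x -> cube J y -> eucl_dist x y <= Num.sqrt d%:R / N.+1%:R.
Proof.
move=> /cubeP hx /cubeP hy.
have h i : (x ord0 i - y ord0 i) ^+ 2 <= N.+1%:R^-1 ^+ 2.
  have /andP[x1 x2] := hx i; have /andP[y1 y2] := hy i.
  have {}x2 : (x ord0 i + L%:R) * N.+1%:R < (J i)%:R + 1 by rewrite natr1.
  have {}y2 : (y ord0 i + L%:R) * N.+1%:R < (J i)%:R + 1 by rewrite natr1.
  have : `|(x ord0 i - y ord0 i) * N.+1%:R| <= 1.
    by rewrite ler_norml; apply/andP; split; rewrite -subr_ge0; lra.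
  rewrite normrM [X in _ * X]gtr0_norm// -ler_pdivlMr// mul1r => le_h.
  by rewrite -[leLHS]real_normK ?num_real// lerXn2r// nnegrE// invr_ge0 ltW.
have -> : Num.sqrt d%:R / N.+1%:R = Num.sqrt (d%:R * N.+1%:R^-1 ^+ 2) :> R.
  by rewrite sqrtrM// sqrtr_sqr ger0_norm// invr_ge0 ltW.
rewrite /eucl_dist ler_wsqrtr//; apply: le_trans (ler_sum _ (fun i _ => h i)) _.
by rewrite sumr_const card_ord mulr_natl.
Qed.

Lemma grid_partition : exists p : tagged_partition B, 0 <= mesh p <= Num.sqrt d%:R / N.+1%:R.
Proof.
(* Only cubes that meet [B] are kept, because every cell must contain its tag. *)
pose X := [set J | `[< exists x, (B `&` cube J) x >]]%SET.
pose cell (i : 'I_#|X|) := B `&` cube (enum_val i).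
have /choice[tag tagP] (i : 'I_#|X|) : exists x, cell i x.
  by have := enum_valP i; rewrite inE => /asboolP.
have cell_cover : \bigcup_i cell i = B.
  apply/seteqP; split=> [x [i _ []]//|x Bx]; have [J Jx] := cube_cover Bx.
  have XJ : J \in X by rewrite inE; apply/asboolP; exists x.
  by exists (enum_rank_in XJ J) => //; rewrite /cell enum_rankK_in.
have cell_jordan i : jordan_measurable (cell i) by exact: jordan_measurable_box.
have cell_interior i j : i != j -> (cell i)° `&` (cell j)° = set0.
  move=> ij; apply/seteqP; split=> // x [/interior_subset[_ xi] /interior_subset[_ xj]].
  by move/eqP: ij; apply; apply: enum_val_inj; exact: cube_unique xi xj.
exists (TaggedPartition cell_cover cell_jordan cell_interior tagP).
have r0 : 0 <= Num.sqrt d%:R / N.+1%:R :> R by rewrite divr_ge0.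
apply/andP; split; first exact: bigmax_ge_id.
apply: bigmax_le => // i _ /=; apply: ge_sup.
  by exists (eucl_dist (tag i) (tag i)), (tag i, tag i) => //; split; exact: tagP.
by move=> _ [[x y] /= [[_ xi] [_ yi]] <-]; exact: diam_cube xi yi.
Qed.

End Grid.

(** Without a fine sequence the conditions that define both Riemann integrals would be vacuous and
    determine no value. *)
Lemma exists_fine_partitions B : jordan_measurable B ->
  exists p : nat -> tagged_partition B, fine_partitions p.
Proof.
move=> jB; have [L BL] := bounded_cube jB.1.
have /choice[p pP] := grid_partition BL jB.
exists p; apply: (@squeeze_cvgr _ _ _ _ (fun=> 0) (fun n => Num.sqrt d%:R * n.+1%:R^-1)).
- by apply: nearW => n; exact: pP.
- exact: cvg_cst.
- rewrite -(mulr0 (Num.sqrt d%:R)); apply: cvgMr; exact: cvg_harmonic.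
Qed.

End Partitions.

(** * Convergence and boundedness of Riemann sums *)

Section RiemannIntegral.
Context (R : realType) (d : nat).
Local Notation E := 'rV[R]_d.
Implicit Types (B : set E).

Lemma cvg_interleave (u : nat -> R) (v : nat -> R) (l : R) :
  u n @[n --> \oo] --> l -> v n @[n --> \oo] --> l ->
  (if odd n then u n./2 else v n./2) @[n --> \oo] --> l.
Proof.
move=> /cvgrPdist_le ul /cvgrPdist_le vl; apply/cvgrPdist_le => e e0.
have [N _ HN] := ul e e0; have [M _ HM] := vl e e0.
exists (maxn N M).*2 => // n /= Nn.
have : (maxn N M <= n./2)%N by rewrite -(doubleK (maxn N M)) half_leq.
by rewrite geq_max => /andP[h h']; case: ifP => _; [exact: HN|exact: HM].
Qed.

(** Integrability gives each fine sequence a limit of its own; interleaving it with a fixed sequence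
    [p0] shows that the limits agree. *)
Lemma riemann_int_cvg B (f : E -> R) (p : nat -> tagged_partition B) :
  jordan_measurable B -> riemann_integrable B f -> fine_partitions p ->
  riemann_sum f (p n) @[n --> \oo] --> riemann_int B f.
Proof.
move=> jB [_ intf]; rewrite /riemann_int; case: xgetP => [I _|none]; first exact.
have [p0 fp0] := exists_fine_partitions jB; have [I p0I] := intf p0 fp0.
exfalso; apply: (none I) => {}p fp.
pose q n := if odd n then p n./2 else p0 n./2.
have fq : fine_partitions q.
  rewrite /fine_partitions /q (_ : (fun n => _) = fun n =>
    if odd n then mesh (p n./2) else mesh (p0 n./2)).
    exact: (@cvg_interleave (fun n => mesh (p n)) (fun n => mesh (p0 n)) 0 fp fp0).
  by apply/funext => n; case: ifP.
have [J qJ] := intf q fq.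
have sub (k : nat -> nat) : (forall n, (n <= k n)%N) -> riemann_sum f (q (k n)) @[n --> \oo] --> J.
  move=> kn; apply: (cvg_comp _ _ _ qJ) => A [N _ NA].
  by exists N => // n /= Nn; apply: NA; exact: leq_trans (kn n).
have -> : I = J.
  have := sub double (fun n => _); rewrite (_ : (fun n => _) = fun n => riemann_sum f (p0 n)).
    move=> h; apply: (cvg_unique _ p0I) => //; apply: h => n.
    by rewrite -addnn leq_addr.
  by apply/funext => n; rewrite /q odd_double doubleK.
have := sub (fun n => n.*2.+1) (fun n => _);
  rewrite (_ : (fun n => _) = fun n => riemann_sum f (p n)).
  by apply => n; rewrite leqW// -addnn leq_addr.
by apply/funext => n; rewrite /q /= odd_double /= uphalf_double.
Qed.

Lemma jordan_content_ge0 B : 0 <= jordan_content B.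
Proof.
have lb : lbound [set v | exists (n : nat) (a b : 'I_n -> E),
    B `<=` \bigcup_i box (a i) (b i) /\ v = \sum_(i < n) box_volume (a i) (b i)] (0 : R).
  by move=> _ [m [p [q [_ ->]]]]; apply: sumr_ge0 => i _; exact: box_volume_ge0.
have [ne|/nonemptyPn e] := pselect ([set v | exists (n : nat) (a b : 'I_n -> E),
    B `<=` \bigcup_i box (a i) (b i) /\ v = \sum_(i < n) box_volume (a i) (b i)] !=set0).
  exact: lb_le_inf.
(* If no finite covering exists, the infimum is that of the empty set, which is 0 by convention. *)
by rewrite /jordan_content /outer_content e inf0.
Qed.

Lemma tag_in B (p : tagged_partition B) (i : 'I_(tp_size p)) : B (tp_tag i).
Proof.
have : (\bigcup_(j : 'I_(tp_size p)) tp_cell j) (tp_tag i) by exists i => //; exact: tp_tagP.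
by have /seteqP[+ _] := tp_cover p; apply.
Qed.

(** [C] bounds the total content of the cells of any partition; it is kept at least 1 because
    [dominatingZ] scales by such factors. *)
Lemma riemann_sum_bounded B : jordan_measurable B -> exists2 C : R, 1 <= C &
  forall (f : E -> R) (p : tagged_partition B) (b : R),
    (forall x, B x -> `|f x| <= b) -> 0 <= b -> `|riemann_sum f p| <= C * b.
Proof.
move=> [bB _]; have [C CP] := content_sum_bounded bB.
exists (Num.max 1 C) => [|f p b fb b0]; first by rewrite le_max lexx.
apply: le_trans (ler_norm_sum _ _ _) _.
apply: (@le_trans _ _ (\sum_(i < tp_size p) b * jordan_content (tp_cell i))).
  apply: ler_sum => i _; rewrite normrM [X in _ * X]ger0_norm ?jordan_content_ge0//.
  by rewrite ler_wpM2r ?jordan_content_ge0// fb//; exact: tag_in.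
by rewrite -mulr_sumr mulrC ler_wpM2r// le_max CP orbT.
Qed.

End RiemannIntegral.

(** * Interchange of the two integrals *)

Lemma jointly_measurable_section (R : realType) (d : nat) (dS : measure_display) (S :
  measurableType dS)
    (B : set 'rV[R]_d) (h : 'rV[R]_d -> S -> R) x : jointly_measurable B h -> B x ->
  measurable_fun setT (h x).
Proof.
move=> hm Bx _ Y mY; have [C mC CE] := hm Y mY; rewrite setTI.
rewrite (_ : _ @^-1` _ = xsection C x); first exact: measurable_xsection.
apply/seteqP; split=> s; rewrite /xsection /= inE => h1.
  by have : ((B `*` setT) `&` [set xs | Y (h xs.1 xs.2)]) (x, s) by []; rewrite CE => -[].
by have : ((B `*` setT) `&` C) (x, s) by []; rewrite -CE => -[].
Qed.

Theorem theorem4p1 (R : realType) (dO dS : measure_display)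
    (Omega : measurableType dO) (P : probability Omega R)
    (S : measurableType dS) (mu : set S -> L0 P)
    (d : nat) (B : set 'rV[R]_d) (h : 'rV[R]_d -> S -> R) (g : S -> R)
    (P_complete : measure_is_complete P)
    (mu_sm : stochastic_measure mu)
    (B_jordan : jordan_measurable B)
    (h_meas : jointly_measurable B h)
    (h_riemann : forall s, riemann_integrable B (fun x => h x s))
    (h_le_g : forall x s, B x -> `|h x s| <= g s)
    (g_int : sm_integrable mu g) :
  let xi : 'rV[R]_d -> L0 P := fun x => sm_int mu setT (h x) in
  [/\ (forall x, B x -> sm_integrable mu (h x)),
      rf_integrable B xi,
      sm_integrable mu (fun s => riemann_int B (fun x => h x s)) &
      rf_int B xi = sm_int mu setT (fun s => riemann_int B (fun x => h x s))].
Proof.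
move=> xi; have g_dom := integrable_dominating mu_sm g_int.
have mh x : B x -> measurable_fun setT (h x) := jointly_measurable_section h_meas.
(* [g] may take negative values if [B] is empty, hence the absolute value. *)
have hg x s : B x -> `|h x s| <= `|g s|.
  by move=> Bx; apply: le_trans (h_le_g x s Bx) (ler_norm _).
have h_int x : B x -> sm_integrable mu (h x).
  by move=> Bx; apply: (dominated_integrable mu_sm g_dom (mh x Bx)) => s; exact: hg.
have /choice[J JP] x : exists I : set S -> L0 P, B x -> is_indefinite_int mu (h x) I.
  have [Bx|nB] := pselect (B x); last by exists (fun=> L0_zero P).
  by have [_ [I hI]] := h_int x Bx; exists I.
have xiE x : B x -> xi x = J x setT by move=> Bx; rewrite -(sm_intE mu_sm (JP x Bx) measurableT).
have [C C1 CP] := riemann_sum_bounded B_jordan.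
pose G s := C * `|g s|; have G_dom : dominating mu G := dominatingZ mu_sm C1 g_dom.
pose F s := riemann_int B (h^~ s).
pose Sn (p : tagged_partition B) s := riemann_sum (h^~ s) p.
have mSn p : measurable_fun setT (Sn p).
  apply: measurable_sum => i; apply: measurable_funM => //; exact: (mh _ (tag_in i)).
have SnG p s : `|Sn p s| <= G s by apply: CP => // x Bx; exact: hg.
have SnF p : fine_partitions p -> forall s, Sn (p n) s @[n --> \oo] --> F s.
  by move=> fp s; exact: riemann_int_cvg.
(* One fine sequence exhibits [F] as a pointwise limit, hence measurable and bounded by [G]; it also
   decides the value of [rf_int] at the end. *)
have [p0 fp0] := exists_fine_partitions B_jordan.
have mF : measurable_fun setT F by apply: (measurable_fun_cvg (fun n => mSn (p0 n))) => s _;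
  exact: SnF.
have FG s : `|F s| <= G s.
  have c : `|Sn (p0 n) s| @[n --> \oo] --> `|F s| by apply: cvg_norm; exact: SnF.
  rewrite -(cvg_lim _ c)//.
  by apply: limr_le; [apply/cvg_ex; eexists; exact: c|exact: nearW].
have F_int := dominated_integrable mu_sm G_dom mF FG.
have [_ [I FI]] := F_int.
have lim (p : nat -> tagged_partition B) : fine_partitions p -> cvg_in_prob P (fun n =>
  random_riemann_sum xi (p n)) (I setT).
  move=> fp.
  have /choice[K KP] n : exists K, is_indefinite_int mu (Sn (p n)) K /\ forall A, measurable A ->
      as_eq P (K A) (fun w => \sum_(i < tp_size (p n)) J (tp_tag i) A w * jordan_content
        (tp_cell i)).
    by apply: (indefinite_int_sum mu_sm) => i; exact: (JP _ (tag_in i)).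
  have KI := dominated_convergence_in_prob mu_sm G_dom (fun n => mSn (p n)) mF
    (fun n => SnG (p n)) FG (SnF p fp) (fun n => (KP n).1) FI.
  have mr n : measurable_fun setT (random_riemann_sum xi (p n)).
    by apply: measurable_sum => i; apply: measurable_funM => //; exact: measurable_L0.
  apply/(cvg_in_probP P mr (measurable_L0 (I setT))).
  apply: (tends_aeq (fun n => measurable_L0 (K n setT)) mr (measurable_L0 (I setT))
    (measurable_L0 (I setT)) _ (aeq_refl _ _) KI).
  move=> n; have := (KP n).2 _ measurableT.
  rewrite (_ : random_riemann_sum xi (p n) = fun w =>
    \sum_(i < tp_size (p n)) J (tp_tag i) setT w * jordan_content (tp_cell i))//.
  by apply/funext => w; apply: eq_bigr => i _; rewrite xiE//; exact: tag_in.
split=> //.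
  split=> [p fp|e e0]; first by exists (I setT); exact: lim.
  have [c cP] := dominated_bounded_in_prob mu_sm g_dom e0.
  exists c => x Bx; rewrite P_pr; last by apply: event_norm_lt; exact: measurable_L0.
  by rewrite lee_fin xiE//; apply: cP (mh x Bx) _ (JP x Bx) => s; exact: hg.
rewrite (sm_intE mu_sm FI measurableT) /rf_int; case: xgetP => [X _ XP|/(_ (I setT))]; last by case.
(* The value chosen in [rf_int] and [I setT] are both limits in probability along [p0], hence equal
   as classes. *)
have mr n : measurable_fun setT (random_riemann_sum xi (p0 n)).
  by apply: measurable_sum => i; apply: measurable_funM => //; exact: measurable_L0.
apply: L0_ext; have mX := measurable_L0 X; have mI := measurable_L0 (I setT).
apply: (tends_unique mr mX mI); first exact/(cvg_in_probP P mr mX)/XP.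
exact/(cvg_in_probP P mr mI)/lim.
Qed.
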